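(* Let $k$ be an infinite field, $R=k[x,y]$, and let $d\le j$ be positive integers. There is an isomorphism $\beta$ of partially ordered sets from the set $\mathcal H(d,j)$ of acceptable $O$-sequences for $(d,j)$, under the partial order $\mathcal P=\mathcal P(d,j)$, to the partially ordered set $\mathcal{PA}(d,j)$, under the product of the majorization partial orders. The isomorphism is given by $\beta(H)=(P,Q)$, where $P=P(H)=A(H)^\ast$ and $Q=Q(H)=B(H)^\ast$. This is the same order as is induced by specialization (closure) of the strata $\mathrm{Grass}(H)=\mathrm{Grass}_H(d,j)$.
   Context: $R=k[x,y]$ has the standard grading; $R_i$ is the space of degree-$i$ forms. For a subspace $V\subset R_j$ and $i\ge0$, $R_iV=\mathrm{span}\{hf: h\in R_i, f\in V\}$ and $R_{-i}V=\{f\in R_{j-i}: R_i f\subset V\}$. The ancestor ideal of $V$ is $\overline V=(V)\oplus R_{-1}V\oplus\cdots\oplus R_{-j}V$, where $(V)$ is the ideal generated by $V$. $H(A)_i=\dim_kA_i$. A proper $O$-sequence is a sequence $H=(1,2,\ldots,\mu,H_\mu,H_{\mu+1},\ldots)$ of non-negative integers with $\mu=\min\{i: H_i<i+1\}$ a positive integer, $\mu\ge H_\mu\ge H_{\mu+1}\ge\cdots$, and $c_H=\lim_{i\to\infty} H_i$. Put $e_i=H_{i-1}-H_i$ ($i\ge1$), $e_0=-1$. $H$ is acceptable for $(d,j)$ if: $e_i\le e_{i+1}$ for $0\le i\le j$; $e_i\ge e_{i+1}$ for $i\ge j$; $\sum_{0\le i\le j}(e_i+1)=d$; $\sum_{i>j}e_i=(j+1-d)-c_H$;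 and $0\le e_j=e_{j+1}\le\min\{j+1-d,d-1\}$. These are exactly the Hilbert functions $H(R/\overline V)$ that occur for $d$-dimensional $V\subset R_j$. The partial order $\mathcal P(d,j)$: $H'\ge_{\mathcal P}H$ means $H'_i\le H_i$ for all $i\le j$ and $H'_i\ge H_i$ for all $i\ge j$. $P(H)=(e_j+1,e_{j-1}+1,\ldots,e_\mu+1)$, a partition of $d$, and $Q(H)=(e_{j+1},e_{j+2},\ldots)$ (zeros omitted), a partition of $j+1-d-c_H$. Here $A^\ast$ denotes the dual (conjugate) partition of $A$. The partitions $A(H)=(a_1\ge\cdots\ge a_\tau)$ and $B(H)=(b_1\ge\cdots\ge b_{\tau-1})$, with $\tau=e_j+1$, are those for which, for any $V$ with $H(R/\overline V)=H$, the minimal graded free resolution of $R/\overline V$ has generator degrees $j+1-a_i$ and relation degrees $j+1+b_i$; they depend only on $H$. $\mathcal{PA}(d,j)$ is the set of pairs of partitions $(P,Q)$ such that $P$ partitions $d$, $Q$ partitions an integer no greater than $j+1-d$ (the empty partition of $0$, with largest part $0$, being allowed), and the largest part $p_1$ of $P$ and the largest part $q_1$ of $Q$ satisfy $p_1=q_1+1$. Its order is: $(P,Q)\le(P',Q')$ if both $P\le P'$ and $Q\le Q'$ in the respective majorization partial orders. Majorization order: for partitions $D=(d_1\ge d_2\ge\cdots\ge d_s)$, $D'=(d'_1\ge\cdots\ge d'_{s'})$, with $|D|$ the sum of the parts, $D'\ge D$ means $|D'|\ge|D|$ and $\sum_{u\le i}d'_u\ge\sum_{u\le i}d_u$ for all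 $1\le i\le\min\{s,s'\}$. $\mathrm{Grass}_H(d,j)$ is the locally closed subscheme of the Grassmannian $\mathrm{Grass}(d,R_j)$ of $d$-dimensional subspaces of $R_j$, defined by rank conditions, parametrizing the $V$ with $H(R/\overline V)=H$; closure is in $\mathrm{Grass}(d,R_j)$.
   Formalization: With the two orders as defined, β reverses order (d=2, j=3: H'=(1,2,2,2,…) ≥ H=(1,2,3,2,1,0,…), but β(H') < β(H)), so what is proved is that H' ≥ H under P(d,j) if and only if β(H') ≤ β(H), an isomorphism onto PA(d,j) with the opposite order. *)

(* Defs.v *)
From HB Require Import structures.
From mathcomp Require Import all_boot all_order all_algebra.
From mathcomp.multinomials Require Import mpoly.

Set Implicit Arguments.
Unset Strict Implicit.
Unset Printing Implicit Defensive.

Import Order.TTheory GRing.Theory Num.Theory.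
Local Open Scope ring_scope.

Definition infinite_field (k : fieldType) : Prop :=
  forall s : seq k, exists x : k, x \notin s.

(** * Partitions: nonincreasing sequences of positive parts *)

Definition is_partition (D : seq nat) : bool :=
  sorted geq D && (0%N \notin D).

Definition conj_partition (D : seq nat) : seq nat :=
  [seq count (fun x => (i < x)%N) D | i <- iota 0 (head 0%N D)].

Definition maj_le (D D' : seq nat) : Prop :=
  (sumn D <= sumn D')%N /\
  forall i, (1 <= i <= minn (size D) (size D'))%N ->
    (sumn (take i D) <= sumn (take i D'))%N.

Definition PA (d j : nat) (PQ : seq nat * seq nat) : Prop :=
  [/\ is_partition PQ.1, sumn PQ.1 = d,
      is_partition PQ.2, (sumn PQ.2 <= j.+1 - d)%N
    & head 0%N PQ.1 = (head 0%N PQ.2).+1].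

Definition PA_le (PQ PQ' : seq nat * seq nat) : Prop :=
  maj_le PQ.1 PQ'.1 /\ maj_le PQ.2 PQ'.2.

(** * Acceptable O-sequences *)

Definition proper_Oseq (H : nat -> nat) (mu : nat) : Prop :=
  [/\ (0 < mu)%N,
      forall i, (i < mu)%N -> H i = i.+1,
      (H mu < mu.+1)%N
    & forall i, (mu <= i)%N -> (H i.+1 <= H i)%N].

Definition eventually (A : nat -> Prop) : Prop :=
  exists N, forall n, (N <= n)%N -> A n.

Definition ediff (H : nat -> nat) (i : nat) : int :=
  if i is i'.+1 then (H i')%:Z - (H i)%:Z else -1.

(* c is the limit of H; the infinite sum of the ediff H i over i > j is read
   as the eventual value of its partial sums. *)
Definition acceptable (d j : nat) (H : nat -> nat) : Prop :=
  exists mu c : nat,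
  [/\ proper_Oseq H mu,
      eventually (fun n => H n = c),
      (forall i, (i <= j)%N -> ediff H i <= ediff H i.+1)
        /\ (forall i, (j <= i)%N -> ediff H i.+1 <= ediff H i),
      \sum_(0 <= i < j.+1) (ediff H i + 1) = d%:Z
        /\ eventually (fun n =>
             \sum_(j.+1 <= i < n) ediff H i = j%:Z + 1 - d%:Z - c%:Z)
    & [/\ 0 <= ediff H j, ediff H j = ediff H j.+1
        & ediff H j <= Num.min (j%:Z + 1 - d%:Z) (d%:Z - 1)]].

Definition P_ge (j : nat) (H' H : nat -> nat) : Prop :=
  (forall i, (i <= j)%N -> (H' i <= H i)%N) /\
  (forall i, (j <= i)%N -> (H i <= H' i)%N).

(* The least i with H i < i + 1; it is at most j when H is acceptable, since
   then H j = j + 1 - d. *)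
Definition order_upto (j : nat) (H : nat -> nat) : nat :=
  find (fun i => (H i < i.+1)%N) (iota 0 j.+1).

Definition Ppart (j : nat) (H : nat -> nat) : seq nat :=
  let mu := order_upto j H in
  [seq absz (ediff H i + 1) | i <- rev (iota mu (j.+1 - mu))].

(* At most H j of the ediff H i with i > j are nonzero, and when H is
   acceptable these come first, so the enumeration can stop after H j terms. *)
Definition Qpart (j : nat) (H : nat -> nat) : seq nat :=
  [seq absz (ediff H i) | i <- iota j.+1 (H j) & ediff H i != 0].

Definition beta (j : nat) (H : nat -> nat) : seq nat * seq nat :=
  (Ppart j H, Qpart j H).

(** * The ancestor ideal of V, for V a space of binary forms of degree j *)

Section Ancestor.
Variable k : fieldType.

Definition in_space (j : nat) (V : {vspace dhomog 2 k j}) (f : {mpoly k[2]}) :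
  Prop := exists2 v : dhomog 2 k j, v \in V & f = v.

Definition ideal_gen (S : {mpoly k[2]} -> Prop) (f : {mpoly k[2]}) : Prop :=
  exists (n : nat) (a s : 'I_n -> {mpoly k[2]}),
    (forall m, S (s m)) /\ f = \sum_(m < n) a m * s m.

(* R_{-i} V, for i <= j *)
Definition down (i j : nat) (V : {vspace dhomog 2 k j}) (f : {mpoly k[2]}) :
  Prop :=
  f \is (j - i)%N.-homog /\
  forall h : {mpoly k[2]}, h \is i.-homog -> in_space V (h * f).

Definition ancestor (j : nat) (V : {vspace dhomog 2 k j}) (f : {mpoly k[2]}) :
  Prop :=
  exists (g : {mpoly k[2]}) (t : nat -> {mpoly k[2]}),
    [/\ ideal_gen (in_space V) g,
        forall i, (1 <= i <= j)%N -> down i V (t i)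
      & f = g + \sum_(1 <= i < j.+1) t i].

Definition hilbert_quot (I : {mpoly k[2]} -> Prop) (H : nat -> nat) : Prop :=
  forall i, exists W : {vspace dhomog 2 k i},
    (forall f : dhomog 2 k i, f \in W <-> I f) /\
    (H i + \dim W)%N = \dim {: dhomog 2 k i}.

(* The points with coordinates in k of the stratum Grass_H(d,j) *)
Definition Grass (d j : nat) (H : nat -> nat) (V : {vspace dhomog 2 k j}) :
  Prop := \dim V = d /\ hilbert_quot (ancestor V) H.

(* The complex 0 -> (+)_s R(-S_s) --M--> (+)_i R(-G_i) --g--> R is a minimal
   graded free resolution of R/I: the maps are homogeneous of degree 0, the
   complex is exact, the cokernel of g is R/I, and all the entries of M and g
   lie in the maximal ideal (x,y). *)
Definition minimal_resolution (I : {mpoly k[2]} -> Prop) (G S : seq nat) :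
  Prop :=
  exists (g : 'rV[{mpoly k[2]}]_(size G))
         (M : 'M[{mpoly k[2]}]_(size G, size S)),
  [/\ (forall i : 'I_(size G), g 0 i \is (nth 0%N G i).-homog) /\
      (forall (i : 'I_(size G)) (s : 'I_(size S)),
                   if (nth 0%N G i <= nth 0%N S s)%N
                   then M i s \is (nth 0%N S s - nth 0%N G i)%N.-homog
                   else M i s == 0),
      forall f, I f <-> exists a : 'cV_(size G), f = (g *m a) 0 0,
      forall a : 'cV_(size G),
        g *m a = 0 <-> exists b : 'cV_(size S), a = M *m b,
      forall b : 'cV_(size S), M *m b = 0 -> b = 0
    & (forall i, (g 0 i)@_0%MM = 0) /\ (forall i s, (M i s)@_0%MM = 0)].

(* A = A(H) and B = B(H). The truncation in j.+1 - a is harmless: minimality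
   excludes generators of degree 0. *)
Definition AB_partitions (d j : nat) (H : nat -> nat) (A B : seq nat) : Prop :=
  [/\ is_partition A, is_partition B,
      (size A)%:Z = ediff H j + 1, (size B)%:Z = ediff H j
    & forall V : {vspace dhomog 2 k j}, Grass d H V ->
        minimal_resolution (ancestor V)
          [seq (j.+1 - a)%N | a <- A] [seq (j.+1 + b)%N | b <- B]].

End Ancestor.

(** * Closure in the Grassmannian *)

(* The Grassmannian is embedded by its Plücker coordinates, indexed by the
   increasing maps from 'I_d to 'I_j.+1. *)
Definition plucker_index (d j : nat) : finType :=
  {f : {ffun 'I_d -> 'I_j.+1} |
    [forall u : 'I_d, forall v : 'I_d, (u < v)%N ==> (f u < f v)%N]}.

Section Plucker.
Variables (K : fieldType) (d j : nat).

(* Meaningful when \dim V = d. Column v holds the coefficients of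
   x^v y^(j-v). *)
Definition coef_mx (V : {vspace dhomog 2 K j}) : 'M[K]_(d, j.+1) :=
  \matrix_(u < d, v < j.+1)
    (mpoly_of_dhomog (nth 0 (vbasis V) u))@_(
       U_(ord0) *+ v + U_(ord_max) *+ (j - v))%MM.

(* Another choice of basis multiplies all the coordinates by the same nonzero
   scalar. *)
Definition plucker (V : {vspace dhomog 2 K j}) (i : 'I_#|plucker_index d j|) :
  K := \det (colsub (val (enum_val i)) (coef_mx V)).

Definition vanishes (k : fieldType) (emb : {rmorphism k -> K})
    (F : {mpoly k[#|plucker_index d j|]}) (V : {vspace dhomog 2 K j}) : Prop :=
  (map_mpoly emb F).@[plucker V] = 0.

End Plucker.

(* A point of the k-scheme Grass(d,R_j) is represented by a d-dimensional
   V in K[x,y]_j for some extension emb : k -> K, and a closed subset is the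
   zero set of homogeneous polynomials over k in the Plücker coordinates. So
   the point V is in the closure of the stratum of H when every homogeneous F
   over k vanishing at all the points of the stratum vanishes at V. *)
Definition in_closure (k : fieldType) (d j : nat) (H : nat -> nat)
    (K : fieldType) (emb : {rmorphism k -> K}) (V : {vspace dhomog 2 K j}) :
  Prop :=
  \dim V = d /\
  forall (D : nat) (F : {mpoly k[#|plucker_index d j|]}), F \is D.-homog ->
    (forall (L : fieldType) (lam : {rmorphism k -> L})
            (U : {vspace dhomog 2 L j}), Grass d H U -> vanishes lam F U) ->
    vanishes emb F V.

Definition stratum_in_closure (k : fieldType) (d j : nat)
    (H' H : nat -> nat) : Prop :=
  forall (K : fieldType) (emb : {rmorphism k -> K})
         (V : {vspace dhomog 2 K j}), Grass d H' V -> in_closure d H emb V.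

Definition stratum_meets_closure (k : fieldType) (d j : nat)
    (H' H : nat -> nat) : Prop :=
  exists (K : fieldType) (emb : {rmorphism k -> K})
         (V : {vspace dhomog 2 K j}), Grass d H' V /\ in_closure d H emb V.

(* Main.v *)
(** Dehomogenize, so that V becomes a space of polynomials in one variable; the Hilbert function
    of the ancestor ideal lists the dimensions of the spaces R_{-i}V and R_iV. By Hilbert-Burch,
    V is generated by h times the maximal minors of a matrix whose (l,s) entry has degree
    a_l + b_s, and the dimensions of R_{-i}V and R_iV are determined by the sums of the
    max(a_l - i, 0) and of the max(b_s - i, 0) and by the degree c of h. These sums are the tails
    of the partitions P and Q, which makes A and B conjugate to P and Q.

    The dimensions are semicontinuous, so specialization implies the order. Conversely the order
    is generated by moving a unit between two parts of a, between two parts of b, or from c to b.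
    A point presented by the special data is a limit of points presented by the less special
    data: a move of a or of b perturbs the matrix so that the leading coefficients of a row or
    column can be cancelled, and a move from c to b transfers a root of h to a column. Finally a
    presented point is a limit of points of the stratum, on the line that joins its matrix to
    that of a monomial point of the stratum. *)

Require Import Defs.
From mathcomp Require Import all_boot all_order all_algebra.
From HB Require Import structures.
From mathcomp.multinomials Require Import mpoly.
From mathcomp Require Import perm fraction zify ring.
From Stdlib Require Import Classical.

Set Implicit Arguments.
Unset Strict Implicit.
Unset Printing Implicit Defensive.

Import Order.TTheory GRing.Theory.
Local Open Scope ring_scope.

(** * Chains of partitions *)

(** Inside a chain the data (a, b, c) need not be those of a stratum: parts of b may be 0, and a
    presented point satisfies only one-sided bounds, the dimension of R_{-i}V being at least and
    that of R_iV at most the expected one. So the moves are made on presented points, and the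
    stratum is entered only at the end, where semicontinuity along a line supplies the opposite
    bounds. The number of generators may jump between strata while the moves keep it fixed, so the
    special point is first padded with trivial generators and relations (a = b = 0). A degeneration
    is a family over K[t] whose generic point lives over K(t); carrying points over all extension
    fields of k makes closure transitive. After dehomogenization y acts as an inclusion, so a graded
    module becomes an increasing family of K-subspaces of a K[x]-module, and its freeness follows
    from dimension counts and a saturation condition, without homological algebra. *)

Definition upd {T : Type} (b : nat -> T) (l : nat) (x : T) : nat -> T :=
  fun m => if m == l then x else b m.

Definition excess (n : nat) (b : nat -> nat) (i : nat) : nat :=
  (\sum_(l < n) (b l - i))%N.

Section Chain.
Local Open Scope nat_scope.

Definition count_gt (n : nat) (b : nat -> nat) (i : nat) : nat :=
  \sum_(l < n) (i < b l).

Lemma excess_rec n b i : excess n b i = excess n b i.+1 + count_gt n b i.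
Proof. rewrite -big_split /=; apply: eq_bigr => l _; case: ltnP; lia. Qed.

Lemma count_gt_mono n b i : count_gt n b i.+1 <= count_gt n b i.
Proof. by apply: leq_sum => l _; do 2 case: ltnP => //; lia. Qed.

Lemma count_gt_le n b i : count_gt n b i <= n.
Proof.
rewrite -[leqRHS]card_ord -sum1_card; apply: leq_sum => l _; exact: leq_b1.
Qed.

Lemma count_gt_drop n b i : count_gt n b i.+1 < count_gt n b i ->
  exists2 l : nat, l < n & b l = i.+1.
Proof.
move=> lt_c; have: exists l : 'I_n, b l == i.+1.
  apply/existsP; apply: contraLR lt_c; rewrite negb_exists -leqNgt => /forallP nb.
  apply: leq_sum => l _; have := nb l; lia.
by case=> l /eqP bl; exists l.
Qed.

Lemma count_gt_lt n b : count_gt n b 0 < n -> exists2 l : nat, l < n & b l = 0.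
Proof.
move=> lt_c; have: exists l : 'I_n, b l == 0.
  apply/existsP; apply: contraLR lt_c; rewrite negb_exists -leqNgt => /forallP nb.
  rewrite -[leqLHS]card_ord -sum1_card; apply: leq_sum => l _; have := nb l; lia.
by case=> l /eqP bl; exists l.
Qed.

Lemma excess_eventually0 n b : exists N, forall i, N <= i -> excess n b i = 0.
Proof.
exists (\max_(l < n) b l) => i le_i; apply: big1 => l _.
apply/eqP; rewrite subn_eq0; apply: leq_trans le_i.
exact: (leq_bigmax (F := fun l : 'I_n => b l)).
Qed.

(** The replaced term is added to the other side, which avoids truncated subtraction. *)
Lemma sum_upd n (g : nat -> nat -> nat) (b : nat -> nat) l x : l < n ->
  \sum_(m < n) g m (upd b l x m) + g l (b l) = \sum_(m < n) g m (b m) + g l x.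
Proof.
move=> ltl; have eq_rest : \sum_(m < n | m != Ordinal ltl) g m (upd b l x m) =
    \sum_(m < n | m != Ordinal ltl) g m (b m).
  apply: eq_bigr => m; rewrite -(inj_eq val_inj) /= => /negbTE nm.
  by rewrite /upd nm.
rewrite (bigD1 (Ordinal ltl)) //= eq_rest [in RHS](bigD1 (Ordinal ltl)) //=.
by rewrite /upd eqxx -addnA [RHS]addnC; congr (_ + _); exact: addnC.
Qed.

Lemma excess_upd n b l x i : l < n ->
  excess n (upd b l x) i + (b l - i) = excess n b i + (x - i).
Proof. exact: (@sum_upd n (fun _ y => y - i)). Qed.

(* Let l.+1 be the first index with a strict inequality, and r.+1 the next one with an
   equality: moving a unit from a part equal to r.+1 to a part equal to l changes only the
   excesses in between. If there is no such r, the unit is taken from c. *)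
Lemma excess_chain (n : nat) (b0 : nat -> nat) (c0 : nat)
    (Phi : (nat -> nat) -> nat -> Prop) :
  (forall b c l1 l2, Phi b c -> l1 < n -> l2 < n -> b l2 + 2 <= b l1 ->
     Phi (upd (upd b l1 (b l1).-1) l2 (b l2).+1) c) ->
  (forall b c l, Phi b c.+1 -> l < n -> Phi (upd b l (b l).+1) c) ->
  forall b c, Phi b c ->
  (forall i, c0 + excess n b0 i <= c + excess n b i) ->
  c0 + excess n b0 0 = c + excess n b 0 ->
  exists2 b', Phi b' c0 & forall i, excess n b' i = excess n b0 i.
Proof.
move=> step1 step2 b c; elim/ltn_ind: c b => c IHc b.
(* A move between parts that differ by at least 2 lowers the sum of squares, and a move out of [c]
   lowers [c]: the induction is lexicographic. *)
have [k] := ubnP (\sum_(l < n) b l ^ 2).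
elim: k b => // k IHk b ltk HPhi ge_b eq0.
have [[i0 lti0]|ngt] :=
    classic (exists i, c0 + excess n b0 i < c + excess n b i); last first.
  have eqb i : c0 + excess n b0 i = c + excess n b i.
    apply/eqP; rewrite eqn_leq ge_b leqNgt /=; apply/negP => lti.
    by apply: ngt; exists i.
  have [N1 N1P] := excess_eventually0 n b.
  have [N2 N2P] := excess_eventually0 n b0.
  have eqc : c0 = c.
    by have := eqb (N1 + N2); rewrite N1P ?N2P ?leq_addr ?leq_addl // !addn0.
  by exists b => [|i]; [rewrite eqc | have := eqb i; lia].
have ex1 : exists i, c0 + excess n b0 i < c + excess n b i by exists i0.
case: (ex_minnP ex1) => l ltl minl {i0 lti0 ex1}.
case: l ltl minl => [|l] ltl minl; first by rewrite eq0 ltnn in ltl.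
have eqlt i : i <= l -> c0 + excess n b0 i = c + excess n b i.
  by move=> lei; apply/eqP; rewrite eqn_leq ge_b leqNgt; apply/negP => /minl; lia.
(* Equality at [l] and strict inequality at [l.+1]: the difference of the two excesses is the number
   of parts above [l]. *)
have lt_cnt : count_gt n b l < count_gt n b0 l.
  have := eqlt l (leqnn l); rewrite (excess_rec n b) (excess_rec n b0); lia.
(* If no part of [b] were equal to [l], the counts of [b] at [l.-1] and [l] would agree, and
   equality of the excesses at [l.-1] would contradict [lt_cnt]; for [l = 0] not all [n] parts are
   positive. *)
have [p ltp bp] : exists2 p : nat, p < n & b p = l.
  case: l {ltl minl} eqlt lt_cnt => [|l] eqlt lt_cnt.
    by apply: count_gt_lt; apply: leq_trans lt_cnt (count_gt_le _ _ _).
  apply: count_gt_drop; apply: leq_trans lt_cnt _.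
  apply: leq_trans (count_gt_mono _ _ _) _.
  have := eqlt l (leqnSn l); have := eqlt l.+1 (leqnn _).
  rewrite (excess_rec n b0 l) (excess_rec n b l); lia.
have gt_until i : l < i ->
    (forall r, l.+1 < r -> r <= i -> c0 + excess n b0 r < c + excess n b r) ->
    c0 + excess n b0 i < c + excess n b i.
  by move=> lti; have [->//|ner] := eqVneq i l.+1; apply; lia.
have [ex2|nex2] :=
  classic (exists r, (l.+1 < r) && (c + excess n b r <= c0 + excess n b0 r)).
  case: (ex_minnP ex2) => [[|r]] //= /andP[ltlr ler] minr.
  have gt_r i : l < i <= r -> c0 + excess n b0 i < c + excess n b i.
    move=> /andP[lti lei]; apply: gt_until => // s lts les.
    by rewrite ltnNge; apply/negP => le'; have := minr s; rewrite lts le' /=; lia.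
  have ltr : c0 + excess n b0 r < c + excess n b r by apply: gt_r; lia.
  (* The gap between the two sides is positive at r, zero at [r.+1] and nonnegative at [r.+2], so
     the counts of [b] must drop between r and [r.+1]. *)
  have [q ltq bq] : exists2 q : nat, q < n & b q = r.+1.
    apply: count_gt_drop; have := ge_b r.+2; have := count_gt_mono n b0 r.
    have := excess_rec n b r; have := excess_rec n b0 r.
    have := excess_rec n b r.+1; have := excess_rec n b0 r.+1; lia.
  have npq : p != q by apply/eqP => epq; move: bp; rewrite epq bq; lia.
  have upd_p : upd b q (b q).-1 p = l by rewrite /upd (negbTE npq).
  have sq := @sum_upd n (fun _ y => y ^ 2) (upd b q (b q).-1) p (b p).+1 ltp.
  have sq' := @sum_upd n (fun _ y => y ^ 2) b q (b q).-1 ltq.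
  have ex i := @excess_upd n (upd b q (b q).-1) p (b p).+1 i ltp.
  have ex' i := @excess_upd n b q (b q).-1 i ltq.
  apply: (IHk (upd (upd b q (b q).-1) p (b p).+1)).
  - have sqS m : m.+1 ^ 2 = m ^ 2 + 2 * m + 1 by rewrite -addn1 sqrnD; lia.
    move: sq sq' ltk; rewrite upd_p bp bq /= !sqS; lia.
  - by apply: step1 => //; rewrite bp bq; lia.
  - move=> i; move: (ex i) (ex' i); rewrite upd_p bp bq /=; have := ge_b i.
    have [lti|gei] := leqP i l; first lia.
    have [lti'|gei'] := leqP i r; last lia.
    have := gt_r i; lia.
  - by move: (ex 0) (ex' 0); rewrite upd_p bp bq /=; lia.
have gtr i : l < i -> c0 + excess n b0 i < c + excess n b i.
  move=> lti; apply: gt_until => // r ltr _.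
  by rewrite ltnNge; apply/negP => le'; apply: nex2; exists r; rewrite ltr.
have [N1 N1P] := excess_eventually0 n b.
(* Far out the excess of [b] vanishes, and the strict inequality compares [c0] with [c] alone. *)
have c_gt0 : 0 < c by have := gtr (N1 + l.+1); rewrite N1P ?leq_addr //; lia.
have ec := prednK c_gt0; rewrite -ec in HPhi.
have ex i := @excess_upd n b p (b p).+1 i ltp.
apply: (IHc c.-1 _ (upd b p (b p).+1)).
- by rewrite ec.
- exact: step2.
- move=> i; move: (ex i); rewrite bp; have := ge_b i.
  have [lti|gei] := leqP i l; first lia.
  have := gtr i gei; lia.
- by move: (ex 0); rewrite bp; lia.
Qed.
End Chain.

(** * Modules over K[x] filtered by degree *)

Section Dimension.
Variable K : fieldType.

Section OneModule.
Variable E : lmodType {poly K}.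
Implicit Types (S T : E -> Prop).

(** The scalars are constants: a [K]-subspace of the [K[x]]-module [E], not a submodule. *)
Definition subspace S : Prop :=
  S 0 /\ forall (a : K) u v, S u -> S v -> S (a%:P *: u + v).

Definition lincomb n (v : 'I_n -> E) (r : 'rV[K]_n) : E :=
  \sum_i (r 0 i)%:P *: v i.

(** A relation on predicates, since the spaces are cut out of infinite-dimensional modules by
    undecidable conditions. *)
Definition has_dim S (n : nat) : Prop :=
  exists v : 'I_n -> E, (forall w, S w <-> exists r, w = lincomb v r) /\
                        (forall r, lincomb v r = 0 -> r = 0).

Lemma lincombD n (v : 'I_n -> E) a r s :
  lincomb v (a *: r + s) = a%:P *: lincomb v r + lincomb v s.
Proof.
rewrite /lincomb scaler_sumr -big_split /=; apply: eq_bigr => i _.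
by rewrite !mxE rmorphD rmorphM /= scalerDl scalerA.
Qed.

Lemma lincomb0 n (v : 'I_n -> E) : lincomb v 0 = 0.
Proof. by rewrite /lincomb big1 // => i _; rewrite mxE scale0r. Qed.

Lemma lincombB n (v : 'I_n -> E) r s :
  lincomb v (r - s) = lincomb v r - lincomb v s.
Proof.
by have := lincombD v (-1) s r; rewrite scaleN1r polyCN scaleN1r ![- _ + _]addrC.
Qed.

Lemma lincomb_mul m n (v : 'I_n -> E) (C : 'M_(m, n)) r :
  lincomb (fun i => lincomb v (row i C)) r = lincomb v (r *m C).
Proof.
rewrite /lincomb; under eq_bigr do rewrite scaler_sumr.
rewrite exchange_big /=; apply: eq_bigr => i _.
rewrite !mxE rmorph_sum scaler_suml; apply: eq_bigr => l _.
by rewrite !mxE rmorphM scalerA.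
Qed.

Lemma lincomb_inj n (v : 'I_n -> E) : (forall r, lincomb v r = 0 -> r = 0) ->
  injective (lincomb v).
Proof.
by move=> vI r s ers; apply/eqP; rewrite -subr_eq0 (vI (r - s)) // lincombB ers subrr.
Qed.

Lemma lincomb_delta n (v : 'I_n -> E) i : lincomb v (delta_mx 0 i) = v i.
Proof.
rewrite /lincomb (bigD1 i) //= mxE !eqxx scale1r big1 ?addr0 // => l nl.
by rewrite mxE (negbTE nl) andbF scale0r.
Qed.

Lemma lincomb_coords m n (v : 'I_m -> E) (w : 'I_n -> E) :
  (forall i, exists r, v i = lincomb w r) ->
  exists C : 'M_(m, n), forall r, lincomb v r = lincomb w (r *m C).
Proof.
case/fin_all_exists => f fP; exists (\matrix_i f i) => r.
by rewrite -lincomb_mul; apply: eq_bigr => i _; rewrite rowK fP.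
Qed.

Lemma has_dim_subspace S n : has_dim S n -> subspace S.
Proof.
case=> v [vS _]; split; first by apply/vS; exists 0; rewrite lincomb0.
move=> a u w /vS[r ->] /vS[s ->]; apply/vS; exists (a *: r + s).
by rewrite lincombD.
Qed.

Lemma eq_has_dim S T n : (forall w, S w <-> T w) -> has_dim S n -> has_dim T n.
Proof. by move=> eST [v [vS vI]]; exists v; split=> // w; rewrite -eST. Qed.

Lemma has_dim_coords S T m n (v : 'I_m -> E) (w : 'I_n -> E) :
  (forall u, S u <-> exists r, u = lincomb v r) ->
  (forall r, lincomb v r = 0 -> r = 0) ->
  (forall u, T u <-> exists r, u = lincomb w r) ->
  (forall u, S u -> T u) ->
  exists2 C : 'M_(m, n), row_free C & forall r, lincomb v r = lincomb w (r *m C).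
Proof.
move=> vS vI wT sST; have [|C CP] := @lincomb_coords _ _ v w.
  by move=> i; apply/wT/sST/vS; exists (delta_mx 0 i); rewrite lincomb_delta.
exists C => //; apply: inj_row_free => r rC.
by apply: vI; rewrite CP rC lincomb0.
Qed.

Lemma has_dim_le S T m n :
  (forall u, S u -> T u) -> has_dim S m -> has_dim T n -> (m <= n)%N.
Proof.
move=> sST [v [vS vI]] [w [wT _]].
have [C Cf _] := has_dim_coords vS vI wT sST.
by move: Cf; rewrite /row_free => /eqP <-; apply: rank_leq_col.
Qed.

Lemma has_dim_uniq S m n : has_dim S m -> has_dim S n -> m = n.
Proof.
by move=> Sm Sn; apply/eqP; rewrite eqn_leq (has_dim_le _ Sm Sn) ?(has_dim_le _ Sn Sm).
Qed.

Lemma has_dim_eq S T n : (forall u, S u -> T u) ->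
  has_dim S n -> has_dim T n -> forall u, T u -> S u.
Proof.
move=> sST [v [vS vI]] [w [wT _]] u /wT[r ->].
have [C Cf CP] := has_dim_coords vS vI wT sST.
have Cu : C \in unitmx by rewrite -row_free_unit.
by apply/vS; exists (r *m invmx C); rewrite CP mulmxKV.
Qed.

Lemma has_dim_sub S T n : subspace S -> (forall u, S u -> T u) -> has_dim T n ->
  exists2 m, (m <= n)%N & has_dim S m.
Proof.
move=> [S0 SD] sST [w [wT wI]].
pose P m := exists2 C : 'M_(m, n), row_free C & forall r, S (lincomb w (r *m C)).
have lincombS m (C : 'M_(m, n)) :
    (forall i, S (lincomb w (row i C))) -> forall r, S (lincomb w (r *m C)).
  move=> SC r; rewrite -lincomb_mul /lincomb.
  by elim/big_rec: _ => // i x _ Sx; apply: SD => //; apply: SC.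
(* Membership in [S] is not decidable, so an independent family of maximal size is obtained
   classically. *)
have [m [Pm maxm]] : exists m, P m /\ forall m', P m' -> (m' <= m)%N.
  have Pn m : P m -> (m <= n)%N by case=> C Cf _; move: Cf; rewrite /row_free => /eqP <-; apply: rank_leq_col.
  have P0 : P 0.
    exists 0; first by rewrite /row_free mxrank0.
    by move=> r; rewrite mulmx0 lincomb0.
  suff main k m : P m -> (n - m < k)%N -> exists m, P m /\ forall m', P m' -> (m' <= m)%N.
    by apply: (main n.+1 _ P0); lia.
  elim: k m => // k IHk m Pm ltm.
  have [[m' [Pm' ltm']]|ngt] := classic (exists m', P m' /\ (m < m')%N).
    by apply: (IHk m') => //; have := Pn _ Pm'; lia.
  exists m; split=> // m' Pm'; rewrite leqNgt; apply/negP => lt; apply: ngt.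
  by exists m'.
case: Pm => C Cf CS; exists m; first by rewrite -(eqP Cf) rank_leq_col.
exists (fun i => lincomb w (row i C)); split=> [u|r]; last first.
  by rewrite lincomb_mul => /wI/(congr1 (mulmx^~ (pinvmx C))); rewrite mulmxKp // mul0mx.
split=> [Su|[r ->]]; last by rewrite lincomb_mul.
have /wT[r er] := sST _ Su.
have [/submxP[s es]|nr] := boolP (r <= C)%MS.
  by exists s; rewrite lincomb_mul -es.
(* A vector of [S] outside the row space of [C] would give a larger independent family. *)
have /maxm : P (m + 1)%N; last by rewrite addn1 ltnn.
exists (col_mx C r).
  rewrite /row_free -addsmxE addsmxC eqn_leq; apply/andP; split.
    by rewrite addsmxC addsmxE rank_leq_row.
  have : (C < r + C)%MS.
    by rewrite /ltmx addsmxSr /=; apply: contra nr => /(submx_trans (addsmxSl _ _)).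
  by move=> /rank_ltmx; rewrite (eqP Cf) addn1.
apply: lincombS => i; case: (split_ordP i) => l ->.
  by rewrite (@rowKu _ m 1) rowE.
by rewrite (@rowKd _ m 1) row_id -er.
Qed.

Lemma has_dim_fin (I : finType) S (v : I -> E) :
  (forall w, S w <-> exists c : I -> K, w = \sum_i (c i)%:P *: v i) ->
  (forall c : I -> K, \sum_i (c i)%:P *: v i = 0 -> forall i, c i = 0) ->
  has_dim S #|I|.
Proof.
move=> vS vI.
have lcE r : lincomb (fun i : 'I_#|I| => v (enum_val i)) r =
             \sum_i (r 0 (enum_rank i))%:P *: v i.
  rewrite /lincomb [RHS](reindex_omap (enum_val (A := predT)) (fun i => Some (enum_rank i))) /=.
    by apply: eq_big => [i|i _]; rewrite ?enum_valK ?eqxx.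
  by move=> i _; rewrite enum_rankK.
exists (fun i : 'I_#|I| => v (enum_val i)); split=> [w|r].
  rewrite vS; split=> [[c ->]|[r ->]].
    exists (\row_i c (enum_val i)); rewrite lcE.
    by apply: eq_bigr => i _; rewrite mxE enum_rankK.
  by exists (fun i => r 0 (enum_rank i)); rewrite lcE.
rewrite lcE => /vI r0; apply/rowP => i.
by have := r0 (enum_val i); rewrite enum_valK mxE.
Qed.

Definition indep t (v : nat -> E) (m : nat -> nat) : Prop :=
  forall p : nat -> {poly K}, (forall l, (l < t)%N -> (size (p l) <= m l)%N) ->
    \sum_(l < t) p l *: v l = 0 -> forall l, (l < t)%N -> p l = 0.

Definition xspan t (v : nat -> E) (m : nat -> nat) (w : E) : Prop :=
  exists2 p : nat -> {poly K}, (forall l, (l < t)%N -> (size (p l) <= m l)%N) &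
    w = \sum_(l < t) p l *: v l.

(* A basis of S made of the multiples X^i v_l with i < m l. *)
Definition xbasis S t (v : nat -> E) (m : nat -> nat) : Prop :=
  (forall w, S w <-> xspan t v m w) /\ indep t v m.

Lemma xspan_subspace t v m : subspace (xspan t v m).
Proof.
split.
  by exists (fun _ => 0) => [l _|]; rewrite ?size_poly0 // big1 // => l _; rewrite scale0r.
move=> a u w [p sp ->] [q sq ->]; exists (fun l => a%:P * p l + q l) => [l ltl|].
  rewrite (leq_trans (size_polyD _ _)) // geq_max sq // andbT.
  by rewrite mul_polyC (leq_trans (size_scale_leq _ _)) ?sp.
rewrite scaler_sumr -big_split /=; apply: eq_bigr => l _.
by rewrite scalerDl scalerA.
Qed.

Lemma xspan_X t v (m : nat -> nat) l k : (l < t)%N -> (k < m l)%N -> xspan t v m ('X^k *: v l).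
Proof.
move=> ltl ltk; exists (fun i => if i == l then 'X^k else 0) => [i _|].
  by case: eqP => [->|_]; rewrite ?size_polyXn ?size_poly0.
rewrite (bigD1 (Ordinal ltl)) //= eqxx big1 ?addr0 // => i.
by rewrite -(inj_eq val_inj) /= => /negbTE ->; rewrite scale0r.
Qed.

Lemma indep_neq0 t v (m : nat -> nat) l : indep t v m -> (l < t)%N -> (0 < m l)%N -> v l != 0.
Proof.
move=> vI ltl ml; apply/eqP => v0; pose p i : {poly K} := (i == l)%:R.
suff /eqP : p l = 0 by rewrite /p eqxx oner_eq0.
apply: vI ltl => [i lti|].
  by rewrite /p; case: eqP => [->|_]; rewrite ?size_poly1 ?size_poly0.
rewrite big1 // => i _; rewrite /p; case: eqP => [->|_]; last by rewrite scale0r.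
by rewrite v0 scaler0.
Qed.

Lemma subspace_sum S (I : Type) (r : seq I) (P : pred I) (F : I -> E) :
  subspace S -> (forall i, P i -> S (F i)) -> S (\sum_(i <- r | P i) F i).
Proof.
case=> S0 SD SF; elim/big_rec: _ => // i x Pi Sx.
by rewrite -[F i]scale1r; apply: SD => //; apply: SF.
Qed.

Lemma subspaceZ S a u : subspace S -> S u -> S (a%:P *: u).
Proof. by case=> S0 SD Su; rewrite -[_ *: _]addr0; apply: SD. Qed.

Lemma subspaceD S u v : subspace S -> S u -> S v -> S (u + v).
Proof. by case=> S0 SD Su Sv; rewrite -[u]scale1r; apply: SD. Qed.

Lemma subspaceN S u : subspace S -> S u -> S (- u).
Proof. by move=> Ss Su; rewrite -scaleN1r -polyCN; apply: subspaceZ. Qed.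

Lemma scale_polyE (p : {poly K}) n (v : E) : (size p <= n)%N ->
  p *: v = \sum_(k < n) (p`_k)%:P *: ('X^k *: v).
Proof.
move=> sp; under eq_bigr do rewrite scalerA mul_polyC.
rewrite -scaler_suml; congr (_ *: v); rewrite -(poly_def n (nth 0 p)).
by apply/polyP => i; rewrite coef_poly; case: ltnP => // le; rewrite nth_default // (leq_trans sp).
Qed.

Lemma xspan_min S t v (m : nat -> nat) : subspace S ->
  (forall l k, (l < t)%N -> (k < m l)%N -> S ('X^k *: v l)) ->
  forall w, xspan t v m w -> S w.
Proof.
move=> Ss SX w [p sp ->]; apply: subspace_sum => // l _.
rewrite (scale_polyE _ (sp l _)) //; apply: subspace_sum => // k _.
by apply: subspaceZ => //; apply: SX.
Qed.

(** Passes between scalars indexed by the pairs (l, k) with [k < m l] and polynomial coefficients of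
    bounded size; the first form is a finite basis, the second is stable under polynomial
    algebra. *)
Lemma xspan_sigma t (v : nat -> E) (m : nat -> nat) : exists f : ({l : 'I_t & 'I_(m l)} -> K) -> nat -> {poly K},
  [/\ forall c l, (l < t)%N -> (size (f c l) <= m l)%N,
      forall c (l : 'I_t) (k : 'I_(m l)),
        (f c l)`_k = c (Tagged (fun l : 'I_t => 'I_(m l)) k)
    & forall c, \sum_(i : {l : 'I_t & 'I_(m l)}) (c i)%:P *: ('X^(tagged i) *: v (tag i)) = \sum_(l < t) f c l *: v l].
Proof.
pose I := {l : 'I_t & 'I_(m l)}.
pose f (c : I -> K) (l : nat) : {poly K} :=
  if @insub nat (fun l => (l < t)%N) 'I_t l is Some l' then
    \poly_(k < m l') (if @insub nat (fun k => (k < m l')%N) 'I_(m l') k is Some k'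
      then c (Tagged (fun l : 'I_t => 'I_(m l)) k') else 0) else 0.
have fE (c : I -> K) (l : 'I_t) (k : 'I_(m l)) :
    (f c l)`_k = c (Tagged (fun l : 'I_t => 'I_(m l)) k).
  by rewrite /f valK coef_poly ltn_ord valK.
have f_size (c : I -> K) (l : nat) : (l < t)%N -> (size (f c l) <= m l)%N.
  by move=> ltl; rewrite /f; case: insubP => [l' _ <-|]; rewrite ?size_poly ?size_poly0.
exists f; split=> // c.
rewrite [RHS](eq_bigr (fun l : 'I_t => \sum_(k < m l)
    (c (Tagged (fun l : 'I_t => 'I_(m l)) k))%:P *: ('X^k *: v l))).
  rewrite (sig_big_dep (fun=> true) (fun _ _ => true) (fun (l : 'I_t) (k : 'I_(m l)) =>
    (c (Tagged (fun l : 'I_t => 'I_(m l)) k))%:P *: ('X^k *: v l))) /=.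
  by apply: eq_bigr => -[l k].
move=> l _; rewrite (scale_polyE _ (f_size c l _)) //.
by apply: eq_bigr => k _; rewrite fE.
Qed.

Lemma xspanP t v (m : nat -> nat) w :
  xspan t v m w <-> exists c : {l : 'I_t & 'I_(m l)} -> K,
    w = \sum_(i : {l : 'I_t & 'I_(m l)}) (c i)%:P *: ('X^(tagged i) *: v (tag i)).
Proof.
have [f [f_size fE fS]] := xspan_sigma t v m.
split=> [[p sp ->]|[c ->]]; last by rewrite fS; exists (f c) => //; apply: f_size.
exists (fun i : {l : 'I_t & 'I_(m l)} => (p (tag i))`_(tagged i)); rewrite fS; apply: eq_bigr => l _.
congr (_ *: _); apply/polyP => k; have [ltk|lek] := ltnP k (m l).
  by rewrite (fE _ l (Ordinal ltk)).
by rewrite !nth_default // (leq_trans _ lek) ?sp ?f_size.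
Qed.

Lemma card_sigma_ord t (m : nat -> nat) :
  #|{: {l : 'I_t & 'I_(m l)}}| = (\sum_(l < t) m l)%N.
Proof.
rewrite card_tagged sumnE big_map big_enum /=.
by apply: eq_bigr => l _; rewrite card_ord.
Qed.

Lemma has_dim_xspan t v (m : nat -> nat) : indep t v m ->
  has_dim (xspan t v m) (\sum_(l < t) m l)%N.
Proof.
move=> vI; have [f [f_size fE fS]] := xspan_sigma t v m.
rewrite -card_sigma_ord.
apply: (has_dim_fin (v := fun i : {l : 'I_t & 'I_(m l)} => 'X^(tagged i) *: v (tag i))) => [w|c].
  exact: xspanP.
rewrite fS => /vI f0 [l k]; rewrite -fE f0 ?coef0 //; exact: f_size.
Qed.

Lemma has_dim_xbasis S t v m : xbasis S t v m -> has_dim S (\sum_(l < t) m l)%N.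
Proof.
by case=> Sw vI; apply: eq_has_dim (has_dim_xspan vI) => w; rewrite Sw.
Qed.

Lemma eq_xspan t v v' (m : nat -> nat) w :
  (forall l, (l < t)%N -> (0 < m l)%N -> v l = v' l) ->
  xspan t v m w -> xspan t v' m w.
Proof.
move=> ev [p sp ->]; exists p => //; apply: eq_bigr => l _.
have [ml|] := posnP (m l); last by move=> ml; rewrite ev.
by have := sp l (ltn_ord l); rewrite ml leqn0 size_poly_eq0 => /eqP ->; rewrite !scale0r.
Qed.

Lemma eq_xbasis S t v v' (m m' : nat -> nat) :
  (forall l, (l < t)%N -> (0 < m l)%N -> v l = v' l) ->
  (forall l, (l < t)%N -> m l = m' l) ->
  xbasis S t v m -> xbasis S t v' m'.
Proof.
move=> ev em [Sw vI]; split=> [w|p sp ep].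
  rewrite Sw; split=> [/(eq_xspan ev)|] [p sp ->].
    by exists p => // l ltl; rewrite -em ?sp.
  apply: (@eq_xspan t v') => [l ltl ml|]; first by rewrite ev.
  by exists p => // l ltl; rewrite em ?sp.
apply: vI => [l ltl|]; first by rewrite em ?sp.
rewrite -[RHS]ep; apply: eq_bigr => l _.
have [ml|ml] := posnP (m l); last by rewrite ev.
have := sp l (ltn_ord l); rewrite -em // ml leqn0 size_poly_eq0 => /eqP ->.
by rewrite !scale0r.
Qed.

End OneModule.

Definition klinear (E E' : lmodType {poly K}) (g : E -> E') : Prop :=
  forall (a : K) u v, g (a%:P *: u + v) = a%:P *: g u + g v.

Lemma klinear0 (E E' : lmodType {poly K}) (g : E -> E') : klinear g -> g 0 = 0.
Proof.
move=> gL; have := gL (-1) 0 0; rewrite scaler0 addr0 polyCN scaleN1r addNr //.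
Qed.

Lemma klinear_lincomb (E E' : lmodType {poly K}) (g : E -> E') n (v : 'I_n -> E) r :
  klinear g -> g (lincomb v r) = lincomb (g \o v) r.
Proof.
move=> gL; rewrite /lincomb; elim/big_rec2: _ => [|i y x _ <-]; first exact: klinear0.
by rewrite gL.
Qed.

Lemma rank_nullity (E E' : lmodType {poly K}) (g : E -> E') (T : E -> Prop) m n :
  klinear g -> has_dim T n -> has_dim (fun w => T w /\ g w = 0) m ->
  (m <= n)%N /\ has_dim (fun u => exists2 w, T w & u = g w) (n - m).
Proof.
move=> gL Tn Km; split; first by apply: (has_dim_le _ Km Tn) => u [].
case: Tn Km => v [vT vI] [u [uK uI]].
have [|C Cf CP] := has_dim_coords uK uI vT; first by move=> w [].
have <- : \rank (C^C)%MS = (n - m)%N by rewrite mxrank_compl (eqP Cf).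
(* A complement of the kernel, in coordinates; [g] maps it isomorphically onto the image. *)
pose D := row_base (C^C)%MS.
have gC r : g (lincomb v (r *m C)) = 0.
  by rewrite -CP; apply: (proj2 (proj2 (uK _) (ex_intro _ r erefl))).
exists (fun i => g (lincomb v (row i D))).
have lcE r : lincomb (fun i => g (lincomb v (row i D))) r = g (lincomb v (r *m D)).
  by rewrite -lincomb_mul klinear_lincomb.
split=> [w|r].
  split=> [[x /vT[r ->] ->]|[r ->]]; last first.
    by rewrite lcE; exists (lincomb v (r *m D)) => //; apply/vT; exists (r *m D).
  have : (r <= C + C^C)%MS by rewrite submx_full // addsmx_compl_full.
  case/sub_addsmxP=> -[r1 r2] /= er.
  have /submxP[r3 er3] : (r2 *m C^C <= D)%MS by rewrite eq_row_base submxMl.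
  exists r3; rewrite lcE er er3 -[r1 *m C]scale1r lincombD gL gC scaler0 add0r //.
rewrite lcE => gr0.
have /uK[s es] : T (lincomb v (r *m D)) /\ g (lincomb v (r *m D)) = 0.
  by split=> //; apply/vT; exists (r *m D).
rewrite CP in es; have {}es := lincomb_inj vI es.
have : (r *m D <= C :&: C^C)%MS.
  by rewrite sub_capmx {1}es submxMl /= -(eq_row_base (C^C)%MS) submxMl.
rewrite capmx_compl submx0 => /eqP /(congr1 (mulmx^~ (pinvmx D))).
by rewrite mulmxKp ?row_base_free // mul0mx.
Qed.

Definition unit_row t (l : nat) : 'rV[{poly K}]_t := \row_i (i == l :> nat)%:R.

Lemma sum_unit_row t (p : nat -> {poly K}) : \sum_(l < t) p l *: unit_row t l = \row_i p i.
Proof.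
apply/rowP => i; rewrite summxE (bigD1 i) //= !mxE eqxx mulr1 big1 ?addr0 // => l.
by rewrite !mxE eq_sym -(inj_eq val_inj) => /negbTE ->; rewrite mulr0.
Qed.

Lemma indep_unit_row t m : indep t (unit_row t) m.
Proof.
by move=> p sp; rewrite sum_unit_row => /rowP p0 l ltl; have := p0 (Ordinal ltl); rewrite !mxE.
Qed.

Lemma xspan_unit_row t (m : nat -> nat) (w : 'rV[{poly K}]_t) :
  xspan t (unit_row t) m w <-> forall l : 'I_t, (size (w 0%R l) <= m l)%N.
Proof.
split=> [[p sp ->] l|sw]; first by rewrite sum_unit_row mxE sp.
pose p l := if @insub nat (fun l => (l < t)%N) 'I_t l is Some l' then w 0 l' else 0.
exists p => [l|]; first by rewrite /p; case: insubP => [l' _ <-|/negbTE ->].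
by rewrite sum_unit_row; apply/rowP => i; rewrite mxE /p valK.
Qed.

(** Rank-nullity for the map from rows with entries of bounded size; [k] is the dimension of the
    space of relations. *)
Lemma xspan_rank (E : lmodType {poly K}) t (v : nat -> E) (m : nat -> nat) :
  exists k, [/\ (k <= \sum_(l < t) m l)%N,
    has_dim (xspan t v m) (\sum_(l < t) m l - k)%N & k = 0%N -> indep t v m].
Proof.
pose g (w : 'rV[{poly K}]_t) : E := \sum_(l < t) w 0 l *: v l.
have gL : klinear g.
  move=> a u w; rewrite /g scaler_sumr -big_split /=; apply: eq_bigr => l _.
  by rewrite !mxE scalerDl scalerA.
have gE (p : nat -> {poly K}) : g (\sum_(l < t) p l *: unit_row t l) = \sum_(l < t) p l *: v l.
  by rewrite sum_unit_row; apply: eq_bigr => l _; rewrite mxE.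
have De := has_dim_xspan (@indep_unit_row t m).
have [|k lek Kk] := @has_dim_sub _ (fun w => xspan t (unit_row t) m w /\ g w = 0) _ _ _ (fun u H => proj1 H) De.
  have [e0 eD] := xspan_subspace t (unit_row t) m.
  split=> [|a u w [Su gu] [Sw gw]]; first by split=> //; apply: klinear0.
  by split; [apply: eD | rewrite gL gu gw scaler0 addr0].
exists k; split=> //; first have [_ dimg] := rank_nullity gL De Kk.
  apply: eq_has_dim dimg => w; split=> [[x [p sp ->] ->]|[p sp ->]].
    by rewrite gE; exists p.
  by exists (\sum_(l < t) p l *: unit_row t l); rewrite ?gE //; exists p.
move=> k0; rewrite k0 in Kk; case: Kk => u [uK _] p sp ep l ltl.
have /uK[r] : xspan t (unit_row t) m (\sum_(l < t) p l *: unit_row t l) /\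
    g (\sum_(l < t) p l *: unit_row t l) = 0.
  by split; [exists p | rewrite gE].
by rewrite /lincomb big_ord0 sum_unit_row => /rowP/(_ (Ordinal ltl)); rewrite !mxE.
Qed.

Lemma xspan_indep (E : lmodType {poly K}) t (v : nat -> E) (m : nat -> nat) :
  has_dim (xspan t v m) (\sum_(l < t) m l)%N -> indep t v m.
Proof.
by move=> dimv; have [k [lek dimk]] := xspan_rank t v m; apply; have := has_dim_uniq dimv dimk; lia.
Qed.

Lemma xspan_xbasis (E : lmodType {poly K}) (S : E -> Prop) t v m :
  (forall w, S w <-> xspan t v m w) -> has_dim S (\sum_(l < t) m l)%N ->
  xbasis S t v m.
Proof.
by move=> Sv dimS; split=> //; apply: xspan_indep; apply: eq_has_dim dimS.
Qed.

(** A new generator contributes only itself ([m' l = 1]), so an extension of a [K]-basis is enough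
    and no compatibility with ['X] is asked of it. *)
Lemma xbasis_complete (E : lmodType {poly K}) (S : E -> Prop) t v (m m' : nat -> nat) :
  subspace S -> has_dim S (\sum_(l < t) m' l)%N -> indep t v m ->
  (forall l k, (l < t)%N -> (k < m l)%N -> S ('X^k *: v l)) ->
  (forall l, (l < t)%N -> m l = m' l \/ m l = 0%N /\ m' l = 1%N) ->
  exists2 v', (forall l, (l < t)%N -> m l = m' l -> v' l = v l) & xbasis S t v' m'.
Proof.
move=> Ss dimS; have [k] := ubnP (\sum_(l < t) (m l != m' l))%N.
elim: k v m => // k IHk v m ltk vI SX em.
have dimv := has_dim_xspan vI; have sS := xspan_min Ss SX.
have [eqm|] := boolP [forall l : 'I_t, m l == m' l].
  have eq_m l (ltl : (l < t)%N) : m l = m' l by apply/eqP; apply: (forallP eqm (Ordinal ltl)).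
  exists v => //; apply: (@eq_xbasis _ S t v _ m) => //; split=> // w; split; last exact: sS.
  apply: (has_dim_eq sS _ dimS).
  have <- : (\sum_(l < t) m l)%N = (\sum_(l < t) m' l)%N by apply: eq_bigr => l _; rewrite eq_m.
  exact: dimv.
rewrite negb_forall => /existsP[l0 nel0].
have [//|[m0 m'0]] := em l0 (ltn_ord l0); first by move=> e; rewrite e eqxx in nel0.
(* If the span already exhausted [S], its dimension would be too small, since the index [l0] still
   lacks a vector. *)
have [[w [Sw nsw]]|nw] := classic (exists w, S w /\ ~ xspan t v m w); last first.
  have /(has_dim_le) /(_ dimS dimv) : forall u, S u -> xspan t v m u.
    by move=> u Su; apply: NNPP => nu; apply: nw; exists u.
  rewrite leqNgt => /negP[]; rewrite (bigD1 l0) //= [ltnRHS](bigD1 l0) //= m0 m'0.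
  by rewrite add0n add1n ltnS; apply: leq_sum => l _; case: (em l (ltn_ord l)) => [->//|[-> _]].
have upd_ne T (b : nat -> T) x (l : 'I_t) : l != l0 -> upd b l0 x l = b l.
  by rewrite /upd -(inj_eq val_inj) => /negbTE ->.
have upd_eq T (b : nat -> T) x : upd b l0 x l0 = x by rewrite /upd eqxx.
have [||||v' ev' bv'] := IHk (upd v l0 w) (upd m l0 1%N).
- rewrite -ltnS; apply: leq_ltn_trans _ ltk.
  rewrite (bigD1 l0) //= [leqRHS](bigD1 l0) //=.
  rewrite upd_eq m0 m'0 eqxx add0n /= add1n ltnS; apply: leq_sum => l nl.
  by rewrite upd_ne.
- move=> p sp; rewrite (bigD1 l0) //= upd_eq => ep.
  have := sp l0 (ltn_ord l0); rewrite upd_eq => /size1_polyC ec.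
  (* A nonzero coefficient at [w] would put [w] in the span of the old vectors. *)
  have [c0|c_neq0] := eqVneq (p l0)`_0 0.
    rewrite c0 in ec => l ltl; have [->|nl] := eqVneq l l0; first by rewrite ec.
    have := vI (fun i => if i == l0 then 0 else p i) _ _ l ltl.
    rewrite (negbTE nl); apply => [i lti|].
      have [->|ni] := eqVneq i l0; first by rewrite size_poly0.
      by have := sp i lti; rewrite /upd (negbTE ni).
    rewrite -[RHS]ep ec scale0r add0r (bigD1 l0) //= eqxx scale0r add0r.
    by apply: eq_bigr => i ni; rewrite upd_ne //; move: ni; rewrite -(inj_eq val_inj) => /negbTE ->.
  case: nsw; have -> : w = (- ((p l0)`_0)^-1)%:P *: (\sum_(l < t) (if l == l0 :> nat then 0 else p l) *: v l).
    rewrite (bigD1 l0) //= eqxx scale0r add0r.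
    rewrite (eq_bigr (fun l : 'I_t => p l *: upd v l0 w l)); last first.
      by move=> i ni; rewrite upd_ne //; move: ni; rewrite -(inj_eq val_inj) => /negbTE ->.
    have /eqP := ep; rewrite addr_eq0 => /eqP ew.
    rewrite -[\sum_(_ < _ | _) _]opprK -ew ec coefC eqxx scalerN scalerA -polyCM.
    by rewrite mulNr mulVf // polyCN scaleNr opprK scale1r.
  apply: subspaceZ; first exact: xspan_subspace.
  exists (fun l : nat => if l == l0 then 0 else p l) => // i lti.
  have [->|ni] := eqVneq i l0; first by rewrite size_poly0.
  by have := sp i lti; rewrite /upd (negbTE ni).
- move=> l i ltl; rewrite /upd; case: eqP => [_|_]; last exact: SX.
  by rewrite ltnS leqn0 => /eqP ->; rewrite expr0 scale1r.
- move=> l ltl; rewrite /upd; case: eqP => [->|_]; first by left.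
  exact: em.
exists v' => // l ltl eml.
have nl : l <> l0 by move=> el; move: eml; rewrite el m0 m'0.
by rewrite ev' // /upd; case: eqP nl.
Qed.

End Dimension.

Lemma size_subCXn (R : nzRingType) (p : {poly R}) n : (size p <= n.+1)%N ->
  (size (p - p`_n *: 'X^n)%R <= n)%N.
Proof.
move=> sp; apply/leq_sizeP => i lei; rewrite coefB coefZ coefXn.
have [->|ne] := eqVneq i n; first by rewrite mulr1 subrr.
by rewrite mulr0 subr0 nth_default // (leq_trans sp) // ltn_neqAle eq_sym ne.
Qed.

(** * Freeness of saturated graded modules *)

Section GradedBasis.
Variables (K : fieldType) (E : lmodType {poly K}).
Variables (F : nat -> E -> Prop) (t : nat) (b : nat -> nat).

(* F n plays the role of the degree n piece of a torsion-free graded k[x,y]-module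
   in which y is injective with torsion-free cokernel; such a module is free. *)
Definition graded_upto (N : nat) : Prop :=
  [/\ forall w, F 0 w -> w = 0,
      forall n w, (n < N)%N -> F n w -> F n.+1 w,
      forall n w, (n < N)%N -> F n w -> F n.+1 ('X *: w),
      forall n w, (n.+1 < N)%N -> F n.+1 w -> F n.+1 ('X *: w) -> F n w
    & forall n, (n <= N)%N -> has_dim (F n) (\sum_(l < t) (n - b l))%N].

(** Only the independence of the old generators one degree higher needs an argument. The top
    coefficients of a relation define an element [w] of the last known piece whose multiple by ['X]
    is again in that piece; saturation pushes [w] one piece down, where these coefficients cannot
    occur. Generators of degree [N] are then added by counting dimensions. *)
Lemma graded_step N v : graded_upto N.+1 ->
  (forall n, (n <= N)%N -> xbasis (F n) t v (fun l => (n - b l)%N)) ->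
  exists2 v', (forall l, (l < t)%N -> b l <> N -> v' l = v l) &
    forall n, (n <= N.+1)%N -> xbasis (F n) t v' (fun l => (n - b l)%N).
Proof.
move=> [F0 Fmono FX Fsat Fdim] vF.
pose m l := if (b l < N)%N then (N.+1 - b l)%N else 0%N.
have [|||||v' ev' bv'] := @xbasis_complete K E (F N.+1) t v m (fun l => N.+1 - b l)%N.
- exact: has_dim_subspace (Fdim _ (leqnn _)).
- exact: Fdim.
- case: N @m Fmono FX Fsat Fdim vF => [|N] m Fmono FX Fsat Fdim vF p sp ep.
    by move=> l /sp; rewrite /m ltn0 leqn0 size_poly_eq0 => /eqP.
  pose c l := if (b l < N.+1)%N then (p l)`_(N.+1 - b l) else 0.
  have cX l : (l < t)%N -> (size (p l - c l *: 'X^(N.+1 - b l))%R <= N.+1 - b l)%N.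
    move=> ltl; have := sp l ltl; rewrite /m /c; case: ifP => ltb sl.
      by apply: size_subCXn; apply: leq_trans sl _; lia.
    by move: sl; rewrite leqn0 size_poly_eq0 => /eqP ->; rewrite scale0r subrr size_poly0.
  (* The top terms of the relation divided by ['X]. *)
  pose q l := c l *: 'X^(N - b l).
  have sq l : (size (q l) <= N.+1 - b l)%N.
    rewrite /q /c; case: ifP => ltb; last by rewrite scale0r size_poly0.
    by rewrite (leq_trans (size_scale_leq _ _)) // size_polyXn; lia.
  have [S1 I1] := vF N.+1 (leqnn _); have [S0 I0] := vF N (leqnSn _).
  pose w := \sum_(l < t) q l *: v l.
  have Fw : F N.+1 w by apply/S1; exists q.
  have FXw : F N.+1 ('X *: w).
    have -> : 'X *: w = - \sum_(l < t) (p l - c l *: 'X^(N.+1 - b l)) *: v l.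
      under [X in - X]eq_bigr do rewrite scalerBl.
      rewrite sumrB ep sub0r opprK scaler_sumr; apply: eq_bigr => l _.
      rewrite scalerA /q /c; case: ifP => ltb; last by rewrite !scale0r mulr0 scale0r.
      rewrite mulrC -scalerAl -exprSr subSn; last by lia.
      by [].

    apply: subspaceN; first exact: has_dim_subspace (Fdim _ (leqnSn _)).
    by apply/S1; exists (fun l => p l - c l *: 'X^(N.+1 - b l)).
  have /S0[r sr er] := Fsat N w (ltnSn _) Fw FXw.
  have qr l : (l < t)%N -> q l = r l.
    move=> ltl; apply/eqP; rewrite -subr_eq0; apply/eqP.
    apply: (I1 (fun l => q l - r l)) => // [i lti|].
      rewrite (leq_trans (size_polyD _ _)) // size_polyN geq_max sq.
      by rewrite (leq_trans (sr _ lti)) //; lia.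
    under eq_bigr do rewrite scalerBl.
    by rewrite sumrB -er subrr.
  have c0 l : (l < t)%N -> c l = 0.
    move=> ltl; have [ltb|leb] := ltnP (b l) N.+1; last by rewrite /c ltnNge leb.
    have := congr1 (fun s : {poly K} => s`_(N - b l)) (qr l ltl).
    by rewrite /q coefZ coefXn eqxx mulr1 => ->; rewrite nth_default ?sr.
  apply: I1 => // l ltl; have := cX l ltl.
  by rewrite c0 // scale0r subr0.
- move=> l k ltl; rewrite /m; case: ifP => // ltb ltk.
  case: k ltk => [_|k ltk].
    apply: Fmono => //; apply/(proj1 (vF N (leqnn _))).
    by apply: (@xspan_X _ _ _ _ (fun l => N - b l)%N) => //; lia.
  rewrite exprS -scalerA; apply: FX => //; apply/(proj1 (vF N (leqnn _))).
  by apply: (@xspan_X _ _ _ _ (fun l => N - b l)%N) => //; lia.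
- by move=> l ltl; rewrite /m; case: ltnP => leb; lia.
exists v' => [l ltl neb|n].
  by apply: ev' => //; rewrite /m; case: ltnP => leb //; lia.
rewrite leq_eqVlt => /orP[/eqP -> //|]; rewrite ltnS => len.
apply: eq_xbasis (vF n len) => // l ltl ltb; rewrite ev' // /m ifT //; lia.
Qed.

Lemma graded_upto_le N M : (M <= N)%N -> graded_upto N -> graded_upto M.
Proof.
move=> leM [F0 Fmono FX Fsat Fdim]; split=> // n; [move=> w ltn..|move=> len].
- by apply: Fmono; apply: leq_trans leM.
- by apply: FX; apply: leq_trans leM.
- by apply: Fsat; apply: leq_trans leM.
- by apply: Fdim; apply: leq_trans leM.
Qed.

Lemma graded_basis_upto N : graded_upto N ->
  exists v, forall n, (n <= N)%N -> xbasis (F n) t v (fun l => (n - b l)%N).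
Proof.
elim: N => [|N IHN] gF.
  exists (fun _ => 0) => n; rewrite leqn0 => /eqP ->; case: gF => F0 _ _ _ Fdim.
  have [F00 _] := has_dim_subspace (Fdim 0%N (leqnn _)).
  split=> [w|p sp _ l /sp]; last by rewrite sub0n leqn0 size_poly_eq0 => /eqP.
  split=> [/F0 ->|[p _ ->]]; first exact: (proj1 (xspan_subspace _ _ _)).
  by under eq_bigr do rewrite scaler0; rewrite big1_eq.
have [v vF] := IHN (graded_upto_le (leqnSn N) gF).
by have [v' _ v'F] := graded_step gF vF; exists v'.
Qed.

Lemma graded_basis : (forall N, graded_upto N) ->
  exists v, forall n, xbasis (F n) t v (fun l => (n - b l)%N).
Proof.
(* Beyond [M] every [b l] is smaller than the degree, so the generators no longer change. *)
move=> gF; pose M := (\max_(l < t) b l).+1.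
have ltM l : (l < t)%N -> (b l < M)%N.
  by move=> ltl; rewrite ltnS; apply: (leq_bigmax (F := fun l : 'I_t => b l) (Ordinal ltl)).
have [v vF] := graded_basis_upto (gF M); exists v => n.
suff main k : forall n, (n <= M + k)%N -> xbasis (F n) t v (fun l => (n - b l)%N).
  by apply: (main n); rewrite leq_addl.
elim: k => [|k IHk] {}n; first by rewrite addn0; apply: vF.
rewrite addnS => len; have [v' ev' bv'] := graded_step (gF _) IHk.
apply: eq_xbasis (bv' n len) => // l ltl _; apply: ev' => //.
have := ltM l ltl; lia.
Qed.

End GradedBasis.

(** * Generators and relations of a space of forms *)

Lemma scale_regular (R : nzRingType) (a : R) (x : R^o) : a *: x = a * (x : R) :> R.
Proof. by []. Qed.

Section Spaces.
Variable K : fieldType.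
Implicit Types (S : {poly K} -> Prop) (p q : {poly K}).

Notation pdim := (@has_dim K ({poly K})^o).
Notation pspan := (@xspan K ({poly K})^o).
Notation pbasis := (@xbasis K ({poly K})^o).
Notation psubspace := (@subspace K ({poly K})^o).

(* A form of degree n is represented by its dehomogenization, a polynomial of
   size at most n.+1; multiplication by y becomes the inclusion. dn S i and
   up S i are then R_{-i}V and R_iV. *)
Definition dn S i p : Prop := forall a, (a <= i)%N -> S ('X^a * p).

Definition up S i p : Prop :=
  exists2 v : nat -> {poly K}, (forall a, (a <= i)%N -> S (v a)) &
    p = \sum_(a < i.+1) 'X^a * v a.

Lemma dnS S i p : dn S i.+1 p <-> dn S i p /\ dn S i ('X * p).
Proof.
split=> [Sp|[Sp SXp] [|a] lea]; last by rewrite exprSr -mulrA; apply: SXp.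
  by split=> a lea; [apply: Sp; lia | rewrite mulrA -exprSr; apply: Sp].
exact: Sp.
Qed.

Lemma dn_le S i i' p : (i' <= i)%N -> dn S i p -> dn S i' p.
Proof. by move=> lei Sp a lea; apply: Sp; apply: leq_trans lei. Qed.

Lemma dn0 S p : dn S 0 p <-> S p.
Proof.
split=> [/(_ 0%N (leqnn _))|Sp a]; first by rewrite expr0 mul1r.
by rewrite leqn0 => /eqP ->; rewrite expr0 mul1r.
Qed.

Lemma subspace_dn S i : psubspace S -> psubspace (dn S i).
Proof.
case=> S0 SD; split=> [a _|c p q Sp Sq a lea]; first by rewrite mulr0.
rewrite mulrDr scale_regular mulrCA; apply: SD; [exact: Sp | exact: Sq].
Qed.

Lemma subspace_up S i : psubspace S -> psubspace (up S i).
Proof.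
case=> S0 SD; split=> [|c p q [v Sv ->] [w Sw ->]].
  by exists (fun=> 0) => //; rewrite big1 // => a _; rewrite mulr0.
exists (fun a => c%:P * v a + w a) => [a lea|].
  by apply: SD; [apply: Sv | apply: Sw].
rewrite scale_regular mulr_sumr -[LHS]big_split /=; apply: eq_bigr => a _.
by rewrite mulrDr mulrCA.
Qed.

Lemma up_mulXn S i a p : psubspace S -> (a <= i)%N -> S p -> up S i ('X^a * p).
Proof.
move=> [S0 SD] lea Sp; exists (fun l => if l == a then p else 0) => [l _|].
  by case: ifP.
rewrite (bigD1 (inord a)) //= inordK // eqxx big1 ?addr0 // => l.
by rewrite -(inj_eq val_inj) /= inordK // => /negbTE ->; rewrite mulr0.
Qed.

Lemma eq_dn S S' i p : (forall q, S q <-> S' q) -> dn S i p <-> dn S' i p.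
Proof. by move=> eS; split=> Sp a lea; apply/eS; apply: Sp. Qed.

Lemma eq_up S S' i p : (forall q, S q <-> S' q) -> up S i p <-> up S' i p.
Proof. by move=> eS; split=> -[v Sv ->]; exists v => // a lea; apply/eS; apply: Sv. Qed.

Lemma up_span S t (f : nat -> {poly K}) (a : nat -> nat) i :
  (forall p, S p -> pspan t f a p) ->
  forall p, up S i p -> pspan t f (fun l => a l + i)%N p.
Proof.
move=> Sf _ [v Sv ->]; apply: (@subspace_sum _ ({poly K})^o); first exact: xspan_subspace.
move=> e _; have [p sp ->] := Sf _ (Sv e (leq_ord e)).
exists (fun l => 'X^e * p l) => [l ltl|].
  rewrite (leq_trans (size_polyMleq _ _)) // size_polyXn.
  by have := sp l ltl; have := leq_ord e; lia.
rewrite mulr_sumr; apply: eq_bigr => l _.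
by rewrite !scale_regular mulrA.
Qed.

(** A power ['X^m] with [m < a l + i] splits into at most i factors absorbed by [up] and a rest of
    exponent below [a l]; when [m <= i] the rest is 1, and positivity of [a l] puts the generator
    itself in [S]. *)
Lemma xspan_up S t (f : nat -> {poly K}) (a : nat -> nat) i :
  psubspace S -> (forall l, (l < t)%N -> (0 < a l)%N) ->
  (forall p, pspan t f a p -> S p) ->
  forall p, pspan t f (fun l => a l + i)%N p -> up S i p.
Proof.
move=> sS a_gt0 fS; apply: (@xspan_min K ({poly K})^o (up S i)); first exact: subspace_up.
move=> l m ltl ltm; have -> : 'X^m = 'X^(minn m i) * 'X^(m - minn m i) :> {poly K}.
  by rewrite -exprD; congr 'X^_; lia.
rewrite scale_regular -mulrA; apply: up_mulXn => //; first by lia.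
apply: fS; apply: (@xspan_X K ({poly K})^o) => //; have := a_gt0 l ltl; lia.
Qed.

Section Generators.
Variables (j t : nat) (S : {poly K} -> Prop) (a : nat -> nat).
Hypothesis leaj : forall l, (l < t)%N -> (a l <= j.+1)%N.
Hypothesis dnE : forall i, pdim (dn S i) (excess t a i).

(** The spaces R_{-i}V, indexed by m = [j.+1 - i], form a graded module with generators in degrees
    [j.+1 - a l]; the shift by one makes the piece m = 0 vanish. [dnS] provides both multiplication
    by ['X] and saturation. *)
Lemma dn_generators : exists f : nat -> {poly K},
  forall i, (i <= j.+1)%N -> pbasis (dn S i) t f (fun l => a l - i)%N.
Proof.
pose F m := dn S (j.+1 - m).
have gF : @graded_upto K ({poly K})^o F t (fun l => j.+1 - a l)%N j.+1.
  split=> [w|m w ltm|m w ltm|m w ltm|m lem]; rewrite /F.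
  - rewrite subn0 => Sw; have := dnE j.+1.
    have -> : excess t a j.+1 = 0%N by apply: big1 => l _; have := leaj (ltn_ord l); lia.
    by case=> v [/(_ w)[/(_ Sw)[r ->] _] _]; rewrite /lincomb big_ord0.
  - by apply: dn_le; lia.
  - by have -> : (j.+1 - m = (j.+1 - m.+1).+1)%N by [lia]; move/dnS => [].
  - by move=> Sw SXw; have -> : (j.+1 - m = (j.+1 - m.+1).+1)%N by [lia]; apply/dnS.
  have <- : excess t a (j.+1 - m) = (\sum_(l < t) (m - (j.+1 - a l)))%N; last exact: dnE.
  by apply: eq_bigr => l _; have := leaj (ltn_ord l); lia.
have [f fP] := graded_basis_upto gF; exists f => i lei.
have := fP (j.+1 - i)%N (leq_subr _ _); rewrite /F subKn //.
apply: eq_xbasis => // l ltl; have := leaj ltl; lia.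
Qed.
End Generators.

(* The degree (j + i) relations between the generators f l of degree j+1 - a l. *)
Definition syzygy t (f : nat -> {poly K}) (a : nat -> nat) i (q : 'rV[{poly K}]_t) : Prop :=
  (forall l : 'I_t, (size (q 0%R l) <= a l + i)%N) /\ \sum_(l < t) q 0 l * f l = 0.

Lemma syzygy_map_klinear t (f : nat -> {poly K}) :
  klinear (fun q : 'rV[{poly K}]_t => (\sum_(l < t) q 0 l * f l : ({poly K})^o)).
Proof.
move=> c p q; rewrite scaler_sumr -big_split /=; apply: eq_bigr => l _.
by rewrite !mxE mulrDl [X in _ = X + _]mulrA.
Qed.

Lemma syzygy_dim S t (f : nat -> {poly K}) (a : nat -> nat) i m :
  (forall p, up S i p <-> pspan t f (fun l => a l + i)%N p) -> pdim (up S i) m ->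
  exists2 k, has_dim (syzygy f a i : 'rV_t -> Prop) k &
    (k + m)%N = (\sum_(l < t) (a l + i))%N.
Proof.
move=> upE dimU; have dimT := has_dim_xspan (@indep_unit_row K t (fun l => a l + i)%N).
have relE (q : 'rV_t) : syzygy f a i q <-> xspan t (@unit_row K t) (fun l => a l + i)%N q /\
    (\sum_(l < t) q 0 l * f l : ({poly K})^o) = 0.
  split=> -[H1 H2]; split=> //; first exact: (proj2 (xspan_unit_row (fun l => a l + i)%N q) H1).
  exact: (proj1 (xspan_unit_row (fun l => a l + i)%N q) H1).
have gL := @syzygy_map_klinear t f.
have [k lek dimK] : exists2 k, (k <= \sum_(l < t) (a l + i))%N &
    has_dim (fun q : 'rV_t => xspan t (@unit_row K t) (fun l => a l + i)%N q /\
      (\sum_(l < t) q 0 l * f l : ({poly K})^o) = 0) k.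
  apply: has_dim_sub dimT => [|q []//]; split.
    split; first exact: (proj1 (xspan_subspace _ _ _)).
    by apply: big1 => l _; rewrite mxE mul0r.
  move=> c p q [Sp gp] [Sq gq]; split; first exact: (proj2 (xspan_subspace _ _ _)).
  by rewrite gL gp gq scaler0 addr0.
exists k; first by apply: eq_has_dim dimK => q; rewrite relE.
have [_ dimI] := rank_nullity gL dimT dimK.
have := has_dim_uniq dimU (eq_has_dim _ dimI); move=> -> //; first lia.
move=> p; rewrite upE; split=> [[q [r sr ->] ->]|[r sr ->]].
  exists r => //; rewrite sum_unit_row; apply: eq_bigr => l _; rewrite mxE //.
exists (\sum_(l < t) r l *: unit_row K t l); first by exists r.
by rewrite sum_unit_row; apply: eq_bigr => l _; rewrite mxE.
Qed.

Section Relations.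
Variables (j n c : nat) (S : {poly K} -> Prop) (a b : nat -> nat) (f : nat -> {poly K}).
Hypothesis a_gt0 : forall l, (l < n.+1)%N -> (0 < a l)%N.
Hypothesis sum_ab : (\sum_(l < n.+1) a l + \sum_(s < n) b s + c = j.+1)%N.
Hypothesis Sf : pbasis S n.+1 f a.
Hypothesis upE : forall i, pdim (up S i) ((j + i).+1 - (c + excess n b i)).

Lemma up_generators i p : up S i p <-> pspan n.+1 f (fun l => a l + i)%N p.
Proof.
split; first by apply: up_span => q /(proj1 Sf).
apply: xspan_up => [|//|q /(proj1 Sf)//].
exact: (@has_dim_subspace _ ({poly K})^o) (has_dim_xbasis Sf).
Qed.

(** The syzygies form a saturated graded module because multiplication by ['X] raises the size of a
    nonzero entry by exactly one; they vanish in degree 0 by independence of the generators, and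
    their dimensions follow from those of [up S i]. *)
Lemma syzygy_basis : exists C : nat -> 'rV[{poly K}]_n.+1,
  forall i, xbasis (syzygy f a i) n C (fun s => i - b s)%N.
Proof.
apply: graded_basis => N; split=> [q [sq]|i q _ [sq eq0]|i q _ [sq eq0]|i q _ [sq eq0] [sXq _]|i _].
- have [_ fI] := Sf => eq0; apply/rowP => l; rewrite mxE.
  pose p l := if @insub nat (fun l => (l < n.+1)%N) 'I_n.+1 l is Some l' then q 0 l' else 0.
  have pE (i : 'I_n.+1) : p i = q 0 i by rewrite /p valK.
  rewrite -pE; apply: fI => // [i lti|].
    by rewrite (pE (Ordinal lti)) -[a _]addn0; apply: sq.
  by rewrite -[RHS]eq0; apply: eq_bigr => i _; rewrite pE.
- by split=> // l; apply: leq_trans (sq l) _; rewrite addnS.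
- split=> [l|].
    rewrite mxE (leq_trans (size_polyMleq _ _)) // size_polyX addnS.
    exact: sq.
  rewrite -[RHS](mulr0 'X) -[in RHS]eq0 mulr_sumr; apply: eq_bigr => l _.
  by rewrite mxE mulrA.
- split=> // l; have [->|nz] := eqVneq (q 0 l) 0; first by rewrite size_poly0.
  by have := sXq l; rewrite mxE mulrC size_mulX // addnS ltnS.
have [k dimk ek] := syzygy_dim (up_generators i) (upE i).
suff <- : k = (\sum_(s < n) (i - b s))%N by [].
(* Termwise (i - b) + b = i + (b - i) for truncated subtraction: both sides are the maximum of i and
   b, or that maximum plus what was cut off. *)
have eb : (\sum_(s < n) (i - b s) + \sum_(s < n) b s = n * i + excess n b i)%N.
  have -> : (n * i = \sum_(s < n) i)%N by rewrite sum_nat_const card_ord.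
  by rewrite /excess -!big_split /=; apply: eq_bigr => s _; lia.
have exb : (excess n b i <= \sum_(s < n) b s)%N by apply: leq_sum => s _; exact: leq_subr.
move: ek; rewrite big_split /= sum_nat_const card_ord mulSn; move: sum_ab eb exb.
move: (\sum_(l < n.+1) a l)%N (\sum_(s < n) b s)%N (\sum_(s < n) (i - b s))%N.
move: (excess n b i) (n * i)%N => ? ? ? ? ?; lia.
Qed.

End Relations.
End Spaces.

(** * Degrees of determinants and cofactors of column 0 *)

Section Determinants.

Lemma size_det (R : comNzRingType) m (M : 'M[{poly R}]_m) (a b : 'I_m -> nat) :
  (forall r s, (size (M r s) <= (a r + b s).+1)%N) ->
  (size (\det M) <= (\sum_r a r + \sum_s b s).+1)%N.
Proof.
move=> sM; apply: (leq_trans (size_sum _ _ _)); apply/bigmax_leqP => g _.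
have -> : (\sum_s b s = \sum_s b (g s))%N by apply: reindex_inj; apply: perm_inj.
rewrite size_Msign -big_split /=.
elim/big_rec2: _ => [|i d p _ IH]; first by rewrite size_poly1.
rewrite (leq_trans (size_polyMleq _ _)) //; move: (sM i (g i)) IH.
move: (size (M i (g i))) (size p) => x y; lia.
Qed.

Lemma size_adj_row0 (R : comNzRingType) n (P : 'M[{poly R}]_n.+1) (a b : nat -> nat)
    (l : 'I_n.+1) :
  (forall r s, (size (P r (lift ord0 s)) <= (a r + b s).+1)%N) ->
  (size (\adj P ord0 l) + a l <= (\sum_(r < n.+1) a r + \sum_(s < n) b s).+1)%N.
Proof.
move=> sP; rewrite mxE /cofactor size_Msign (bigD1_ord l) //=.
have : (size (\det (row' l (col' ord0 P))) <= (\sum_(r < n) a (lift l r) + \sum_(s < n) b s).+1)%N.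
  by apply: (@size_det R n _ (fun r => a (lift l r)) b) => r s; rewrite !mxE; apply: sP.
move: (size _) (\sum_(r < n) _)%N (\sum_(s < n) _)%N => x y z; lia.
Qed.

Definition setcol0 (R : nzRingType) n (P : 'M[R]_n.+1) (u : 'cV[R]_n.+1) : 'M[R]_n.+1 :=
  \matrix_(r, s) if s == ord0 then u r 0 else P r s.

Lemma det_setcol0 (R : comNzRingType) n (P : 'M[R]_n.+1) u :
  \det (setcol0 P u) = \sum_l u l 0 * \adj P ord0 l.
Proof.
rewrite (expand_det_col _ ord0); apply: eq_bigr => l _; rewrite !mxE eqxx.
congr (_ * (_ * \det _)); apply/matrixP => r s.
by rewrite !mxE [lift _ _ == _]eq_sym (negbTE (neq_lift _ _)).
Qed.

Lemma adj_row0_mul (R : comNzRingType) n (P : 'M[R]_n.+1) (s : 'I_n) :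
  \sum_l \adj P ord0 l * P l (lift ord0 s) = 0.
Proof.
have /matrixP/(_ ord0 (lift ord0 s)) := mul_adj_mx P; rewrite !mxE.
by rewrite -[_ == _]/(ord0 == _) (negbTE (neq_lift _ _)).
Qed.

(** A relation among the columns 1, ..., n is a vector with first entry 0 killed by the matrix whose
    column 0 is the [l]-th unit vector; the determinant of that matrix is the nonzero cofactor. *)
Lemma adj_row0_free (R : idomainType) n (P : 'M[R]_n.+1) l (p : 'I_n -> R) :
  \adj P ord0 l != 0 ->
  (forall r, \sum_s p s * P r (lift ord0 s) = 0) -> forall s, p s = 0.
Proof.
move=> nz Pp s; pose M := setcol0 P (delta_mx l 0).
have detM : \det M = \adj P ord0 l.
  rewrite det_setcol0 (bigD1 l) //= !mxE !eqxx mul1r big1 ?addr0 // => i ni.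
  by rewrite mxE (negbTE ni) mul0r.
pose y := \col_r (if unlift ord0 r is Some s then p s else 0) : 'cV[R]_n.+1.
have My : M *m y = 0.
  apply/colP => r; rewrite !mxE big_ord_recl !mxE unlift_none mulr0 add0r.
  rewrite -[RHS](Pp r); apply: eq_bigr => i _.
  by rewrite !mxE liftK [lift _ _ == _]eq_sym (negbTE (neq_lift _ _)) mulrC.
have /(congr1 (mulmx (\adj M))) := My; rewrite mulmxA mul_adj_mx mulmx0 mul_scalar_mx detM.
move=> /colP/(_ (lift ord0 s)); rewrite mxE [y _ _]mxE liftK [RHS]mxE => /eqP.
by rewrite mulf_eq0 (negbTE nz) => /eqP.
Qed.

End Determinants.

(** A gcd as a combination of the family; the coefficients later fill column 0 of the Hilbert-Burch
    matrix. *)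
Lemma family_bezout (K : fieldType) t (f : nat -> {poly K}) :
  exists u : nat -> {poly K}, forall l, (l < t)%N -> \sum_(i < t) u i * f i %| f l.
Proof.
elim: t => [|t [u uP]]; first by exists (fun=> 0).
set g := \sum_(i < t) u i * f i in uP.
have [[x y] /= exy] := Bezoutp g (f t).
exists (fun i => if i == t then y else x * u i) => l.
have -> : \sum_(i < t.+1) (if i == t :> nat then y else x * u i) * f i = x * g + y * f t.
  rewrite big_ord_recr /= eqxx; congr (_ + _); rewrite mulr_sumr.
  by apply: eq_bigr => i _; rewrite ltn_eqF // mulrA.
rewrite (eqp_dvdl _ exy) ltnS leq_eqVlt => /orP[/eqP ->|ltl]; first exact: dvdp_gcdr.
exact: dvdp_trans (dvdp_gcdl _ _) (uP l ltl).
Qed.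

(** * Presentations by maximal minors *)

Section Presentation.
Variable K : fieldType.

Notation pdim := (@has_dim K ({poly K})^o).
Notation pspan := (@xspan K ({poly K})^o).
Notation pbasis := (@xbasis K ({poly K})^o).
Notation psubspace := (@subspace K ({poly K})^o).

(** Row 0 of the adjugate lists the signed maximal minors of the columns 1, ..., n. Keeping a square
    matrix gives access to the identities for determinants. *)
Definition minor_gen (R : comNzRingType) n (P : 'M[R]_n.+1) (h : R) (l : nat) : R :=
  h * \adj P ord0 (inord l).

(* V is generated in degree j by h times the maximal minors of the columns
   1, ..., n of P, whose entry (r, s) has degree a r + b s; column 0 is junk. *)
Definition presented j n (a b : nat -> nat) c (S : {poly K} -> Prop) : Prop :=
  exists (P : 'M[{poly K}]_n.+1) (h : {poly K}),
  [/\ forall r s, (size (P r (lift ord0 s)) <= (a r + b s).+1)%N,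
      (size h <= c.+1)%N,
      forall p, S p <-> pspan n.+1 (minor_gen P h) a p,
      pdim S (\sum_(l < n.+1) a l)
    & (\sum_(l < n.+1) a l + \sum_(s < n) b s + c = j.+1)%N].

(** With Bezout coefficients of the gcd g in column 0 and the basic syzygies in the others, [P]
    becomes invertible over [K[x]], so its determinant is a constant. The row of the [f l] times [P]
    is g times the first unit vector, and multiplying by the adjugate expresses [f] by the
    cofactors. *)
Lemma hilbert_burch n (a b : nat -> nat) (f : nat -> {poly K}) (C : nat -> 'rV[{poly K}]_n.+1) :
  (forall i, xbasis (syzygy f a i) n C (fun s => i - b s)%N) ->
  (exists2 l, (l < n.+1)%N & f l != 0) ->
  exists (P : 'M[{poly K}]_n.+1) (h : {poly K}),
  [/\ forall r s, P r (lift ord0 s) = C s 0 r,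
      forall l, (l < n.+1)%N -> f l = minor_gen P h l,
      h != 0 & forall l, (l < n.+1)%N -> h %| f l].
Proof.
move=> Cb [l0 ltl0 fl0]; have [u uP] := family_bezout n.+1 f.
set g := \sum_(i < _) _ in uP.
have g_neq0 : g != 0 by apply: contraNneq fl0 => g0; have := uP _ ltl0; rewrite g0 dvd0p.
pose P : 'M[{poly K}]_n.+1 :=
  \matrix_(r, s) if unlift ord0 s is Some s' then C s' 0 r else u r.
have PC r s : P r (lift ord0 s) = C s 0 r by rewrite mxE liftK.
have P0 r : P r ord0 = u r by rewrite mxE unlift_none.
have [Y PY] : exists Y, P *m Y = 1%:M.
  suff [y yP] : exists y : 'I_n.+1 -> 'cV_n.+1, forall r, P *m y r = delta_mx r 0.
    exists (\matrix_(s, r) y r s 0); apply/matrixP => r r'; rewrite !mxE.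
    have /colP/(_ r) := yP r'; rewrite !mxE andbT => <-.
    by apply: eq_bigr => s _; rewrite !mxE.
  apply: (@fin_all_exists _ (fun=> 'cV_n.+1) (fun r y => P *m y = delta_mx r 0)) => r0.
  (* The unit vector at [r0] minus x times the Bezout row is a syzygy, hence a combination of the
     columns [C]; so the unit vector is a combination of the columns of [P]. The degree [i] is just
     large enough to bound all entries. *)
  pose x := f r0 %/ g; pose w : 'rV_n.+1 := \row_r ((r == r0)%:R - u r * x).
  pose i := \sum_(r < n.+1) size (w 0 r).
  have [p sp ew] : xspan n C (fun s => i - b s)%N w.
    apply/(proj1 (Cb i)); split=> [l|].
      by rewrite (leq_trans _ (leq_addl _ _)) // /i (bigD1 l) //= leq_addr.
    under eq_bigr do rewrite mxE mulrBl mulrAC.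
    rewrite sumrB -mulr_suml -/g [g * x]mulrC divpK ?uP //.
    rewrite (bigD1 r0) //= eqxx mul1r big1 ?addr0 ?subrr // => r nr.
    by rewrite (negbTE nr) mul0r.
  exists (\col_s if unlift ord0 s is Some s' then p s' else x).
  apply/colP => r; rewrite mxE big_ord_recl P0 mxE unlift_none.
  under eq_bigr do rewrite PC mxE liftK.
  have -> : \sum_(s < n) C s 0 r * p s = w 0 r.
    by rewrite ew summxE; apply: eq_bigr => s _; rewrite !mxE mulrC.
  by rewrite !mxE andbT addrC subrK.
have Pu : P \in unitmx by case/mulmx1_unit: PY.
have [d d_neq0 eP] : exists2 d : K, d != 0 & \det P = d%:P.
  move: Pu; rewrite unitmxE poly_unitE => /andP[/eqP sP]; rewrite unitfE => dn.
  by exists (\det P)`_0 => //; apply: size1_polyC; rewrite sP.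
have fP : (\row_r f r) *m P = g *: delta_mx 0 0.
  apply/rowP => s; rewrite !mxE eqxx /=; case: (unliftP ord0 s) => [s'|] ->.
    rewrite eq_sym (negbTE (neq_lift _ _)) mulr0.
    have [|_ eC] := proj2 (proj1 (Cb (b s').+1) (C s')).
      rewrite -[C s']scale1r -[1]/('X^0); apply: xspan_X => //; lia.
    by rewrite -[RHS]eC; apply: eq_bigr => r _; rewrite mxE PC mulrC.
  by rewrite eqxx mulr1 /g; apply: eq_bigr => r _; rewrite mxE P0 mulrC.
have fE l : (l < n.+1)%N -> f l = minor_gen P (d^-1 *: g) l.
  move=> ltl; have /(congr1 (mulmx^~ (\adj P))) := fP.
  rewrite -mulmxA mul_mx_adj -scalemxAl mul_mx_scalar eP -rowE => /rowP/(_ (Ordinal ltl)).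
  rewrite [LHS]mxE [X in _ * X = _]mxE [RHS]mxE [X in _ = _ * X]mxE => ef.
  rewrite /minor_gen -scalerAl.
  have -> : inord l = Ordinal ltl by apply: val_inj; rewrite /= inordK.
  by rewrite -ef mul_polyC scalerA mulVf // scale1r.
exists P, (d^-1 *: g); split=> //; first by rewrite scaler_eq0 negb_or invr_eq0 d_neq0.
by move=> l ltl; rewrite dvdpZl ?invr_eq0 // uP.
Qed.

Section Present.
Variables (j n c : nat) (S : {poly K} -> Prop) (a b : nat -> nat).
Hypothesis a_gt0 : forall l, (l < n.+1)%N -> (0 < a l)%N.
Hypothesis sum_ab : (\sum_(l < n.+1) a l + \sum_(s < n) b s + c = j.+1)%N.
Hypothesis sizeS : forall p, S p -> (size p <= j.+1)%N.
Hypothesis dnE : forall i, pdim (dn S i) (excess n.+1 a i).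
Hypothesis upE : forall i, pdim (up S i) ((j + i).+1 - (c + excess n b i)).

Lemma le_aj l : (l < n.+1)%N -> (a l <= j.+1)%N.
Proof.
move=> ltl; rewrite -sum_ab -addnA; apply: leq_trans (leq_addr _ _).
by rewrite (bigD1 (Ordinal ltl)) //= leq_addr.
Qed.

Lemma free_resolution : exists (f : nat -> {poly K}) (C : nat -> 'rV[{poly K}]_n.+1),
  [/\ forall i, (i <= j.+1)%N -> pbasis (dn S i) n.+1 f (fun l => a l - i)%N,
      forall i p, up S i p <-> pspan n.+1 f (fun l => a l + i)%N p
    & forall i, xbasis (syzygy f a i) n C (fun s => i - b s)%N].
Proof.
have [f fP] := dn_generators le_aj dnE.
have Sf : pbasis S n.+1 f a.
  have [Sf fI] := fP 0%N isT; split=> [p|p sp]; last first.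
    by apply: fI => l ltl; rewrite subn0 sp.
  by rewrite -dn0 Sf; split=> -[q sq ->]; exists q => // l ltl; have := sq l ltl; rewrite subn0.
have [C CP] := syzygy_basis a_gt0 sum_ab Sf upE.
by exists f, C; split=> // i p; exact: (up_generators a_gt0 Sf).
Qed.

Lemma presented_of_dims : presented j n a b c S.
Proof.
have [f [C [fP upf CP]]] := free_resolution.
have Sf : pbasis S n.+1 f a.
  have [Sf fI] := fP 0%N isT; split=> [p|p sp]; last first.
    by apply: fI => l ltl; rewrite subn0 sp.
  by rewrite -dn0 Sf; split=> -[q sq ->]; exists q => // l ltl; have := sq l ltl; rewrite subn0.
have f_neq0 l : (l < n.+1)%N -> f l != 0.
  by move=> ltl; apply: (indep_neq0 (proj2 Sf)) => //; apply: a_gt0.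
have [|P [h [PC fE h_neq0 hf]]] := hilbert_burch CP; first by exists 0%N; rewrite ?f_neq0.
exists P, h; split=> //.
- move=> r s; rewrite PC -addnS.
  have [|sC _] := proj2 (proj1 (CP (b s).+1) (C s)); last exact: sC.
  rewrite -[C s]scale1r -[1]/('X^0); apply: xspan_X => //; lia.
(* In large degree the dimension of [up] falls short of the full one by exactly c, while all its
   elements are multiples of h; hence the degree of h is at most c. *)
- have [N NP] := excess_eventually0 n b.
  have dimU := upE N.+1; rewrite NP // addn0 in dimU.
  have hI m : @indep K ({poly K})^o 1 (fun=> h) (fun=> m).
    move=> p _; rewrite big_ord1 => /eqP; rewrite mulf_eq0 (negbTE h_neq0) orbF => /eqP p0.
    by case.
  have := @has_dim_le _ _ _ _ _ _ _ dimU (has_dim_xspan (hI ((j + N.+1).+1 - (size h).-1)%N)).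
  rewrite big_ord1 => lec; have szh : (0 < size h)%N by rewrite size_poly_gt0.
  suff : ((j + N.+1).+1 - c <= (j + N.+1).+1 - (size h).-1)%N by lia.
  apply: lec => p Up; have /dvdpP[q ep] : h %| p.
    have /upf[q _ ->] := Up; elim/big_rec: _ => [|l x _ hx]; first exact: dvdp0.
    by rewrite dvdp_add // scale_regular dvdp_mull // hf.
  exists (fun=> q); last by rewrite big_ord1.
  move=> _ _; have [->|q0] := eqVneq q 0; first by rewrite size_poly0.
  have : (size p <= (j + N.+1).+1)%N.
    case: Up => v Sv ->; apply: leq_trans (size_sum _ _ _) _; apply/bigmax_leqP => i _.
    rewrite (leq_trans (size_polyMleq _ _)) // size_polyXn.
    move: (sizeS (Sv i (leq_ord i))) (leq_ord i).
    by move: (size (v i)) => x; lia.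
  rewrite ep size_mul //; move: szh; rewrite -size_poly_gt0 in q0; move: q0.
  move: (size q) (size h) => x y; lia.
- move=> p; rewrite (proj1 Sf); split; apply: eq_xspan => l ltl _; first exact: fE.
  by rewrite fE.
exact: has_dim_xbasis Sf.
Qed.

End Present.

Lemma presented_subspace j n a b c S : presented j n a b c S -> psubspace S.
Proof. by case=> P [h [_ _ _ dimS _]]; apply: has_dim_subspace dimS. Qed.

Lemma minor_gen_size (R : comNzRingType) n (P : 'M[{poly R}]_n.+1) (h : {poly R}) (a b : nat -> nat) c l
    (q : {poly R}) :
  (forall r s, (size (P r (lift ord0 s)) <= (a r + b s).+1)%N) -> (size h <= c.+1)%N ->
  (l < n.+1)%N -> (size q <= a l)%N ->
  (size (q * minor_gen P h l)%R <= \sum_(r < n.+1) a r + \sum_(s < n) b s + c)%N.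
Proof.
move=> sP sh ltl; have [->|nz] := eqVneq q 0; first by rewrite mul0r size_poly0.
rewrite -size_poly_gt0 in nz; move: nz => q_gt0 sq.
have := size_adj_row0 (inord l) sP; rewrite inordK // => sadj.
apply: (leq_trans (size_polyMleq _ _)).
move: sadj sh q_gt0 sq (size_polyMleq h (\adj P ord0 (inord l))); rewrite -/(minor_gen P h l).
move: (\sum_(r < n.+1) a r)%N (\sum_(s < n) b s)%N (size (minor_gen P h l)) (size q) => A B x y.
by move: (size (\adj P ord0 (inord l))) (size h) => z u; lia.
Qed.

Lemma presented_basis j n a b c S : presented j n a b c S ->
  exists (P : 'M[{poly K}]_n.+1) (h : {poly K}),
  [/\ forall r s, (size (P r (lift ord0 s)) <= (a r + b s).+1)%N,
     (size h <= c.+1)%N & pbasis S n.+1 (minor_gen P h) a].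
Proof.
case=> P [h [sP sh Sf dimS _]]; exists P, h; split=> //.
exact: xspan_xbasis.
Qed.

(** Only an inequality: the multiples ['X^k] of the generators with [k < a l - i] lie in [dn S i],
    but a special matrix may allow more elements. *)
Lemma presented_dn j n a b c S i m : presented j n a b c S ->
  pdim (dn S i) m -> (excess n.+1 a i <= m)%N.
Proof.
move=> pS dimD; have sS := presented_subspace pS.
have [P [h [sP sh [Sf fI]]]] := presented_basis pS.
have fIi : @indep K ({poly K})^o n.+1 (minor_gen P h) (fun l => a l - i)%N.
  by move=> p sp; apply: fI => l ltl; apply: leq_trans (sp l ltl) (leq_subr _ _).
apply: (has_dim_le _ (has_dim_xspan fIi) dimD).
apply: (@xspan_min K ({poly K})^o (dn S i)); first exact: subspace_dn.
move=> l k ltl ltk e lee; rewrite scale_regular mulrA -exprD; apply/Sf.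
by apply: (@xspan_X K ({poly K})^o) => //; lia.
Qed.

(** The columns of the matrix and their multiples are syzygies, which bounds the image from above; a
    special matrix may have further syzygies. *)
Lemma presented_up j n a b c S i m : presented j n a b c S -> (0 < \sum_(l < n.+1) a l)%N ->
  pdim (up S i) m -> (m <= (j + i).+1 - (c + excess n b i))%N.
Proof.
move=> pS suma dimU; have sS := presented_subspace pS.
have [P [h [sP sh [Sf fI]]]] := presented_basis pS.
have [_ [_ [_ _ _ _ sumab]]] := pS.
(* A generator with [a l0 > 0] belongs to a basis, so its minor is nonzero; this makes the columns
   independent. *)
have [l0 al0] : exists l0 : 'I_n.+1, (0 < a l0)%N.
  apply/existsP; apply: contraLR suma; rewrite negb_exists -leqNgt leqn0 => /forallP a0.
  by rewrite big1 // => l _; have := a0 l; lia.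
have f0 : minor_gen P h l0 != 0 by apply: (indep_neq0 fI).
have adj0 : \adj P ord0 l0 != 0.
  by apply: contraNneq f0; rewrite /minor_gen inord_val => ->; rewrite mulr0.
have dimT := has_dim_xspan (@indep_unit_row K n.+1 (fun l => a l + i)%N).
have gL := @syzygy_map_klinear K n.+1 (minor_gen P h).

have [k lek dimK] : exists2 k, (k <= \sum_(l < n.+1) (a l + i))%N &
    has_dim (fun q : 'rV_n.+1 => xspan n.+1 (@unit_row K n.+1) (fun l => a l + i)%N q /\
      (\sum_(l < n.+1) q 0 l * minor_gen P h l : ({poly K})^o) = 0) k.
  apply: has_dim_sub dimT => [|q []//]; split.
    split; first exact: (proj1 (xspan_subspace _ _ _)).
    by apply: big1 => l _; rewrite mxE mul0r.
  move=> e p q [Sp gp] [Sq gq]; split; first exact: (proj2 (xspan_subspace _ _ _)).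
  by rewrite gL gp gq scaler0 addr0.
have [_ dimI] := rank_nullity gL dimT dimK.
have lem : (m <= \sum_(l < n.+1) (a l + i) - k)%N.
  apply: has_dim_le dimU dimI => p Up.
  have [q sq ->] := up_span (fun p => proj1 (Sf p)) Up.
  exists (\sum_(l < n.+1) q l *: unit_row K n.+1 l); first by exists q.
  by rewrite sum_unit_row; apply: eq_bigr => l _; rewrite mxE.
pose C (s : nat) : 'rV[{poly K}]_n.+1 :=
  if @insub nat (fun s => (s < n)%N) 'I_n s is Some s' then \row_r P r (lift ord0 s') else 0.
have CE (s : 'I_n) r : C s 0 r = P r (lift ord0 s) by rewrite /C valK mxE.
have CI : indep n C (fun s => i - b s)%N.
  move=> p sp /rowP ep s lts.
  apply: (adj_row0_free (p := fun s : 'I_n => p s) adj0 _ (Ordinal lts)) => r.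
  have er := ep r; rewrite summxE [RHS]mxE in er; rewrite -[RHS]er; apply: eq_bigr => s' _.
  by rewrite [RHS]mxE CE.
have : (\sum_(s < n) (i - b s) <= k)%N.
  apply: has_dim_le (has_dim_xspan CI) dimK => q [p sp ->]; split.
    apply/xspan_unit_row => l; rewrite summxE.
    apply: leq_trans (size_sum _ _ _) _; apply/bigmax_leqP => s _.
    rewrite mxE CE; have [->|nz] := eqVneq (p s) 0; first by rewrite mul0r size_poly0.
    rewrite (leq_trans (size_polyMleq _ _)) //; rewrite -size_poly_gt0 in nz.
    move: nz (sp s (ltn_ord s)) (sP l s).
    by move: (size (p s)) (size (P l (lift ord0 s))) (a l) (b s) => x y u w; lia.
  under eq_bigr do rewrite summxE mulr_suml.
  rewrite exchange_big big1 //= => s _.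
  under eq_bigr do rewrite mxE CE /minor_gen inord_val mulrCA -!mulrA.
  rewrite -mulr_sumr -[X in _ * X = _]mulr_sumr.
  under eq_bigr do rewrite mulrC.
  by rewrite adj_row0_mul !mulr0.
have eb : (\sum_(s < n) (i - b s) + \sum_(s < n) b s = n * i + excess n b i)%N.
  have -> : (n * i = \sum_(s < n) i)%N by rewrite sum_nat_const card_ord.
  by rewrite /excess -!big_split /=; apply: eq_bigr => s _; lia.
have exb : (excess n b i <= \sum_(s < n) b s)%N by apply: leq_sum => s _; exact: leq_subr.
move: lem eb exb sumab lek; rewrite big_split /= sum_nat_const card_ord mulSn.
move: (\sum_(l < n.+1) a l)%N (\sum_(s < n) b s)%N (\sum_(s < n) (i - b s))%N.
move: (excess n b i) (n * i)%N => ? ? ? ? ?; lia.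
Qed.

End Presentation.

(** * Closure and semicontinuity *)

Section Evaluation.

Lemma eval_map_mpolyE n (k R : comNzRingType) (tau : {rmorphism k -> R}) (v : 'I_n -> R)
    (F : {mpoly k[n]}) :
  (map_mpoly tau F).@[v] = \sum_(m <- msupp F) tau F@_m * \prod_i v i ^+ m i.
Proof.
rewrite /map_mpoly /mmap (raddf_sum (meval v)) /=; apply: eq_bigr => m _.
by rewrite mevalM mevalC mmap1_id mevalX.
Qed.

Lemma eval_map_mpoly_rmorph n (k R L : comNzRingType) (tau : {rmorphism k -> R})
    (sigma : {rmorphism R -> L}) (st : {rmorphism k -> L}) v (F : {mpoly k[n]}) :
  (forall x, st x = sigma (tau x)) ->
  sigma (map_mpoly tau F).@[v] = (map_mpoly st F).@[fun i => sigma (v i)].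
Proof.
move=> est; rewrite !eval_map_mpolyE rmorph_sum; apply: eq_bigr => m _.
rewrite rmorphM est rmorph_prod; congr (_ * _).
by apply: eq_bigr => i _; rewrite rmorphXn.
Qed.

Lemma eval_homog_scale n (k R : comNzRingType) (tau : {rmorphism k -> R}) c v D
    (F : {mpoly k[n]}) : F \is D.-homog ->
  (map_mpoly tau F).@[fun i => c * v i] = c ^+ D * (map_mpoly tau F).@[v].
Proof.
move=> /dhomogP hF; rewrite !eval_map_mpolyE mulr_sumr; apply: eq_big_seq => m /hF em.
rewrite mulrCA; congr (_ * _); rewrite -em -[X in _ = _ ^+ X * _]/(mdeg m) mdegE -prodrXr -big_split /=.
by apply: eq_bigr => i _; rewrite exprMn.
Qed.

End Evaluation.

Section Grassmannian.
Variables d j : nat.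
Local Notation idx := (plucker_index d j).

Definition plu (R : comNzRingType) (N : 'M[R]_(d, j.+1)) (i : 'I_#|idx|) : R :=
  \det (colsub (val (enum_val i)) N).

Lemma plu_mul (R : comNzRingType) (g : 'M[R]_d) (N : 'M_(d, j.+1)) i :
  plu (g *m N) i = \det g * plu N i.
Proof. by rewrite /plu -mulmx_colsub det_mulmx. Qed.

Lemma plu_map (R L : comNzRingType) (sigma : {rmorphism R -> L}) (N : 'M[R]_(d, j.+1)) i :
  plu (map_mx sigma N) i = sigma (plu N i).
Proof. by rewrite /plu -det_map_mx map_mxsub. Qed.

Definition rowspace (K : fieldType) m n (N : 'M[K]_(m, n)) (p : {poly K}) : Prop :=
  exists r : 'rV_m, p = rVpoly (r *m N).

(* A stratum is described by its points N, of which only the row space matters. *)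
Definition point_class := forall L : fieldType, 'M[L]_(d, j.+1) -> Prop.

Definition cl (k : fieldType) (X : point_class) (K : fieldType) (emb : {rmorphism k -> K})
    (N : 'M[K]_(d, j.+1)) : Prop :=
  forall (D : nat) (F : {mpoly k[#|idx|]}), F \is D.-homog ->
    (forall (L : fieldType) (lam : {rmorphism k -> L}) U,
       X L U -> (map_mpoly lam F).@[plu U] = 0) ->
    (map_mpoly emb F).@[plu N] = 0.

Lemma cl_refl (k : fieldType) (X : point_class) (K : fieldType) (emb : {rmorphism k -> K}) N : X K N -> cl X emb N.
Proof. by move=> XN D F _; apply. Qed.

(** The forms have coefficients in [k] and are tested at points over all extensions, so closures
    compose although each degeneration enlarges the field. *)
Lemma cl_trans (k : fieldType) (X Y : point_class) (K : fieldType) (emb : {rmorphism k -> K}) N :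
  (forall (L : fieldType) (lam : {rmorphism k -> L}) U, X L U -> cl Y lam U) -> cl X emb N -> cl Y emb N.
Proof. by move=> XY NX D F hF YF; apply: (NX D F hF) => L lam U /XY/(_ D F hF); apply. Qed.

Lemma rowspaceP (K : fieldType) m n (N : 'M[K]_(m, n)) (p : {poly K}) : (size p <= n)%N ->
  rowspace N p <-> (poly_rV p <= N)%MS.
Proof.
move=> sp; split=> [[r ->]|/submxP[r er]]; first by rewrite rVpolyK submxMl.
by exists r; rewrite -er poly_rV_K.
Qed.

Lemma rowspace_size (K : fieldType) m n (N : 'M[K]_(m, n)) (p : {poly K}) : rowspace N p -> (size p <= n)%N.
Proof. by case=> r ->; apply: size_poly. Qed.

Lemma rowspace_sub (K : fieldType) m m' n (N : 'M[K]_(m, n)) (N' : 'M[K]_(m', n)) :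
  (forall p, rowspace N p -> rowspace N' p) -> (N <= N')%MS.
Proof.
move=> sNN; apply/row_subP => i.
have [|r er] := sNN (rVpoly (row i N)); first by exists (delta_mx 0 i); rewrite -rowE.
by rewrite -[row i N]rVpolyK er rVpolyK submxMl.
Qed.

Lemma sub_rowspace (K : fieldType) m m' n (N : 'M[K]_(m, n)) (N' : 'M[K]_(m', n)) p :
  (N <= N')%MS -> rowspace N p -> rowspace N' p.
Proof. by case/submxP=> C -> [r ->]; exists (r *m C); rewrite mulmxA. Qed.

(** A change of basis multiplies all Plücker coordinates by the same determinant, which a
    homogeneous form turns into a factor. *)
Lemma eq_rowspace_cl (k : fieldType) (X : point_class) (K : fieldType) (emb : {rmorphism k -> K}) (N N' : 'M[K]_(d, j.+1)) :
  row_free N -> (forall p, rowspace N p <-> rowspace N' p) -> cl X emb N' -> cl X emb N.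
Proof.
move=> Nf eN NX D F hF XF.
have /submxP[g eg] : (N <= N')%MS by apply: rowspace_sub => p /eN.
have -> : (map_mpoly emb F).@[plu N] = (map_mpoly emb F).@[fun i => \det g * plu N' i].
  by apply: meval_eq => i; rewrite eg plu_mul.
by rewrite (eval_homog_scale _ _ _ hF) (NX D F hF XF) mulr0.
Qed.

End Grassmannian.

Section Family.
Variables d j : nat.

Lemma row_free_minor (K : fieldType) m n (N : 'M[K]_(m, n)) : row_free N ->
  exists f : 'I_m -> 'I_n, \det (colsub f N) != 0.
Proof.
move=> Nf; have fN : row_full N^T by rewrite /row_full mxrank_tr.
exists (fullrankfun fN); rewrite -det_tr -unitfE -unitmxE.
have -> : (colsub (fullrankfun fN) N)^T = rowsub (fullrankfun fN) N^T.
  by apply/matrixP => u v; rewrite !mxE.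
exact: fullrowsub_unit.
Qed.

Lemma minor_row_free (K : fieldType) m n (N : 'M[K]_(m, n)) (f : 'I_m -> 'I_n) :
  \det (colsub f N) != 0 -> row_free N.
Proof.
rewrite -unitfE -unitmxE => fu; apply: inj_row_free => v vN.
have : v *m colsub f N = 0 by rewrite mulmx_colsub vN; apply/matrixP => u w; rewrite !mxE.
by move/(congr1 (mulmx^~ (invmx (colsub f N)))); rewrite mulmxK // mul0mx.
Qed.

(* N is a curve of points: rho is its generic point and t = r the special one. *)
Lemma specialize_cl (k K L : fieldType) (X : point_class d j) (emb : {rmorphism k -> K})
    (rho : {rmorphism {poly K} -> L}) (lam : {rmorphism k -> L}) (r : K)
    (N : 'M[{poly K}]_(d, j.+1)) : injective rho -> (forall x, lam x = rho (emb x)%:P) ->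
  X L (map_mx rho N) -> cl X emb (map_mx (horner_eval r) N).
Proof.
move=> rho_inj lamE XN D F hF XF.
pose mu : {rmorphism k -> {poly K}} := GRing.RMorphism.clone _ _ (@polyC K \o emb) _.
(* The value of the form along the curve is a polynomial in t; it vanishes under the injective
   [rho], so it is zero and vanishes at t = r. *)
have F0 : (map_mpoly mu F).@[plu N] = 0.
  apply: rho_inj; rewrite rmorph0 (@eval_map_mpoly_rmorph _ _ _ _ mu rho lam) //.
  rewrite -(XF L lam _ XN); apply: meval_eq => i; by rewrite plu_map.
have <- : (map_mpoly mu F).@[plu N].[r] = 0 by rewrite F0 horner0.
rewrite -/(horner_eval r _) (@eval_map_mpoly_rmorph _ _ _ _ mu (horner_eval r) emb).
  by apply: meval_eq => i; rewrite plu_map.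
by move=> x; rewrite /= /horner_eval hornerC.
Qed.

Variables (K : fieldType) (I : finType) (cardI : #|I| = d) (w : I -> {poly {poly K}}).
Hypothesis size_w : forall i, (size (w i) <= j.+1)%N.

Definition family_mx : 'M[{poly K}]_(d, j.+1) :=
  \matrix_(u < d, v < j.+1) (w (enum_val (cast_ord (esym cardI) u)))`_v.

Lemma rowspace_family (L : fieldType) (sigma : {rmorphism {poly K} -> L}) p :
  rowspace (map_mx sigma family_mx) p <->
  exists c : I -> L, p = \sum_i (c i)%:P * map_poly sigma (w i).
Proof.
have E (r : 'rV_d) : rVpoly (r *m map_mx sigma family_mx) =
    \sum_i (r 0 (cast_ord cardI (enum_rank i)))%:P * map_poly sigma (w i).
  rewrite [r *m _]mulmx_sum_row linear_sum /=.
  rewrite (reindex (fun i => cast_ord cardI (enum_rank i))) /=; last first.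
    by exists (fun u => enum_val (cast_ord (esym cardI) u)) => u _;
      rewrite ?enum_valK ?cast_ordKV // cast_ordK enum_rankK.
  apply: eq_bigr => i _; rewrite linearZ /= -mul_polyC; congr (_ * _).
  apply/polyP => v; rewrite coef_map coef_rVpoly.
  case: insubP => [v' _ <-|]; first by rewrite !mxE cast_ordK enum_rankK.
  rewrite -leqNgt => lev; rewrite nth_default; first by apply/esym/rmorph0.
  exact: leq_trans (size_w i) lev.
split=> [[r ->]|[c ->]]; first by rewrite E; exists (fun i => r 0 (cast_ord cardI (enum_rank i))).
exists (\row_u c (enum_val (cast_ord (esym cardI) u))); rewrite E.
by apply: eq_bigr => i _; rewrite mxE cast_ordK enum_rankK.
Qed.

Lemma family_cl (k L : fieldType) (X : point_class d j) (emb : {rmorphism k -> K})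
    (rho : {rmorphism {poly K} -> L}) (lam : {rmorphism k -> L}) (r : K)
    (N0 : 'M[K]_(d, j.+1)) : injective rho -> (forall x, lam x = rho (emb x)%:P) ->
  row_free N0 ->
  (forall p, rowspace N0 p <->
     exists c : I -> K, p = \sum_i (c i)%:P * map_poly (horner_eval r) (w i)) ->
  (forall U : 'M[L]_(d, j.+1), row_free U ->
     (forall p, rowspace U p <-> exists c : I -> L, p = \sum_i (c i)%:P * map_poly rho (w i)) ->
     X L U) ->
  cl X emb N0.
Proof.
move=> rho_inj lamE N0f N0E XU; pose N := family_mx.
have eN p : rowspace N0 p <-> rowspace (map_mx (horner_eval r) N) p.
  by rewrite N0E rowspace_family.
apply: (eq_rowspace_cl N0f eN). refine (@specialize_cl k K L X emb rho lam r N rho_inj lamE _).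
apply: XU; last by move=> p; apply: rowspace_family.
(* A minor that is nonzero at t = r is a nonzero polynomial in t, so the generic matrix has full
   rank as well. *)
have : row_free (map_mx (horner_eval r) N).
  have /mxrankS : (N0 <= map_mx (horner_eval r) N)%MS by apply: rowspace_sub => p /eN.
  by rewrite /row_free eqn_leq rank_leq_row (eqP N0f).
case/row_free_minor=> f; rewrite -map_mxsub det_map_mx => nz.
apply: (@minor_row_free _ _ _ _ f); rewrite -map_mxsub det_map_mx.
apply: contraNneq nz => e0; suff -> : \det (colsub f N) = 0 by rewrite rmorph0.
by apply: rho_inj; rewrite rmorph0.
Qed.

End Family.

(** * Rank conditions in Plücker coordinates *)

Section Semicontinuity.
Variables d j : nat.
Local Notation idx := (plucker_index d j).

(** The function [rk] counts the values below a given one; the inverse of this permutation lists the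
    indices in increasing order of [phi]. *)
Lemma increasing_reorder (phi : 'I_d -> 'I_j.+1) : injective phi ->
  exists s : {perm 'I_d}, forall u v : 'I_d, (u < v)%N -> (phi (s u) < phi (s v))%N.
Proof.
move=> phiI; pose rk u := #|[set x | (phi x < phi u)%N]|.
have rk_lt u v : (phi u < phi v)%N -> (rk u < rk v)%N.
  move=> lt; apply: proper_card; apply/properP; split.
    by apply/subsetP => x; rewrite !inE => /ltn_trans; apply.
  by exists u; rewrite inE // ltnn.
have rk_ltd u : (rk u < d)%N.
  rewrite -[ltnRHS]card_ord; apply: proper_card; apply/properP; split; first exact/subsetP.
  by exists u; rewrite ?inE // ltnn.
pose rk' u := Ordinal (rk_ltd u).
have rkI : injective rk'.
  move=> u v /(congr1 val) /= e; apply: phiI; apply: val_inj => /=.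
  by case: (ltngtP (phi u) (phi v)) => // /rk_lt; rewrite e ltnn.
exists (perm rkI)^-1%g => u v ltuv; rewrite ltnNge leq_eqVlt; apply/negP => /orP[|/rk_lt].
  by move/eqP/val_inj/phiI/perm_inj => e; rewrite e ltnn in ltuv.
have rkK x : rk ((perm rkI)^-1%g x) = x.
  by have := congr1 val (permKV (perm rkI) x); rewrite permE.
by rewrite !rkK ltnNge ltnW.
Qed.

(** An arbitrary choice of columns gives a Plücker coordinate up to sign, or 0 when a column
    repeats. The outcome is chosen before the ring and the matrix, so that one polynomial serves all
    points. *)
Lemma generic_minor (phi : 'I_d -> 'I_j.+1) : exists o : option (bool * 'I_#|idx|),
  forall (R : comNzRingType) (N : 'M[R]_(d, j.+1)),
    \det (colsub phi N) = if o is Some (b, i) then (-1) ^+ b * plu N i else 0.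
Proof.
have [/injectiveP phiI|/injectivePn[u [v nuv ephi]]] := boolP (injectiveb phi); last first.
  exists None => R N; rewrite -det_tr; apply: (determinant_alternate nuv) => i.
  by rewrite !mxE ephi.
have [s sP] := increasing_reorder phiI.
have sP' : [forall u : 'I_d, forall v : 'I_d, (u < v)%N ==>
    ([ffun u => phi (s u)] u < [ffun u => phi (s u)] v)%N].
  by apply/forallP => u; apply/forallP => v; rewrite !ffunE; apply/implyP/sP.
pose i : idx := exist _ [ffun u => phi (s u)] sP'.
exists (Some ((s : bool), enum_rank i)) => R N; rewrite /plu enum_rankK.
have -> : colsub (val i) N = col_perm s (colsub phi N).
  by apply/matrixP => x y; rewrite !mxE /= ffunE.
by rewrite col_permE det_mulmx det_perm odd_permV mulrCA -signr_addb addbb mulr1.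
Qed.

Lemma generic_minor_poly (k : fieldType) (phi : 'I_d -> 'I_j.+1) :
  exists Y : {mpoly k[#|idx|]}, Y \is 1.-homog /\
    forall (L : fieldType) (lam : {rmorphism k -> L}) (N : 'M[L]_(d, j.+1)),
      (map_mpoly lam Y).@[plu N] = \det (colsub phi N).
Proof.
have [[[b i]|] oP] := generic_minor phi; last first.
  by exists 0; split=> [|L lam N]; rewrite ?dhomog0 // !rmorph0 oP.
exists ((-1) ^+ b *: 'X_i); split=> [|L lam N].
  apply: dhomogZ; rewrite dhomogX; apply/eqP; exact: mdeg1.
by rewrite map_mpolyZ mevalZ map_mpolyX mevalXU oP rmorph_sign.
Qed.

Lemma rank_minor (K : fieldType) p q (A : 'M[K]_(p, q)) r : (r <= \rank A)%N ->
  exists (f : 'I_r -> 'I_p) (g : 'I_r -> 'I_q), \det (mxsub f g A) != 0.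
Proof.
move=> ler; pose f (u : 'I_r) := maxrankfun A (widen_ord ler u).
have rf : row_free (rowsub f A).
  apply: inj_row_free => v; rewrite (_ : rowsub f A = rowsub (widen_ord ler) (rowsub (maxrankfun A) A)); last first.
    by apply/matrixP => x y; rewrite !mxE.
  rewrite -[rowsub (maxrankfun A) A]mul1mx -mul_rowsub_mx mulmxA.
  move/(congr1 (mulmx^~ (pinvmx (rowsub (maxrankfun A) A)))).
  rewrite mulmxKp ?maxrowsub_free // mul0mx => v0.
  apply/rowP => u; have /rowP/(_ (widen_ord ler u)) := v0; rewrite !mxE.
  rewrite (bigD1 u) //= !mxE eqxx mulr1 big1 ?addr0 // => x nx; rewrite !mxE.
  by rewrite (_ : widen_ord _ _ == _ = false) ?mulr0 //; apply/negP => /eqP/(congr1 val)/= /val_inj e; rewrite e eqxx in nx.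
have [g nz] := row_free_minor rf; exists f, g.
by rewrite (_ : mxsub f g A = colsub g (rowsub f A)) //; apply/matrixP => x y; rewrite !mxE.
Qed.

Lemma rank_mxsub (K : fieldType) p q r (A : 'M[K]_(p, q)) (f : 'I_r -> 'I_p) (g : 'I_r -> 'I_q) :
  \det (mxsub f g A) != 0 -> (r <= \rank A)%N.
Proof.
rewrite -unitfE -unitmxE -row_free_unit => /eqP {1}<-.
rewrite (_ : mxsub f g A = rowsub f 1%:M *m A *m colsub g 1%:M); last first.
  by rewrite mul_rowsub_mx mul1mx mulmx_colsub mulmx1; apply/matrixP => x y; rewrite !mxE.
by rewrite (leq_trans (mxrankM_maxl _ _)) // mxrankM_maxr.
Qed.

Lemma dhomog_det (k : fieldType) n r (A : 'M[{mpoly k[n]}]_r) :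
  (forall x y, A x y \is 1.-homog) -> \det A \is r.-homog.
Proof.
move=> hA; rewrite /determinant; apply: rpred_sum => s _.
suff : \prod_i A i (s i) \is r.-homog.
  by case: (s : bool) => hp; rewrite ?expr0 ?expr1 ?mul1r ?mulN1r ?rpredN.
rewrite [X in _ \is X.-homog](_ : _ = (\sum_(i < r) 1)%N); last by rewrite sum1_card !card_ord.
elim/big_rec2: _ => [|i e p _ IH]; first exact: dhomog1.
exact: dhomogM.
Qed.

(** The rank is at most [m] when all minors of size [m.+1] vanish, and these are forms in the
    Plücker coordinates. *)
Lemma rank_cl (k : fieldType) p q (Z : 'M[{mpoly k[#|idx|]}]_(p, q)) (X : point_class d j)
    (K : fieldType) (emb : {rmorphism k -> K}) N m :
  (forall x y, Z x y \is 1.-homog) ->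
  (forall (L : fieldType) (lam : {rmorphism k -> L}) U, X L U ->
     (\rank (map_mx (fun F => (map_mpoly lam F).@[plu U]) Z) <= m)%N) ->
  cl X emb N -> (\rank (map_mx (fun F => (map_mpoly emb F).@[plu N]) Z) <= m)%N.
Proof.
move=> hZ ZX NX; rewrite leqNgt; apply/negP => /rank_minor[f [g]].
pose F := \det (mxsub f g Z).
have hF : F \is (m.+1).-homog by apply: dhomog_det => x y; rewrite mxE.
have evF (L : fieldType) (lam : {rmorphism k -> L}) U : (map_mpoly lam F).@[plu U] =
    \det (mxsub f g (map_mx (fun F => (map_mpoly lam F).@[plu U]) Z)).
  rewrite /F -(det_map_mx (map_mpoly lam)) -(det_map_mx (meval (plu U))).
  by congr (\det _); apply/matrixP => x y; rewrite !mxE.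
rewrite -evF (NX _ _ hF) ?eqxx // => L lam U XU; rewrite evF.
by apply: contraTeq (ZX L lam U XU) => /rank_mxsub; rewrite -ltnNge.
Qed.

End Semicontinuity.

Section DimensionSemicontinuity.
Variables d j : nat.
Local Notation idx := (plucker_index d j).

Lemma lincomb_rowspace (K : fieldType) m n (N : 'M[K]_(m, n)) r :
  lincomb (fun x => rVpoly (row x N) : ({poly K})^o) r = rVpoly (r *m N).
Proof.
rewrite mulmx_sum_row linear_sum /=; apply: eq_bigr => x _.
by rewrite linearZ /= scale_regular mul_polyC.
Qed.

Lemma has_dim_rowspace (K : fieldType) m n (N : 'M[K]_(m, n)) :
  @has_dim K ({poly K})^o (rowspace N) (\rank N).
Proof.
exists (fun x => rVpoly (row x (row_base N))); split=> [p|r].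
  split=> [Np|[r ->]]; last first.
    rewrite lincomb_rowspace; apply: (@sub_rowspace _ _ _ _ (row_base N)); last by exists r.
    by rewrite eq_row_base.
  have [|r ->] := @sub_rowspace _ _ _ _ N (row_base N) p _ Np; first by rewrite eq_row_base.
  by exists r; rewrite lincomb_rowspace.
rewrite lincomb_rowspace => /(congr1 (@poly_rV _ n)); rewrite rVpolyK linear0.
by move/(congr1 (mulmx^~ (pinvmx (row_base N)))); rewrite mulmxKp ?row_base_free // mul0mx.
Qed.

Lemma subspace_rowspace (K : fieldType) m n (N : 'M[K]_(m, n)) :
  @subspace K ({poly K})^o (rowspace N).
Proof. exact: has_dim_subspace (has_dim_rowspace N). Qed.

Lemma rowspace_row (K : fieldType) m n (N : 'M[K]_(m, n)) x : rowspace N (rVpoly (row x N)).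
Proof. by exists (delta_mx 0 x); rewrite -rowE. Qed.

Lemma det_colsub_update (R : comNzRingType) (f : 'I_d -> 'I_j.+1) (U : 'M[R]_(d, j.+1)) u v :
  \det (colsub (fun x => if x == u then v else f x) U) = (\adj (colsub f U) *m U) u v.
Proof.
rewrite (expand_det_col _ u) mxE; apply: eq_bigr => x _; rewrite !mxE eqxx mulrC.
congr (_ * \det _ * _); apply/matrixP => y z; rewrite !mxE.
by rewrite eq_sym (negbTE (neq_lift _ _)).
Qed.

Variables (k : fieldType) (f : 'I_d -> 'I_j.+1).

(* At a point U, the matrix T evaluates to \adj U_f *m U with U_f = colsub f U.
   Its rows lie in the row space of U, and span it when the Plücker coordinate
   \det U_f is nonzero. *)
Lemma adj_mulmx_poly : exists (T : 'I_d -> 'I_j.+1 -> {mpoly k[#|idx|]}) (Y : {mpoly k[#|idx|]}),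
  [/\ forall u v, T u v \is 1.-homog, Y \is 1.-homog,
    forall (L : fieldType) (lam : {rmorphism k -> L}) (U : 'M[L]_(d, j.+1)) u v,
      (map_mpoly lam (T u v)).@[plu U] = (\adj (colsub f U) *m U) u v
  & forall (L : fieldType) (lam : {rmorphism k -> L}) (U : 'M[L]_(d, j.+1)),
      (map_mpoly lam Y).@[plu U] = \det (colsub f U)].
Proof.
have [Y [hY YE]] := generic_minor_poly k f.
have /fin_all_exists[T TP] (uv : 'I_d * 'I_j.+1) : exists T : {mpoly k[#|idx|]},
    T \is 1.-homog /\ forall (L : fieldType) (lam : {rmorphism k -> L}) (U : 'M[L]_(d, j.+1)),
      (map_mpoly lam T).@[plu U] = (\adj (colsub f U) *m U) uv.1 uv.2.
  have [y [hy yE]] := generic_minor_poly k (fun x => if x == uv.1 then uv.2 else f x).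
  by exists y; split=> // L lam U; rewrite yE det_colsub_update.
exists (fun u v => T (u, v)), Y; split=> // [u v|L lam U u v]; last exact: (proj2 (TP (u, v))).
exact: (proj1 (TP (u, v))).
Qed.

Lemma adj_mulmx_rowspace (K : fieldType) (N : 'M[K]_(d, j.+1)) :
  \det (colsub f N) != 0 -> (N <= \adj (colsub f N) *m N)%MS.
Proof.
move=> nz; apply/submxP; exists ((\det (colsub f N))^-1 *: colsub f N).
by rewrite -scalemxAl mulmxA mul_mx_adj mul_scalar_mx scalerA mulVf // scale1r.
Qed.

(** The rows of [Z] evaluate to the products of ['X^a] with the rows of the matrix from
    [adj_mulmx_poly]. They lie in R_iV at every point, and span it on the chart where the chosen
    minor is nonzero. *)
Lemma up_rank_poly i : exists p (Z : 'M[{mpoly k[#|idx|]}]_(p, (j + i).+1)),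
  (forall x y, Z x y \is 1.-homog) /\
  forall (L : fieldType) (lam : {rmorphism k -> L}) (U : 'M[L]_(d, j.+1)) m,
    @has_dim L ({poly L})^o (up (rowspace U) i) m ->
    let r := \rank (map_mx (fun F => (map_mpoly lam F).@[plu U]) Z) in
    (r <= m)%N /\ (\det (colsub f U) != 0 -> r = m).
Proof.
have [T [Y [hT hY TE YE]]] := adj_mulmx_poly.
pose I := ('I_i.+1 * 'I_d)%type.
pose Z : 'M[{mpoly k[#|idx|]}]_(#|{: I}|, (j + i).+1) := \matrix_(x < #|{: I}|, v < (j + i).+1)
  let: (a, u) := (enum_val x : I) in
  if (a <= v < a + j.+1)%N then T u (inord (v - a)) else 0.
exists #|{: I}|, Z; split=> [x y|L lam U m dimU].
  by rewrite mxE; case: (enum_val x) => a u; case: ifP; rewrite ?dhomog0.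
set ZU := map_mx _ Z; pose TU := \adj (colsub f U) *m U.
have ZE x : rVpoly (row x ZU) = 'X^((enum_val x).1) * rVpoly (row (enum_val x).2 TU).
  apply/polyP => v; rewrite coef_rVpoly coefXnM coef_rVpoly.
  have [ltv|lev] := ltnP v (j + i).+1; last first.
    rewrite insubN -?leqNgt // insubN; first by case: ltnP.
    by have := leq_ord (enum_val x).1; rewrite -leqNgt; lia.
  rewrite insubT !mxE /=; case: (enum_val x) => a u /=.
  have [ltva|leav] := ltnP v a; first by rewrite !rmorph0.
  case: ltnP => [lt|le].
    have lt' : (v - a < j.+1)%N by lia.
    rewrite TE insubT [RHS]mxE; congr (TU _ _); apply: val_inj; by rewrite /= inordK.
  by rewrite insubN ?rmorph0 ?meval0 // -leqNgt; lia.
have sU := subspace_up i (subspace_rowspace U).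
have ZU_up p : rowspace ZU p -> up (rowspace U) i p.
  case=> r ->; rewrite -lincomb_rowspace /lincomb.
  apply: (@subspace_sum _ ({poly L})^o) => // x _; apply: (@subspaceZ _ ({poly L})^o) => //.
  rewrite ZE; apply: up_mulXn; [exact: subspace_rowspace | exact: leq_ord | ].
  apply: (sub_rowspace _ (rowspace_row TU _)); exact: submxMl.
split; first exact: (@has_dim_le L ({poly L})^o _ _ _ _ ZU_up (has_dim_rowspace ZU) dimU).
move=> nz; apply: (@has_dim_uniq L ({poly L})^o _ _ _ (has_dim_rowspace ZU)).
apply: eq_has_dim dimU => p; split=> [[v Uv ->]|]; last exact: ZU_up.
apply: (@subspace_sum _ ({poly L})^o); first exact: subspace_rowspace.
move=> a _; have [r ->] := sub_rowspace (adj_mulmx_rowspace nz) (Uv a (leq_ord a)).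
rewrite -lincomb_rowspace /lincomb mulr_sumr.
apply: (@subspace_sum _ ({poly L})^o); first exact: subspace_rowspace.
move=> u _; rewrite scale_regular mulrCA.
apply: (@subspaceZ _ ({poly L})^o); first exact: subspace_rowspace.
have := rowspace_row ZU (enum_rank ((a, u) : I)); by rewrite ZE enum_rankK.
Qed.

(** Here R_{-i}V is written as a kernel: linear equations that hold on the row space are imposed on
    ['X^a * t] for all a up to [i]. Off the chart the equations may have extra solutions, which
    still gives an inequality. *)
Lemma dn_rank_poly i : exists q (Z : 'M[{mpoly k[#|idx|]}]_(j.+1, q)),
  (forall x y, Z x y \is 1.-homog) /\
  forall (L : fieldType) (lam : {rmorphism k -> L}) (U : 'M[L]_(d, j.+1)) m,
    @has_dim L ({poly L})^o (dn (rowspace U) i) m ->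
    let r := \rank (map_mx (fun F => (map_mpoly lam F).@[plu U]) Z) in
    (r <= j.+1 - m)%N /\ (\det (colsub f U) != 0 -> (r + m = j.+1)%N).
Proof.
have [T [Y [hT hY TE YE]]] := adj_mulmx_poly.
pose I := ('I_i.+1 * 'I_(j + i).+1)%type.
pose Z : 'M[{mpoly k[#|idx|]}]_(j.+1, #|{: I}|) := \matrix_(v < j.+1, y < #|{: I}|)
  let: (a, w) := (enum_val y : I) in
  (if (v + a == w)%N then Y else 0) -
  (if (w < j.+1)%N then \sum_(u | f u == (v + a)%N :> nat) T u (inord w) else 0).
exists #|{: I}|, Z; split=> [x y|L lam U m dimU].
  rewrite mxE; case: (enum_val y) => a w; apply: rpredB; first by case: ifP; rewrite ?dhomog0.
  by case: ifP; rewrite ?dhomog0 // => _; apply: rpred_sum => u _; apply: hT.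
set ZU := map_mx _ Z; pose TU := \adj (colsub f U) *m U.
(* Equations of the row space on the chart: a member is recovered from its coefficients at the
   chosen positions [f u], and its coefficients beyond index [j] vanish. *)
pose cond (t : {poly L}) := forall w : 'I_(j + i).+1, \det (colsub f U) * t`_w =
  if (w < j.+1)%N then \sum_u t`_(f u) * TU u (inord w) else 0.
have XnE (r : 'rV[L]_j.+1) a w : ('X^a * rVpoly r)`_w = \sum_(v < j.+1) (v + a == w)%N%:R * r 0 v.
  rewrite coefXnM; case: ltnP => [ltwa|leaw].
    by rewrite big1 // => v _; rewrite (_ : (_ == _) = false) ?mul0r //; lia.
  rewrite coef_rVpoly; case: insubP => [v _ ev|lt].
    rewrite (bigD1 v) //= ev subnK // eqxx mul1r big1 ?addr0 // => v' nv.
    rewrite (_ : (_ == _) = false) ?mul0r //; apply/negbTE; apply: contra nv => /eqP e.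
    by apply/eqP/val_inj; rewrite /= ev -e addnK.
  rewrite big1 // => v _; rewrite (_ : (_ == _) = false) ?mul0r //.
  by have := ltn_ord v; rewrite -leqNgt in lt; lia.
have ZE (r : 'rV[L]_j.+1) : r *m ZU = 0 <-> forall a, (a <= i)%N -> cond ('X^a * rVpoly r).
  have rE y : (r *m ZU) 0 y = \det (colsub f U) * ('X^((enum_val y).1) * rVpoly r)`_((enum_val y).2) -
      if ((enum_val y).2 < j.+1)%N then
        \sum_u ('X^((enum_val y).1) * rVpoly r)`_(f u) * TU u (inord (enum_val y).2) else 0.
    rewrite mxE; case ey: (enum_val y) => [a w] /=.
    have -> : \sum_(v < j.+1) r 0 v * ZU v y = \sum_(v < j.+1) r 0 v * ((v + a == w)%N%:R * \det (colsub f U) -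
        if (w < j.+1)%N then \sum_u (v + a == f u)%N%:R * TU u (inord w) else 0).
      apply: eq_bigr => v _; congr (_ * _); rewrite !mxE ey !rmorphB /=; congr (_ - _).
        by case: ifP => _; rewrite ?YE ?mul1r ?mul0r // !rmorph0.
      case: ifP => _; last by rewrite !rmorph0.
      rewrite (raddf_sum (map_mpoly lam)) (raddf_sum (meval (plu U))) /= [LHS]big_mkcond; apply: eq_bigr => u _.
      by rewrite eq_sym; case: ifP => _; rewrite ?TE ?mul1r ?mul0r.
    rewrite (eq_bigr _ (fun v _ => mulrBr (r 0 v) _ _)) sumrB; congr (_ - _).
      by rewrite XnE mulr_sumr; apply: eq_bigr => v _; rewrite mulrCA mulrA mulrC mulrCA.
    case: ifP => _; last by rewrite big1 // => v _; rewrite mulr0.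
    rewrite (eq_bigr _ (fun v _ => mulr_sumr _ _ _ (r 0 v))) exchange_big.
    apply: eq_bigr => u _; rewrite XnE mulr_suml.
    by apply: eq_bigr => v _; rewrite mulrCA mulrA.
  split=> [r0 a lea w|rc].
    have := rE (enum_rank ((inord a, w) : I)); rewrite r0 mxE enum_rankK /= inordK //.
    by move/esym/eqP; rewrite subr_eq0 => /eqP.
  by apply/rowP => y; rewrite rE rc ?leq_ord // subrr mxE.
have condU t : rowspace U t -> cond t.
  case=> c -> w; case: ltnP => [ltw|lew]; last first.
    by rewrite coef_rVpoly insubN ?mulr0 // -leqNgt.
  have ew : w = (inord w : 'I_j.+1) :> nat by rewrite inordK.
  rewrite {1}ew coef_rVpoly_ord; have -> : \sum_u (rVpoly (c *m U))`_(f u) * TU u (inord w) =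
      (c *m colsub f U *m TU) 0 (inord w).
    by rewrite [RHS]mxE; apply: eq_bigr => u _; rewrite coef_rVpoly_ord mulmx_colsub !mxE.
  by rewrite /TU -mulmxA [colsub f U *m _]mulmxA mul_mx_adj mul_scalar_mx -scalemxAr [RHS]mxE.
have Ucond (t : {poly L}) : \det (colsub f U) != 0 -> (size t <= (j + i).+1)%N -> cond t -> rowspace U t.
  move=> nz st ct; exists ((\det (colsub f U))^-1 *: (\row_u t`_(f u)) *m \adj (colsub f U)).
  rewrite -mulmxA -/TU -scalemxAl; apply/polyP => w; rewrite coef_rVpoly.
  have [ltw|lew] := ltnP w (j + i).+1; last first.
    rewrite nth_default ?(leq_trans st) // insubN // -leqNgt; lia.
  have /= cw := ct (Ordinal ltw); apply: (mulfI nz); rewrite cw.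
  case: ltnP => lt; last by rewrite insubN ?mulr0 // -leqNgt.
  rewrite insubT mxE mulrA mulfV // mul1r [RHS]mxE; apply: eq_bigr => u _.
  by rewrite [X in _ = X * _]mxE; congr (_ * TU _ _); apply: val_inj; rewrite /= inordK.
have dn_size (t : {poly L}) : dn (rowspace U) i t -> (size t <= j.+1)%N.
  by move/(_ 0%N (leq0n _)); rewrite expr0 mul1r; apply: rowspace_size.
have ker_rank : (\rank ZU + \rank (kermx ZU) = j.+1)%N.
  by rewrite mxrank_ker subnKC // rank_leq_row.
have dn_ker (t : {poly L}) : dn (rowspace U) i t -> rowspace (kermx ZU) t.
  move=> dt; rewrite rowspaceP ?dn_size //; apply/sub_kermxP/ZE => a lea; apply: condU.
  by rewrite poly_rV_K ?dn_size //; apply: dt.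
have lem := @has_dim_le L ({poly L})^o _ _ _ _ dn_ker dimU (has_dim_rowspace _).
split=> [|nz]; first by rewrite -[X in (_ <= X - _)%N]ker_rank -addnBA // leq_addr.
rewrite -[RHS]ker_rank; congr (_ + _)%N; apply: (@has_dim_uniq L ({poly L})^o _ _ _ dimU).
apply: eq_has_dim (has_dim_rowspace _) => t; split; last exact: dn_ker.
case=> r -> a lea; apply: Ucond => //.
  rewrite (leq_trans (size_polyMleq _ _)) // size_polyXn.
  by have := size_poly j.+1 (fun k => if insub k is Some i then (r *m kermx ZU) 0 i else 0);
    rewrite -/(rVpoly _); move: (size _) => s; lia.
have /ZE rc : (r *m kermx ZU) *m ZU = 0 by rewrite -mulmxA mulmx_ker mulmx0.
exact: rc.
Qed.

End DimensionSemicontinuity.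

Section ClosureDimensions.
Variables (d j : nat) (k K : fieldType) (X : point_class d j) (emb : {rmorphism k -> K}).
Variables (N : 'M[K]_(d, j.+1)) (i m m' : nat).
Hypotheses (Nf : row_free N) (NX : cl X emb N).

(** The chart is chosen at [N], where the rank equals the dimension; at the points of [X] the
    one-sided bound is enough, even off the chart. *)
Lemma up_dim_cl : @has_dim K ({poly K})^o (up (rowspace N) i) m ->
  (forall (L : fieldType) (lam : {rmorphism k -> L}) (U : 'M[L]_(d, j.+1)), @X L U ->
     exists2 n, (n <= m')%N & @has_dim L ({poly L})^o (up (rowspace U) i) n) ->
  (m <= m')%N.
Proof.
move=> dimN XU; have [f nz] := row_free_minor Nf.
have [p [Z [hZ ZE]]] := up_rank_poly k f i.
have [_ /(_ nz) <-] := ZE K emb N m dimN.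
apply: (rank_cl hZ _ NX) => L lam U /(XU L lam)[n len /(ZE L lam)[le _]].
exact: leq_trans len.
Qed.

Lemma dn_dim_cl : @has_dim K ({poly K})^o (dn (rowspace N) i) m ->
  (forall (L : fieldType) (lam : {rmorphism k -> L}) (U : 'M[L]_(d, j.+1)), @X L U ->
     exists2 n, (m' <= n)%N & @has_dim L ({poly L})^o (dn (rowspace U) i) n) ->
  (m' <= j.+1)%N -> (m' <= m)%N.
Proof.
move=> dimN XU lem'; have [f nz] := row_free_minor Nf.
have [q [Z [hZ ZE]]] := dn_rank_poly k f i.
have [_ /(_ nz) eN] := ZE K emb N m dimN.
suff : (\rank (map_mx (fun F => (map_mpoly emb F).@[plu N]) Z) <= j.+1 - m')%N.
  by move: eN; move: (\rank _) => r; lia.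
apply: (rank_cl hZ _ NX) => L lam U /(XU L lam)[n len /(ZE L lam)[le _]].
by apply: leq_trans le _; apply: leq_sub2l.
Qed.

End ClosureDimensions.

(** * One-parameter degenerations *)

Section Columns.
Variable R : comNzRingType.
Implicit Types (n : nat).

Lemma adj_row0E n (Q : 'M[R]_n.+1) l : \adj Q ord0 l = \det (setcol0 Q (delta_mx l 0)).
Proof.
rewrite det_setcol0 (bigD1 l) //= [delta_mx _ _ _ _]mxE !eqxx mul1r big1 ?addr0 // => r nr.
by rewrite [delta_mx _ _ _ _]mxE (negbTE nr) mul0r.
Qed.

(** Effect of a row operation on the maximal minors: multiplying by [M] the matrix with a unit
    vector in column 0 puts column [l] of [M] there. *)
Lemma adj_row0_mulmx n (M P : 'M[R]_n.+1) l :
  \sum_r \adj (M *m P) ord0 r * M r l = \det M * \adj P ord0 l.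
Proof.
have -> : \det M * \adj P ord0 l = \det (M *m setcol0 P (delta_mx l 0)).
  by rewrite det_mulmx -adj_row0E.
have -> : M *m setcol0 P (delta_mx l 0) = setcol0 (M *m P) (col l M).
  apply/matrixP => r s; rewrite !mxE; case: ifP => s0.
    rewrite (bigD1 l) //= !mxE s0 !eqxx mulr1 big1 ?addr0 // => q nq.
    by rewrite !mxE s0 (negbTE nq) mulr0.
  by apply: eq_bigr => q _; rewrite !mxE s0.
by rewrite det_setcol0; apply: eq_bigr => r _; rewrite [col _ _ _ _]mxE mulrC.
Qed.

(** A column operation that does not involve column 0 multiplies all maximal minors by its
    determinant. *)
Lemma adj_row0_mulmxr n (M P : 'M[R]_n.+1) l :
  (forall s, M ord0 s = (s == ord0)%:R) -> (forall s, M s ord0 = (s == ord0)%:R) ->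
  \adj (P *m M) ord0 l = \det M * \adj P ord0 l.
Proof.
move=> M0 M0'.
rewrite !adj_row0E mulrC -det_mulmx; congr (\det _); apply/matrixP => r s; rewrite !mxE.
case: ifP => s0.
  rewrite (bigD1 ord0) //= !mxE (eqP s0) M0 eqxx mulr1 big1 ?addr0 // => q nq.
  by rewrite M0' (negbTE nq) mulr0.
apply: eq_bigr => q _; rewrite !mxE; case: ifP => // /eqP ->.
by rewrite M0 s0 !mulr0.
Qed.

(** As a row operation: row [l1] becomes t times itself plus [x] times row [l2], and row [l2]
    changes sign. The determinant is -t, which the moves compensate by [- kappa h]. *)
Definition elem_mx n (l1 l2 : 'I_n) (t x : R) : 'M[R]_n :=
  \matrix_(r, s) if r == l1 then (if s == l1 then t else if s == l2 then x else 0)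
                 else if r == l2 then - (s == l2)%:R else (r == s)%:R.

Lemma det_elem_mx n (l1 l2 : 'I_n) t x : l1 != l2 -> \det (elem_mx l1 l2 t x) = - t.
Proof.
move=> nl; have diag : \prod_i elem_mx l1 l2 t x i i = - t.
  rewrite (bigD1 l1) //= (bigD1 l2) /=; last by rewrite eq_sym.
  rewrite !mxE !eqxx eq_sym (negbTE nl) big1 ?mulr1 ?mulrN1 // => r /andP[n1 n2].
  by rewrite mxE (negbTE n1) (negbTE n2) eqxx.
have [lt|ge] := ltnP l1 l2; last first.
  rewrite det_trig //; apply/is_trig_mxP => r s ltrs; rewrite mxE.
  case: eqP => [er|_]; first rewrite er in ltrs.
    case: eqP => [es|_]; first by rewrite es ltnn in ltrs.
    by case: eqP => // es; rewrite es in ltrs; move: ltrs; rewrite ltnNge ge.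
  case: eqP => [er|_]; first rewrite er in ltrs.
    by case: eqP => [es|_]; [rewrite es ltnn in ltrs | rewrite oppr0].
  by case: eqP => // es; rewrite es ltnn in ltrs.
rewrite -det_tr det_trig; first by rewrite -[RHS]diag; apply: eq_bigr => r _; rewrite mxE.
apply/is_trig_mxP => s r ltsr; rewrite !mxE.
case: eqP => [er|_]; first rewrite er in ltsr.
  case: eqP => [es|_]; first by rewrite es ltnn in ltsr.
  by case: eqP => // es; rewrite es in ltsr; move: (ltn_trans ltsr lt); rewrite ltnn.
case: eqP => [er|_]; first rewrite er in ltsr.
  by case: eqP => [es|_]; [rewrite es ltnn in ltsr | rewrite oppr0].
by case: eqP => // es; rewrite es ltnn in ltsr.
Qed.

End Columns.

Section GeneralSpan.
Variable R : comNzRingType.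

(** [xspan] over a coefficient ring such as K[t], which is not a field. *)
Definition gspan t (v : nat -> {poly R}) (m : nat -> nat) (w : {poly R}) : Prop :=
  exists2 p : nat -> {poly R}, (forall l, (l < t)%N -> (size (p l) <= m l)%N) &
    w = \sum_(l < t) p l * v l.

Lemma gspan_mul t v (m : nat -> nat) (p : {poly R}) l : (l < t)%N -> (size p <= m l)%N ->
  gspan t v m (p * v l).
Proof.
move=> ltl sp; exists (fun i => if i == l then p else 0) => [i _|].
  by case: eqP => [->|_]; rewrite ?sp ?size_poly0.
rewrite (bigD1 (Ordinal ltl)) //= eqxx big1 ?addr0 // => i.
by rewrite -(inj_eq val_inj) /= => /negbTE ->; rewrite mul0r.
Qed.

Lemma gspanB t v (m : nat -> nat) (w w' : {poly R}) :
  gspan t v m w -> gspan t v m w' -> gspan t v m (w - w').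
Proof.
move=> [p sp ->] [q sq ->]; exists (fun l => p l - q l) => [l ltl|].
  by rewrite (leq_trans (size_polyD _ _)) // size_polyN geq_max sp ?sq.
by rewrite -sumrB; apply: eq_bigr => l _; rewrite mulrBl.
Qed.

End GeneralSpan.

Lemma minor_gen_map (R R' : comNzRingType) (sigma : {rmorphism R -> R'}) n (P : 'M_n.+1) h l :
  sigma (minor_gen P h l) = minor_gen (map_mx sigma P) (sigma h) l.
Proof. by rewrite /minor_gen rmorphM -map_mx_adj [X in _ = _ * X]mxE. Qed.

Lemma size_mul_regular (R : idomainType) (t : R) (p : {poly R}) : t != 0 ->
  size (t%:P * p) = size p.
Proof. by move=> t0; rewrite mul_polyC size_scale. Qed.

Section Moves.
Variables d j : nat.

Definition presented_points n a b c : point_class d j :=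
  fun L U => row_free U /\ presented j n a b c (rowspace U).

Lemma rowspace_dim (L : fieldType) (U : 'M[L]_(d, j.+1)) : row_free U ->
  @has_dim L ({poly L})^o (rowspace U) d.
Proof. by move=> /eqP e; rewrite -[X in has_dim _ X]e; apply: has_dim_rowspace. Qed.

Lemma presented_sum n a b c (L : fieldType) (U : 'M[L]_(d, j.+1)) :
  presented_points n a b c U -> (\sum_(l < n.+1) a l)%N = d.
Proof.
case=> /rowspace_dim dimU [P [h [_ _ _ dimU' _]]].
exact: (@has_dim_uniq _ ({poly L})^o _ _ _ dimU' dimU).
Qed.

(** Containment of the row space in the span suffices, because the span has dimension at most the
    sum of the [a l], which is [d]. *)
Lemma presented_family (L : fieldType) (I : finType) (w : I -> {poly L}) n (a b : nat -> nat) c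
    (P : 'M[{poly L}]_n.+1) (h : {poly L}) (U : 'M[L]_(d, j.+1)) :
  (forall r s, (size (P r (lift ord0 s)) <= (a r + b s).+1)%N) -> (size h <= c.+1)%N ->
  (\sum_(l < n.+1) a l + \sum_(s < n) b s + c = j.+1)%N -> (\sum_(l < n.+1) a l = d)%N ->
  row_free U -> (forall p, rowspace U p <-> exists e : I -> L, p = \sum_i (e i)%:P * w i) ->
  (forall i, gspan n.+1 (minor_gen P h) a (w i)) ->
  presented_points n a b c U.
Proof.
move=> sP sh sumab suma Uf UE wP; split=> //; exists P, h.
have dimU := rowspace_dim Uf.
split=> //; last by rewrite suma.
have sU p : rowspace U p -> @xspan L ({poly L})^o n.+1 (minor_gen P h) a p.
  case/UE=> e ->; apply: (@subspace_sum L ({poly L})^o) => [|i _]; first exact: xspan_subspace.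
  apply: (@subspaceZ L ({poly L})^o); [exact: xspan_subspace | exact: wP].
have [k [lek dimk kI]] := @xspan_rank L ({poly L})^o n.+1 (minor_gen P h) a.
have := @has_dim_le L ({poly L})^o _ _ _ _ sU dimU dimk; rewrite suma => le.
have ek : (d - k = d)%N by apply/eqP; rewrite eqn_leq leq_subr le.
rewrite suma ek in dimk; move=> p; split; first exact: sU.
exact: (@has_dim_eq L ({poly L})^o _ _ _ sU dimU dimk).
Qed.

Section Deform.
Variables (k K : fieldType) (emb : {rmorphism k -> K}) (N : 'M[K]_(d, j.+1)).
Variables (n : nat) (a : nat -> nat) (F : nat -> {poly K}).
Hypothesis Nf : row_free N.
Hypothesis NE : forall p, rowspace N p <-> @xspan K ({poly K})^o n.+1 F a p.
Hypothesis suma : (\sum_(l < n.+1) a l = d)%N.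
Let I : finType := {l : 'I_n.+1 & 'I_(a l)}.
Variables (w : I -> {poly {poly K}}) (r : K).
Hypothesis size_w : forall i, (size (w i) <= j.+1)%N.
Hypothesis wE : forall i, map_poly (horner_eval r) (w i) = 'X^(tagged i) * F (tag i).

Lemma deform_cl (L : fieldType) (X : point_class d j) (rho : {rmorphism {poly K} -> L})
    (lam : {rmorphism k -> L}) : injective rho -> (forall x, lam x = rho (emb x)%:P) ->
  (forall U : 'M[L]_(d, j.+1), row_free U ->
     (forall p, rowspace U p <-> exists c : I -> L, p = \sum_i (c i)%:P * map_poly rho (w i)) ->
     X L U) ->
  cl X emb N.
Proof.
move=> rho_inj lamE XU; have cardI : #|I| = d by rewrite card_sigma_ord.
apply: (family_cl cardI size_w (r := r) rho_inj lamE Nf _ XU) => p.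
rewrite NE xspanP; split=> -[c ->]; exists c; apply: eq_bigr => i _.
  by rewrite wE.
by rewrite wE.
Qed.

End Deform.

Lemma tofrac_inj (R : idomainType) : injective (@tofrac R).
Proof. by move=> x y /eqP; rewrite tofrac_eq => /eqP. Qed.

(* The factor t, which clears denominators, becomes invertible at the generic point rho. *)
Lemma generic_presented (K L : fieldType) (rho : {rmorphism {poly K} -> L})
    (I : finType) (t : {poly K}) (w : I -> {poly {poly K}}) n (a b : nat -> nat) c
    (P : 'M[{poly {poly K}}]_n.+1) (h : {poly {poly K}}) :
  injective rho -> t != 0 ->
  (forall i, gspan n.+1 (minor_gen P h) a (t%:P * w i)) ->
  (forall r s, (size (P r (lift ord0 s)) <= (a r + b s).+1)%N) -> (size h <= c.+1)%N ->
  (\sum_(l < n.+1) a l + \sum_(s < n) b s + c = j.+1)%N -> (\sum_(l < n.+1) a l = d)%N ->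
  (forall i, (size (w i) <= j.+1)%N) /\
  forall U : 'M[L]_(d, j.+1), row_free U ->
    (forall p, rowspace U p <-> exists e : I -> L, p = \sum_i (e i)%:P * map_poly rho (w i)) ->
    presented_points n a b c U.
Proof.
move=> rhoI t0 wP sP sh sumab suma; split=> [i|U Uf UE].
  rewrite -(size_mul_regular _ t0); have [q sq ->] := wP i.
  apply: leq_trans (size_sum _ _ _) _; apply/bigmax_leqP => l _; rewrite -sumab.
  by apply: minor_gen_size => //; apply: sq.
apply: (presented_family (P := map_mx (map_poly rho) P) (h := map_poly rho h) _ _ sumab suma Uf UE).
- by move=> x s; rewrite mxE; apply: leq_trans (size_poly _ _) (sP x s).
- exact: leq_trans (size_poly _ _) sh.
move=> i; have [q sq eq] := wP i.
have rt0 : rho t != 0 by apply: contraNneq t0 => rt; apply/eqP/rhoI; rewrite rt rmorph0.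
exists (fun l => (rho t)^-1%:P * map_poly rho (q l)) => [l ltl|].
  rewrite mul_polyC size_scale ?invr_eq0 //.
  exact: leq_trans (size_poly _ _) (sq l ltl).
have := congr1 (map_poly rho) eq; rewrite rmorphM rmorph_sum /= map_polyC /= => e.
have -> : map_poly rho (w i) = (rho t)^-1%:P * ((rho t)%:P * map_poly rho (w i)).
  by rewrite mulrA -polyCM mulVf // mul1r.
rewrite e mulr_sumr; apply: eq_bigr => l _.
by rewrite rmorphM /= minor_gen_map mulrA.
Qed.

End Moves.

Lemma mul_elem_mx (R : comNzRingType) n (l1 l2 : 'I_n) (t x : R) (P : 'M[R]_n) r s : l1 != l2 ->
  (elem_mx l1 l2 t x *m P) r s =
  if r == l1 then t * P l1 s + x * P l2 s else if r == l2 then - P l2 s else P r s.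
Proof.
move=> nl; rewrite mxE.
have [->|n1] := eqVneq r l1.
  rewrite (bigD1 l1) //= (bigD1 l2) /=; last by rewrite eq_sym.
  rewrite !mxE !eqxx eq_sym (negbTE nl) big1 ?addr0 // => q /andP[q1 q2].
  by rewrite mxE eqxx (negbTE q1) (negbTE q2) mul0r.
have [->|n2] := eqVneq r l2.
  rewrite (bigD1 l2) //= !mxE eq_sym (negbTE nl) !eqxx mulN1r big1 ?addr0 // => q q2.
  by rewrite mxE eq_sym (negbTE nl) eqxx (negbTE q2) oppr0 mul0r.
rewrite (bigD1 r) //= !mxE (negbTE n1) (negbTE n2) eqxx mul1r big1 ?addr0 // => q nq.
by rewrite mxE (negbTE n1) (negbTE n2) eq_sym (negbTE nq) mul0r.
Qed.

Lemma mul_tr_elem_mx (R : comNzRingType) n (l1 l2 : 'I_n) (t x : R) (P : 'M[R]_n) r s : l1 != l2 ->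
  (P *m (elem_mx l1 l2 t x)^T) r s =
  if s == l1 then t * P r l1 + x * P r l2 else if s == l2 then - P r l2 else P r s.
Proof.
move=> nl; have -> : P *m (elem_mx l1 l2 t x)^T = (elem_mx l1 l2 t x *m P^T)^T.
  by rewrite trmx_mul trmxK.
by rewrite mxE mul_elem_mx // !mxE.
Qed.

Lemma exists_generic_point (K : fieldType) :
  exists (L : fieldType) (rho : {rmorphism {poly K} -> L}), injective rho.
Proof. by exists {fraction {poly K}}, (@tofrac {poly K}); apply: tofrac_inj. Qed.

Lemma specialize_const (K : fieldType) (r : K) (p : {poly K}) :
  map_poly (horner_eval r) (map_poly (@polyC K) p) = p.
Proof. by apply/polyP => i; rewrite !coef_map /= /horner_eval hornerC. Qed.

(** * Moving a unit between two columns or two rows *)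

Section MoveLemmas.
Variables d j : nat.
Variables (k K : fieldType) (emb : {rmorphism k -> K}) (N : 'M[K]_(d, j.+1)).
Notation ppoints := (@presented_points d j).
Notation kappa := (map_poly (@polyC K)).

Lemma move_cl n (a : nat -> nat) (F : nat -> {poly K}) r (t : {poly K})
    (w : {l : 'I_n.+1 & 'I_(a l)} -> {poly {poly K}}) n' (a' b' : nat -> nat) c'
    (P : 'M[{poly {poly K}}]_n'.+1) (h : {poly {poly K}}) :
  row_free N -> (forall p, rowspace N p <-> @xspan K ({poly K})^o n.+1 F a p) ->
  (\sum_(l < n.+1) a l = d)%N ->
  (forall i, map_poly (horner_eval r) (w i) = 'X^(tagged i) * F (tag i)) ->
  t != 0 -> (forall i, gspan n'.+1 (minor_gen P h) a' (t%:P * w i)) ->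
  (forall r s, (size (P r (lift ord0 s)) <= (a' r + b' s).+1)%N) -> (size h <= c'.+1)%N ->
  (\sum_(l < n'.+1) a' l + \sum_(s < n') b' s + c' = j.+1)%N -> (\sum_(l < n'.+1) a' l = d)%N ->
  cl (ppoints n' a' b' c') emb N.
Proof.
move=> Nf NE suma wE t0 wP sP sh sumab' suma'.
have [L [rho rhoI]] := exists_generic_point K.
have [sw Upres] := generic_presented rhoI t0 wP sP sh sumab' suma'.
pose lam : {rmorphism k -> L} := GRing.RMorphism.clone _ _ (rho \o (@polyC K \o emb)) _.
exact: (deform_cl Nf NE suma sw wE (lam := lam) rhoI _ Upres).
Qed.

Variables (n : nat) (a b : nat -> nat) (c : nat).

Lemma sum_upd_move m (e : nat -> nat) l1 l2 : (l1 < m)%N -> (l2 < m)%N -> (e l2 + 2 <= e l1)%N ->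
  (\sum_(l < m) upd (upd e l1 (e l1).-1) l2 (e l2).+1 l = \sum_(l < m) e l)%N.
Proof.
move=> lt1 lt2 le; have n12 : l2 <> l1 by move=> e12; rewrite e12 in le; lia.
have e2 : upd e l1 (e l1).-1 l2 = e l2 by rewrite /upd; case: eqP.
have := @sum_upd m (fun _ y => y) (upd e l1 (e l1).-1) l2 (e l2).+1 lt2.
have := @sum_upd m (fun _ y => y) e l1 (e l1).-1 lt1.
rewrite e2 /=; lia.
Qed.

(* Over K[t], t times the top coefficients of column s1 are subtracted from column s2; a
   column operation then cancels the top coefficients of column s1, and multiplies the
   minors by t. *)
Lemma b_move (s1 s2 : nat) : (s1 < n)%N -> (s2 < n)%N -> (b s2 + 2 <= b s1)%N ->
  ppoints n a b c N -> cl (ppoints n a (upd (upd b s1 (b s1).-1) s2 (b s2).+1) c) emb N.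
Proof.
move=> lt1 lt2 leb Npt; have suma := presented_sum Npt.
case: Npt => Nf [P [h [sP sh NE _ sumab]]].
pose o1 := Ordinal lt1; pose o2 := Ordinal lt2.
have no12 : o1 != o2 by apply/eqP => /(congr1 val) /= e; rewrite e in leb; lia.
have no : lift ord0 o1 != lift ord0 o2 by rewrite (inj_eq lift_inj).
(* The shift from the new weight of column [s2] to the old weight of column [s1], so that ['X^e]
   takes [D r] to the top degree of column [s1]. *)
pose e := (b s1 - (b s2).+1)%N.
pose top r : K := (P r (lift ord0 o1))`_(a r + b s1).
pose D (r : 'I_n.+1) : {poly {poly K}} := ('X * (top r)%:P)%:P * 'X^(a r + (b s2).+1).
pose Pt : 'M[{poly {poly K}}]_n.+1 :=
  \matrix_(r, s) (kappa (P r s) - if s == lift ord0 o2 then D r else 0).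
pose M := (elem_mx (lift ord0 o1) (lift ord0 o2) 'X%:P 'X^e)^T : 'M[{poly {poly K}}]_n.+1.
have detM : \det M = - 'X%:P by rewrite det_tr det_elem_mx.
have adjN l : \adj (Pt *m M) ord0 l = - 'X%:P * \adj Pt ord0 l.
  have nl (q : 'I_n) : (ord0 == lift ord0 q) = false by apply: negbTE (neq_lift _ _).
  rewrite adj_row0_mulmxr ?detM // => s; rewrite !mxE !nl; last by rewrite eq_sym.
  case: eqP => [->|_]; first by rewrite eq_sym nl.
  by case: eqP => [->|_] //; rewrite oppr0 eq_sym nl.
apply: (move_cl (w := fun i => 'X^(tagged i) * minor_gen Pt (kappa h) (tag i)) (P := Pt *m M)
  (h := - kappa h) (t := 'X) (r := 0) Nf NE suma _ _ _ _ _ _ suma).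
- move=> i; rewrite rmorphM /= map_polyXn minor_gen_map /= specialize_const.
  congr (_ * minor_gen _ _ _); apply/matrixP => r s; rewrite !mxE rmorphB /= specialize_const.
  case: ifP => _; last by rewrite rmorph0 subr0.
  by rewrite rmorphM /= map_polyC /= /horner_eval hornerM hornerX mul0r mul0r subr0.
- by rewrite polyX_eq0.
- move=> i; have -> : 'X%:P * ('X^(tagged i) * minor_gen Pt (kappa h) (tag i)) =
      'X^(tagged i) * minor_gen (Pt *m M) (- kappa h) (tag i).
    rewrite /minor_gen adjN [- 'X%:P * _]mulNr mulrNN mulrCA; congr (_ * _); exact: mulrCA.
  by apply: gspan_mul; rewrite ?size_polyXn.
- move=> r s; rewrite mul_tr_elem_mx // !mxE /upd !(inj_eq lift_inj).
  have [->|ns1] := eqVneq s o1.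
    rewrite eqxx (negbTE no12) subr0 ifN; last by apply/eqP => /= e12; rewrite e12 in leb; lia.
    rewrite [_ == s1]eqxx.
    (* The contribution of [D r] is exactly t times the top term of column [s1], which therefore
       disappears. *)
    have -> : 'X%:P * kappa (P r (lift ord0 o1)) + 'X^e * (kappa (P r (lift ord0 o2)) - D r) =
        'X%:P * kappa (P r (lift ord0 o1) - top r *: 'X^(a r + b s1)) + 'X^e * kappa (P r (lift ord0 o2)).
      have -> : D r = 'X%:P * (top r)%:P%:P * 'X^(a r + (b s2).+1) by rewrite /D polyCM.
      have -> : (a r + b s1 = e + (a r + (b s2).+1))%N by rewrite /e; lia.
      rewrite rmorphB /= map_polyZ /= map_polyXn (exprD _ e) -[_ *: _]mul_polyC; ring.
    rewrite (leq_trans (size_polyD _ _)) // geq_max; apply/andP; split.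
      rewrite size_mul_regular ?polyX_eq0 //; apply: leq_trans (size_poly _ _) _.
      apply: leq_trans (size_subCXn (sP r o1)) _ => /=; lia.
    rewrite (leq_trans (size_polyMleq _ _)) // size_polyXn.
    have : (size (kappa (P r (lift ord0 o2))) <= (a r + b o2).+1)%N.
      exact: leq_trans (size_poly _ _) (sP r o2).
    rewrite /e /=; move: (size (kappa (P r (lift ord0 o2)))) => x; lia.
  case: (eqVneq s o2) => [->|ns2]; rewrite ?[_ == s2]eqxx ?eqxx.
    rewrite size_polyN (leq_trans (size_polyD _ _)) // size_polyN geq_max; apply/andP; split.
      apply: leq_trans (size_poly _ _) _; apply: leq_trans (sP r o2) _ => /=; lia.
    by rewrite /D mul_polyC (leq_trans (size_scale_leq _ _)) // size_polyXn.
  rewrite subr0 ifN; last by apply: contra ns2 => /eqP e2; apply/eqP/val_inj.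
  rewrite ifN; last by apply: contra ns1 => /eqP e1; apply/eqP/val_inj.
  exact: leq_trans (size_poly _ _) (sP r s).
- by rewrite size_polyN; apply: leq_trans (size_poly _ _) sh.
by rewrite sum_upd_move.
Qed.

(* As in b_move, with rows in place of columns. *)
Lemma a_move (l1 l2 : nat) : (l1 < n.+1)%N -> (l2 < n.+1)%N -> (a l2 + 2 <= a l1)%N ->
  ppoints n a b c N -> cl (ppoints n (upd (upd a l1 (a l1).-1) l2 (a l2).+1) b c) emb N.
Proof.
move=> lt1 lt2 lea Npt; have suma := presented_sum Npt.
case: Npt => Nf [P [h [sP sh NE _ sumab]]].
pose o1 := Ordinal lt1; pose o2 := Ordinal lt2.
have no : o1 != o2 by apply/eqP => /(congr1 val) /= e; rewrite e in lea; lia.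
pose e := (a l1 - (a l2).+1)%N.
pose D (s : 'I_n.+1) : {poly {poly K}} := if unlift ord0 s is Some s' then
  ('X * ((P o1 s)`_(a l1 + b s'))%:P)%:P * 'X^((a l2).+1 + b s') else 0.
pose Pt : 'M[{poly {poly K}}]_n.+1 := \matrix_(r, s) (kappa (P r s) - if r == o2 then D s else 0).
pose M := elem_mx o1 o2 'X%:P 'X^e : 'M[{poly {poly K}}]_n.+1.
pose f := minor_gen Pt (kappa h).
pose g := minor_gen (M *m Pt) (- kappa h).
have X0 : 'X%:P != 0 :> {poly {poly K}} by rewrite polyC_eq0 polyX_eq0.
have adjN l := adj_row0_mulmx M Pt l; rewrite det_elem_mx // in adjN.
have M1 r : M r o1 = if r == o1 then 'X%:P else 0.
  rewrite mxE eqxx; case: ifP => // ro1; case: ifP => [_|]; first by rewrite (negbTE no) oppr0.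
  by rewrite ro1.
have adj1 : \adj (M *m Pt) ord0 o1 = - \adj Pt ord0 o1.
  have := adjN o1; rewrite (bigD1 o1) //= M1 eqxx big1 ?addr0 => [|r nr]; last first.
    by rewrite M1 (negbTE nr) mulr0.
  by move=> eX; apply: (mulIf X0); rewrite eX mulNr mulNr mulrC.
have g1 : g o1 = f o1 by rewrite /g /f /minor_gen !inord_val adj1 mulrNN.
have go (l : 'I_n.+1) : l != o1 -> l != o2 -> g l = 'X%:P * f l.
  move=> n1 n2; have Ml r : M r l = (r == l)%:R.
    rewrite mxE (negbTE n1) (negbTE n2); case: eqP => [->|_].
      by rewrite eq_sym (negbTE n1).
    by case: eqP => [->|_] //; rewrite oppr0 eq_sym (negbTE n2).
  have := adjN l; rewrite (bigD1 l) //= Ml eqxx mulr1 big1 ?addr0 => [eX|r nr]; last first.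
    by rewrite Ml (negbTE nr) mulr0.
  by rewrite /g /f /minor_gen !inord_val eX; ring.
have M2 r : M r o2 = if r == o1 then 'X^e else if r == o2 then -1 else 0.
  rewrite mxE [o2 == o1]eq_sym (negbTE no) eqxx; case: ifP => // _.
  by case: ifP => // ->.
have g2 : g o2 = 'X^e * f o1 - 'X%:P * f o2.
  have eX : - 'X%:P * \adj Pt ord0 o2 =
      - \adj (M *m Pt) ord0 o2 + \adj (M *m Pt) ord0 o1 * 'X^e.
    rewrite -adjN (bigD1 o2) //= (bigD1 o1) //= big1 ?addr0 => [|r /andP[n2 n1]].
      by rewrite !M2 !eqxx [o2 == o1]eq_sym (negbTE no) mulrN1.
    by rewrite M2 (negbTE n1) (negbTE n2) mulr0.
  rewrite /g /f /minor_gen !inord_val.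
  have -> : \adj (M *m Pt) ord0 o2 = \adj (M *m Pt) ord0 o1 * 'X^e + 'X%:P * \adj Pt ord0 o2.
    by rewrite -[RHS]opprK opprD -[- ('X%:P * _)]mulNr eX; ring.
  rewrite adj1; move: (\adj Pt ord0 o1) (\adj Pt ord0 o2) (kappa h) => x y z; ring.
pose a' := upd (upd a l1 (a l1).-1) l2 (a l2).+1.
have a'1 : a' o1 = (a l1).-1 by rewrite /a' /upd eqxx; case: eqP => // /= e12; rewrite e12 in lea; lia.
have a'2 : a' o2 = (a l2).+1 by rewrite /a' /upd eqxx.
have a'o (l : 'I_n.+1) : l != o1 -> l != o2 -> a' l = a l.
  by rewrite -!(inj_eq val_inj) /= /a' /upd => /negbTE -> /negbTE ->.
(* Row [l1] loses its last multiple. Only that basis element is perturbed, into ['X^(a l2) * g o2],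
   the multiple gained by row [l2]. *)
pose w (i : {l : 'I_n.+1 & 'I_(a l)}) : {poly {poly K}} := 'X^(tagged i) * f (tag i) -
  if (tag i == o1) && (tagged i == (a l1).-1 :> nat) then 'X%:P * ('X^(a l2) * f o2) else 0.
rewrite -/a'; apply: (move_cl (w := w) (P := M *m Pt) (h := - kappa h) (t := 'X) (r := 0) Nf NE suma).
- move=> i; have fE l : map_poly (horner_eval 0) (f l) = minor_gen P h l.
    rewrite /f minor_gen_map /= specialize_const; congr (minor_gen _ _ _).
    apply/matrixP => r s; rewrite !mxE rmorphB /= specialize_const.
    case: ifP => _; last by rewrite rmorph0 subr0.
    rewrite /D; case: unlift => [s'|]; last by rewrite rmorph0 subr0.
    by rewrite rmorphM /= map_polyC /= /horner_eval hornerM hornerX mul0r mul0r subr0.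
  rewrite rmorphB rmorphM /= map_polyXn fE; case: ifP => _; last by rewrite rmorph0 subr0.
  by rewrite rmorphM /= map_polyC /= /horner_eval hornerX mul0r subr0.
- by rewrite polyX_eq0.
- case=> l m; rewrite /w /=; have [el|n1] := eqVneq l o1.
    have ltm : (m < a l1)%N by apply: leq_trans (ltn_ord m) _; rewrite el.
    case: eqP => [em|nm] /=.
      have -> : 'X%:P * ('X^m * f l - 'X%:P * ('X^(a l2) * f o2)) = ('X%:P * 'X^(a l2)) * g o2.
        rewrite g2 em el; have -> : ((a l1).-1 = a l2 + e)%N by rewrite /e; lia.
        rewrite exprD; move: (f o1) (f o2) => x y; ring.
      apply: gspan_mul => //; rewrite a'2 size_mul_regular ?polyX_eq0 // size_polyXn //.
    have -> : 'X%:P * ('X^m * f l - 0) = ('X%:P * 'X^m) * g o1.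
      by rewrite g1 subr0 mulrA (_ : f l = f o1) // el.
    apply: gspan_mul => //; rewrite a'1 size_mul_regular ?polyX_eq0 // size_polyXn; lia.
  rewrite subr0; have [el|n2] := eqVneq l o2.
    have ltm : (m < a l2)%N by apply: leq_trans (ltn_ord m) _; rewrite el.
    (* Solves the formula [g2] for the old generator; as [m < a l2], the exponent [m + e] stays
       below [(a l1).-1]. *)
    have -> : 'X%:P * ('X^m * f l) = 'X^(m + e) * g o1 - 'X^m * g o2.
      rewrite g1 g2 (_ : f l = f o2) ?el // exprD.
      move: (f o1) (f o2) => x y; ring.
    by apply: gspanB; apply: gspan_mul => //; rewrite size_polyXn ?a'1 ?a'2 // /e; lia.
  have -> : 'X%:P * ('X^m * f l) = 'X^m * g l by rewrite go // mulrCA.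
  by apply: gspan_mul => //; rewrite a'o // size_polyXn.
- move=> r s; rewrite mul_elem_mx // !mxE.
  have DE : D (lift ord0 s) = ('X * ((P o1 (lift ord0 s))`_(a l1 + b s))%:P)%:P * 'X^((a l2).+1 + b s).
    by rewrite /D liftK.
  have [->|n1] := eqVneq r o1.
    rewrite a'1 (negbTE no) eqxx subr0 DE; set p1 := P o1 _; set p2 := P o2 _.
    have -> : 'X%:P * kappa p1 + 'X^e * (kappa p2 - ('X * (p1`_(a l1 + b s))%:P)%:P * 'X^((a l2).+1 + b s)) =
       'X%:P * kappa (p1 - p1`_(a l1 + b s) *: 'X^(a l1 + b s)) + 'X^e * kappa p2.
      have -> : 'X^(a l1 + b s) = 'X^e * 'X^((a l2).+1 + b s) :> {poly K}.
        by rewrite -exprD; congr 'X^_; rewrite /e; lia.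
      rewrite rmorphB /= map_polyZ /= [map_poly _ (_ * _)]rmorphM /= !map_polyXn -[_ *: _]mul_polyC polyCM; ring.
    rewrite (leq_trans (size_polyD _ _)) // geq_max; apply/andP; split.
      rewrite size_mul_regular ?polyX_eq0 //; apply: leq_trans (size_poly _ _) _.
      apply: leq_trans (size_subCXn (sP o1 s)) _ => /=; lia.
    rewrite (leq_trans (size_polyMleq _ _)) // size_polyXn.
    have : (size (kappa p2) <= (a o2 + b s).+1)%N by exact: leq_trans (size_poly _ _) (sP o2 s).
    by rewrite /e /=; move: (size _) => x; lia.
  have [->|n2] := eqVneq r o2.
    rewrite a'2 size_polyN (leq_trans (size_polyD _ _)) // size_polyN geq_max DE; apply/andP; split.
      apply: leq_trans (size_poly _ _) _; apply: leq_trans (sP o2 s) _ => /=; lia.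
    by rewrite eqxx mul_polyC (leq_trans (size_scale_leq _ _)) // size_polyXn.
  rewrite subr0 a'o //; exact: leq_trans (size_poly _ _) (sP r s).
- by rewrite size_polyN; apply: leq_trans (size_poly _ _) sh.
- by rewrite sum_upd_move.
by rewrite sum_upd_move.
Qed.

End MoveLemmas.

Section Padding.
Variable K : fieldType.

(** A block sum with 1: a redundant generator together with the relation that eliminates it. It
    adjusts the number of generators before the moves, which keep it fixed. *)
Definition pad_mx (R : nzRingType) n (P : 'M[R]_n.+1) : 'M[R]_n.+2 :=
  \matrix_(r, s) match unlift ord_max r, unlift ord_max s with
    | Some r', Some s' => P r' s' | None, None => 1 | _, _ => 0 end.

Lemma adj_pad_mx (R : comNzRingType) n (P : 'M[R]_n.+1) l :
  \adj (pad_mx P) ord0 (lift ord_max l) = \adj P ord0 l.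
Proof.
rewrite !adj_row0E (expand_det_row _ ord_max) (bigD1 ord_max) //= big1 ?addr0 => [|s ns].
  rewrite [setcol0 _ _ _ _]mxE [pad_mx _ _ _]mxE unlift_none /= mul1r /cofactor.
  rewrite -signr_odd oddD addbb expr0 mul1r; congr (\det _); apply/matrixP => r s.
  have e0 : (lift ord_max s == ord0 :> 'I_n.+2) = (s == ord0).
    by rewrite -!(inj_eq val_inj) /= /bump leqNgt ltn_ord.
  by rewrite !mxE !liftK (inj_eq lift_inj) e0.
rewrite [setcol0 _ _ _ _]mxE; case: (unliftP ord_max s) ns => [s' ->|->]; last by rewrite eqxx.
case: ifP => [_|_] _; first by rewrite mxE (negbTE (neq_lift _ _)) mul0r.
by rewrite mxE unlift_none liftK mul0r.
Qed.

Lemma sum_upd_last n (e : nat -> nat) :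
  (\sum_(l < n.+1) upd e n 0%N l = \sum_(l < n) e l)%N.
Proof.
rewrite big_ord_recr /= {2}/upd eqxx addn0; apply: eq_bigr => l _.
by rewrite /upd ltn_eqF.
Qed.

Lemma excess_upd_last n (e : nat -> nat) i : excess n.+1 (upd e n 0%N) i = excess n e i.
Proof.
rewrite /excess big_ord_recr /= {2}/upd eqxx sub0n addn0; apply: eq_bigr => l _.
by rewrite /upd ltn_eqF.
Qed.

Lemma presented_pad j n (a b : nat -> nat) c (S : {poly K} -> Prop) : presented j n a b c S ->
  presented j n.+1 (upd a n.+1 0%N) (upd b n 0%N) c S.
Proof.
case=> P [h [sP sh SE dimS sumab]]; exists (pad_mx P), h.
rewrite !sum_upd_last; split=> // [r s|p].
  rewrite mxE /upd; case: (unliftP ord_max r) => [r'|] er; last first.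
    case: (unliftP ord_max (lift ord0 s)) => [s'|] es; first by rewrite size_poly0.
    by rewrite size_poly1.
  case: (unliftP ord_max (lift ord0 s)) => [s'|] es; last by rewrite size_poly0.
  have er' : r = r' :> nat by rewrite er lift_max.
  have es' : s.+1 = s' :> nat by rewrite -(lift_max s') -es lift0.
  rewrite er' ltn_eqF //; have lts : (s < n)%N by have := ltn_ord s'; rewrite -es'.
  rewrite ltn_eqF //; have -> : s' = lift ord0 (Ordinal lts) by apply: val_inj; rewrite /= -es'.
  exact: sP r' (Ordinal lts).
have gE (l : 'I_n.+1) : minor_gen (pad_mx P) h l = minor_gen P h l.
  rewrite /minor_gen inord_val; have -> : inord l = lift ord_max l :> 'I_n.+2.
    by apply: ord_inj; rewrite inordK ?lift_max //; apply: ltn_trans (ltn_ord l) _.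
  by rewrite adj_pad_mx.
rewrite SE; split=> -[q sq ->].
  exists (fun l => if l == n.+1 then 0 else q l) => [l ltl|].
    rewrite /upd; case: eqP => [_|nl]; first by rewrite size_poly0.
    by apply: sq; rewrite ltn_neqAle -ltnS ltl andbT; apply/eqP => e; apply: nl.
  rewrite [RHS]big_ord_recr /= eqxx scale0r addr0; apply: eq_bigr => l _.
  by rewrite ltn_eqF // gE.
exists q => [l ltl|].
  by have := sq l (ltnW ltl); rewrite /upd ltn_eqF.
rewrite big_ord_recr /=; have := sq n.+1 (ltnSn _); rewrite /upd eqxx leqn0 size_poly_eq0 => /eqP ->.
by rewrite scale0r addr0; apply: eq_bigr => l _; rewrite gE.
Qed.

End Padding.

Section LineAndRoot.
Variables d j : nat.
Variables (k K : fieldType) (emb : {rmorphism k -> K}) (N : 'M[K]_(d, j.+1)).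
Notation ppoints := (@presented_points d j).
Notation kappa := (map_poly (@polyC K)).
Variables (n : nat) (a b : nat -> nat).

(* When h is not constant, h - u acquires a root s over K(s), where u = h(s) is
   still transcendental over K. *)
Lemma c_move c s1 : (s1 < n)%N -> ppoints n a b c.+1 N -> cl (ppoints n a (upd b s1 (b s1).+1) c) emb N.
Proof.
move=> lt1 Npt; have suma := presented_sum Npt.
case: (Npt) => Nf [P [h [sP sh NE dimN sumab]]].
pose o1 := Ordinal lt1; set b' := upd b s1 (b s1).+1.
have leb (s : 'I_n) : (b s <= b' s)%N by rewrite /b' /upd; case: eqP => // ->.
have sumab' : (\sum_(l < n.+1) a l + \sum_(s < n) b' s + c = j.+1)%N.
  have := @sum_upd n (fun _ y => y) b s1 (b s1).+1 lt1; rewrite /= -/b'; move: sumab.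
  move: (\sum_(l < n.+1) a l)%N (\sum_(s < n) b s)%N (\sum_(s < n) b' s)%N => x y z; lia.
(* If the degree of [h] is already at most [c], the same matrix and factor satisfy the weaker bounds
   of the new data. *)
have [leh|gth] := leqP (size h) c.+1.
  apply: cl_refl; split=> //; exists P, h; split=> // r s.
  by apply: leq_trans (sP r s) _; rewrite ltnS leq_add2l.
have [L [rho rhoI]] := exists_generic_point K.
(* Sends t to h(s), where s is the generic element; injectivity holds because [h] is not
   constant. *)
pose rho' : {rmorphism {poly K} -> L} := GRing.RMorphism.clone _ _ (rho \o comp_poly h) _.
have sh1 : (1 < size h)%N by apply: leq_trans gth.
have rhoI' : injective rho'.
  move=> p q /= /rhoI /eqP; rewrite -subr_eq0 -comp_polyB comp_poly_eq0 // subr_eq0.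
  by move/eqP.
pose lam : {rmorphism k -> L} := GRing.RMorphism.clone _ _ (rho \o (@polyC K \o emb)) _.
have lamE x : lam x = rho' (emb x)%:P by rewrite /= comp_polyC.
pose iota p := map_poly rho (kappa p).
have iotaE p : map_poly rho' (kappa p) = iota p.
  by apply/polyP => i; rewrite !coef_map /= comp_polyC.
have root_s : root (iota h - (rho h)%:P) (rho 'X).
  rewrite /root !hornerE /iota horner_map /= -/(comp_poly _ _) comp_polyXr subrr //.
have [q eq] := factor_theorem _ _ root_s.
pose w (i : {l : 'I_n.+1 & 'I_(a l)}) : {poly {poly K}} :=
  'X^(tagged i) * minor_gen (map_mx kappa P) (kappa h - 'X%:P) (tag i).
have size_w i : (size (w i) <= j.+1)%N.
  rewrite -sumab; apply: minor_gen_size; rewrite ?size_polyXn //.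
    by move=> r s; rewrite mxE; apply: leq_trans (size_poly _ _) (sP r s).
  rewrite (leq_trans (size_polyD _ _)) // size_polyN geq_max (leq_trans (size_poly _ _) sh) /=.
  by rewrite (leq_trans (size_polyC_leq1 _)).
apply: (deform_cl Nf NE suma (r := 0) size_w _ rhoI' lamE) => [i|U Uf UE].
  rewrite rmorphM /= map_polyXn minor_gen_map /= rmorphB /= specialize_const.
  rewrite map_polyC /= /horner_eval hornerX subr0; congr (_ * minor_gen _ _ _).
  by apply/matrixP => r s; rewrite !mxE specialize_const.
(* Multiplying the single column [s1] by the linear factor multiplies all maximal minors by it, so
   it can be taken out of [h]. *)
pose D : 'M[{poly L}]_n.+1 :=
  diag_mx (\row_s if s == lift ord0 o1 then 'X - (rho 'X)%:P else 1).
have nl q' : (ord0 == lift ord0 q' :> 'I_n.+1) = false by apply: negbTE (neq_lift _ _).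
have detD : \det D = 'X - (rho 'X)%:P.
  rewrite det_diag (bigD1 (lift ord0 o1)) //= mxE eqxx big1 ?mulr1 // => s ns.
  by rewrite mxE (negbTE ns).
have DE s s' : D s s' = if s == s' then (if s == lift ord0 o1 then 'X - (rho 'X)%:P else 1) else 0.
  by rewrite !mxE; have [->|_] := eqVneq s s'; rewrite ?mulr1n ?mulr0n.
apply: (presented_family (P := map_mx iota P *m D) (h := q) _ _ sumab' suma Uf UE).
- move=> r s; have -> : (map_mx iota P *m D) r (lift ord0 s) =
      iota (P r (lift ord0 s)) * D (lift ord0 s) (lift ord0 s).
    rewrite mxE (bigD1 (lift ord0 s)) //= mxE big1 ?addr0 // => s' ns'.
    by rewrite DE (negbTE ns') mulr0.
  have si : (size (iota (P r (lift ord0 s))) <= (a r + b s).+1)%N.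
    exact: leq_trans (size_poly _ _) (leq_trans (size_poly _ _) (sP r s)).
  rewrite DE eqxx (inj_eq lift_inj) /b' /upd -(inj_eq val_inj) /=; case: eqP => [es|_]; last first.
    by rewrite mulr1.
  rewrite (leq_trans (size_polyMleq _ _)) // size_XsubC addn2 /= addnS ltnS -es.
  exact: si.
- have [->|q0] := eqVneq q 0; first by rewrite size_poly0.
  rewrite -ltnS; have -> : (size q).+1 = size (q * ('X - (rho 'X)%:P)).
    by rewrite size_mul ?polyXsubC_eq0 // size_XsubC addn2.
  rewrite -eq (leq_trans (size_polyD _ _)) // size_polyN geq_max; apply/andP; split.
    exact: leq_trans (size_poly _ _) (leq_trans (size_poly _ _) sh).
  by rewrite (leq_trans (size_polyC_leq1 _)).
case=> l m; rewrite /w /= rmorphM /= map_polyXn minor_gen_map /= rmorphB /= iotaE map_polyC /=.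
rewrite comp_polyX eq; have -> : minor_gen (map_mx (map_poly rho') (map_mx kappa P))
    (q * ('X - (rho 'X)%:P)) l = minor_gen (map_mx iota P *m D) q l.
  rewrite /minor_gen inord_val adj_row0_mulmxr ?detD.
  - rewrite -mulrA; congr (_ * (_ * \adj _ _ _)); apply/matrixP => r s.
    by rewrite !mxE -iotaE.
  - by move=> s; rewrite DE nl eq_sym; case: eqP.
  by move=> s; rewrite DE; case: eqP => // ->; rewrite nl.
by apply: gspan_mul => //; rewrite size_polyXn.
Qed.

End LineAndRoot.

(** * Chains of degenerations between strata *)

Section Specialization.
Variables d j : nat.
Notation ppoints := (@presented_points d j).

(* The point U lies in the stratum of the Hilbert function H with
   H (j - i) = (j - i).+1 - al i and H (j + i) = be i. *)
Definition stratum (al be : nat -> nat) : point_class d j := fun L U =>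
  row_free U /\ forall i,
    @has_dim L ({poly L})^o (dn (rowspace U) i) (al i) /\
    @has_dim L ({poly L})^o (up (rowspace U) i) ((j + i).+1 - be i).

Lemma eq_stratum (al al' be be' : nat -> nat) (L : fieldType) (U : 'M[L]_(d, j.+1)) :
  (forall i, al i = al' i) -> (forall i, be i = be' i) ->
  stratum al be U -> stratum al' be' U.
Proof. by move=> ea eb [Uf UD]; split=> // i; rewrite -ea -eb. Qed.

Lemma exists_dim_up (L : fieldType) (U : 'M[L]_(d, j.+1)) i :
  exists m, @has_dim L ({poly L})^o (up (rowspace U) i) m.
Proof.
have [||m _ dimm] := @has_dim_sub L ({poly L})^o (up (rowspace U) i) _ _ _ _
  (has_dim_rowspace (1%:M : 'M[L]_((j + i).+1))); last by exists m.
  exact: subspace_up (subspace_rowspace U).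
move=> p [v Uv ->]; apply: (@subspace_sum L ({poly L})^o) => [|e _]; first exact: subspace_rowspace.
apply/rowspaceP; last exact: submx1.
rewrite (leq_trans (size_polyMleq _ _)) // size_polyXn.
have := rowspace_size (Uv e (leq_ord e)); have := leq_ord e.
by move: (size (v e)) => x; lia.
Qed.

Lemma exists_dim_dn (L : fieldType) (U : 'M[L]_(d, j.+1)) i :
  exists2 m, (m <= j.+1)%N & @has_dim L ({poly L})^o (dn (rowspace U) i) m.
Proof.
have [||m lem dimm] := @has_dim_sub L ({poly L})^o (dn (rowspace U) i) _ _ _ _
  (has_dim_rowspace U).
- exact: subspace_dn (subspace_rowspace U).
- by move=> p /(_ 0%N (leq0n _)); rewrite expr0 mul1r.
by exists m => //; apply: leq_trans lem (rank_leq_col U).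
Qed.

Lemma stratum_presented n (a b : nat -> nat) c (L : fieldType) (U : 'M[L]_(d, j.+1)) :
  (forall l, (l < n.+1)%N -> (0 < a l)%N) ->
  (\sum_(l < n.+1) a l + \sum_(s < n) b s + c = j.+1)%N ->
  stratum (excess n.+1 a) (fun i => c + excess n b i)%N U -> ppoints n a b c U.
Proof.
move=> a_gt0 sumab [Uf UD]; split=> //; apply: presented_of_dims => // [p|i|i].
- exact: rowspace_size.
- exact: (proj1 (UD i)).
exact: (proj2 (UD i)).
Qed.

Lemma presented_sumab n (a b : nat -> nat) c (L : fieldType) (U : 'M[L]_(d, j.+1)) :
  ppoints n a b c U -> (\sum_(l < n.+1) a l + \sum_(s < n) b s + c = j.+1)%N.
Proof. by case=> _ [P [h []]]. Qed.

(* The generic point of the line joining the presentations of N and N0 specializes to N0, so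
   by semicontinuity its dimensions are bounded by those of the stratum; being presented, it
   satisfies the opposite bounds. *)
Lemma presented_cl (k K : fieldType) (emb : {rmorphism k -> K}) (N N0 : 'M[K]_(d, j.+1))
    n (a b : nat -> nat) c :
  (0 < d)%N -> (forall l, (l < n.+1)%N -> (0 < a l)%N) ->
  ppoints n a b c N -> stratum (excess n.+1 a) (fun i => c + excess n b i)%N N0 ->
  cl (stratum (excess n.+1 a) (fun i => c + excess n b i)%N) emb N.
Proof.
move=> d_gt0 a_gt0 Npt N0s; have sumab := presented_sumab Npt.
have suma := presented_sum Npt.
have N0pt := stratum_presented a_gt0 sumab N0s.
case: Npt => Nf [P [h [sP sh NE _ _]]]; case: N0pt => N0f [P0 [h0 [sP0 sh0 N0E _ _]]].
pose ka := map_poly (@polyC K).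
(* The line through both presentations: t = 0 gives [N] and t = 1 gives [N0]. *)
pose Pt : 'M[{poly {poly K}}]_n.+1 := \matrix_(r, s) (ka (P r s) + 'X%:P * ka (P0 r s - P r s)).
pose ht := ka h + 'X%:P * ka (h0 - h).
have size_line (p q : {poly K}) m : (size p <= m)%N -> (size q <= m)%N ->
    (size (ka p + 'X%:P * ka (q - p))%R <= m)%N.
  move=> sp sq; rewrite (leq_trans (size_polyD _ _)) // geq_max (leq_trans (size_poly _ _) sp) /=.
  rewrite size_mul_regular ?polyX_eq0 // (leq_trans (size_poly _ _)) //.
  by rewrite (leq_trans (size_polyD _ _)) // size_polyN geq_max sp sq.
have line0 (p q : {poly K}) : map_poly (horner_eval 0) (ka p + 'X%:P * ka (q - p)) = p.
  rewrite rmorphD rmorphM /= !specialize_const map_polyC /= /horner_eval hornerX.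
  by rewrite mul0r addr0.
have line1 (p q : {poly K}) : map_poly (horner_eval 1) (ka p + 'X%:P * ka (q - p)) = q.
  rewrite rmorphD rmorphM /= !specialize_const map_polyC /= /horner_eval hornerX.
  by rewrite mul1r addrC subrK.
pose w (i : {l : 'I_n.+1 & 'I_(a l)}) := 'X^(tagged i) * minor_gen Pt ht (tag i).
have w0 i : map_poly (horner_eval 0) (w i) = 'X^(tagged i) * minor_gen P h (tag i).
  rewrite rmorphM /= map_polyXn minor_gen_map /= line0; congr (_ * minor_gen _ _ _).
  by apply/matrixP => r s; rewrite mxE [Pt _ _]mxE; apply: line0.
have w1 i : map_poly (horner_eval 1) (w i) = 'X^(tagged i) * minor_gen P0 h0 (tag i).
  rewrite rmorphM /= map_polyXn minor_gen_map /= line1; congr (_ * minor_gen _ _ _).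
  by apply/matrixP => r s; rewrite mxE [Pt _ _]mxE; apply: line1.
have [L [rho rhoI]] := exists_generic_point K.
have [|||sw Upres] := @generic_presented d j K L rho _ 1 w n a b c Pt ht rhoI (oner_neq0 _) _ _ _ sumab suma.
- by move=> i; rewrite polyC1 mul1r; apply: gspan_mul => //; rewrite size_polyXn.
- by move=> r s; rewrite mxE; apply: size_line.
- exact: size_line.
pose lam : {rmorphism k -> L} := GRing.RMorphism.clone _ _ (rho \o (@polyC K \o emb)) _.
pose lam1 : {rmorphism K -> L} := GRing.RMorphism.clone _ _ (rho \o @polyC K) _.
pose idK : {rmorphism K -> K} := GRing.RMorphism.clone _ _ idfun _.
apply: (deform_cl Nf NE suma sw w0 (lam := lam) rhoI) => // U Uf UE; split=> // i.
have Upt := Upres U Uf UE; have [_ N0D] := N0s.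
(* Specializing at t = 1 instead of t = 0: [N0] is in the closure of any class that contains all the
   bases of the row space of the generic point [U]. *)
have N0cl (X : point_class d j) : (forall U' : 'M[L]_(d, j.+1),
    (forall p, rowspace U' p <-> rowspace U p) -> X L U') -> cl X idK N0.
  move=> XU; apply: (deform_cl N0f N0E suma sw w1 (lam := lam1) rhoI) => // U' _ U'E.
  by apply: XU => p; rewrite U'E UE.
have [m dimm] := exists_dim_up U i; have [m' lem' dimm'] := exists_dim_dn U i.
have d0 : (0 < \sum_(l < n.+1) a l)%N by rewrite suma.
split.
  suff -> : excess n.+1 a i = m' by [].
  apply/eqP; rewrite eqn_leq (presented_dn (proj2 Upt) dimm') /=.
  pose X : point_class d j := fun L' U' =>
    exists2 q, (m' <= q)%N & @has_dim L' ({poly L'})^o (dn (rowspace U') i) q.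
  apply: (@dn_dim_cl d j K K X idK N0 i _ m' N0f _ (proj1 (N0D i))) => //.
  apply: N0cl => U' eU; exists m' => //; apply: eq_has_dim dimm' => p.
  by apply: eq_dn => q; rewrite eU.
suff -> : ((j + i).+1 - (c + excess n b i))%N = m by [].
apply/eqP; rewrite eqn_leq (presented_up (proj2 Upt) d0 dimm) andbT.
pose X : point_class d j := fun L' U' =>
  exists2 q, (q <= m)%N & @has_dim L' ({poly L'})^o (up (rowspace U') i) q.
apply: (@up_dim_cl d j K K X idK N0 i _ m N0f _ (proj2 (N0D i))) => //.
apply: N0cl => U' eU; exists m => //; apply: eq_has_dim dimm => p.
by apply: eq_up => q; rewrite eU.
Qed.

Lemma presented_points_pad n s (a b : nat -> nat) c (L : fieldType) (U : 'M[L]_(d, j.+1)) :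
  ppoints n a b c U -> exists a' b', [/\ ppoints (n + s) a' b' c U,
    forall i, excess (n + s).+1 a' i = excess n.+1 a i
    & forall i, excess (n + s) b' i = excess n b i].
Proof.
move=> Upt; elim: s => [|s [a' [b' [[Uf Upt'] ea eb]]]]; first by exists a, b; rewrite addn0.
exists (upd a' (n + s).+1 0%N), (upd b' (n + s) 0%N); rewrite addnS; split=> [|i|i].
- by split=> //; apply: presented_pad.
- by rewrite excess_upd_last ea.
by rewrite excess_upd_last eb.
Qed.

(** The number of positive parts is the difference of the excesses at 0 and 1. *)
Lemma excess_gt0 n (a a' : nat -> nat) : (forall i, excess n a' i = excess n a i) ->
  (forall l, (l < n)%N -> (0 < a l)%N) -> forall l, (l < n)%N -> (0 < a' l)%N.
Proof.
move=> ea a_gt0 l ltl; have ec : count_gt n a' 0 = n.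
  have := excess_rec n a' 0; rewrite !ea (excess_rec n a 0) => /addnI <-.
  rewrite -[RHS]card_ord -sum1_card; apply: eq_bigr => q _.
  by rewrite a_gt0.
rewrite lt0n; apply/eqP => a0; have : (count_gt n a' 0 < n)%N; last by rewrite ec ltnn.
rewrite -[ltnRHS]card_ord -sum1_card /count_gt (bigD1 (Ordinal ltl)) //= a0 ltnn add0n.
by rewrite [ltnRHS](bigD1 (Ordinal ltl)) //= add1n ltnS; apply: leq_sum => q _; apply: leq_b1.
Qed.

Lemma stratum_cl (k K : fieldType) (emb : {rmorphism k -> K}) (N : 'M[K]_(d, j.+1))
    n n' (a b a' b' : nat -> nat) c c' :
  (0 < d)%N -> (n' <= n)%N -> (forall l, (l < n.+1)%N -> (0 < a l)%N) ->
  (forall l, (l < n'.+1)%N -> (0 < a' l)%N) ->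
  (\sum_(l < n'.+1) a' l + \sum_(s < n') b' s + c' = j.+1)%N ->
  (forall i, (excess n.+1 a i <= excess n'.+1 a' i)%N) ->
  excess n.+1 a 0 = excess n'.+1 a' 0 ->
  (forall i, (c + excess n b i <= c' + excess n' b' i)%N) ->
  (c + excess n b 0 = c' + excess n' b' 0)%N ->
  (forall L : fieldType, exists N0 : 'M[L]_(d, j.+1),
     stratum (excess n.+1 a) (fun i => c + excess n b i)%N N0) ->
  stratum (excess n'.+1 a') (fun i => c' + excess n' b' i)%N N ->
  cl (stratum (excess n.+1 a) (fun i => c + excess n b i)%N) emb N.
Proof.
move=> d_gt0 len a_gt0 a'_gt0 sumab' lea ea0 leb eb0 exN0 Ns.
have Npt := stratum_presented a'_gt0 sumab' Ns.
have [a1 [b1 [N1 ea1 eb1]]] := presented_points_pad (n - n') Npt.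
rewrite subnKC // in N1 ea1 eb1.
(* For the rows the constant [c] of the chain is a dummy held at 0, so only moves between two parts
   occur. *)
have [|||||a2 [_ N2] ea2] := @excess_chain n.+1 a 0
  (fun a c => c = 0%N /\ cl (ppoints n a b1 c') emb N) _ _ a1 0%N.
- move=> e c0 l1 l2 [-> eN] lt1 lt2 le12; split=> //.
  by apply: cl_trans eN => L lam U; apply: a_move.
- by move=> e c0 l1 [].
- by split=> //; apply: cl_refl.
- by move=> i; rewrite ea1 !add0n.
- by rewrite ea1 !add0n.
have [||||b2 N3 eb2] := @excess_chain n b c (fun b c => cl (ppoints n a2 b c) emb N) _ _ b1 c' N2.
- move=> e c0 l1 l2 eN lt1 lt2 le12.
  by apply: cl_trans eN => L lam U; apply: b_move.
- by move=> e c0 l1 eN lt1; apply: cl_trans eN => L lam U; apply: c_move.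
- by move=> i; rewrite eb1.
- by rewrite eb1.
(* The chain reaches points presented with the target data, which need not lie in the stratum. These
   are defined over varying fields, so a stratum point is needed over each of them. *)
apply: cl_trans N3 => L lam U Upt; have [N0 N0s] := exN0 L.
have a2_gt0 := excess_gt0 ea2 a_gt0.
have sE (V : fieldType) (W : 'M[V]_(d, j.+1)) :
    stratum (excess n.+1 a) (fun i => c + excess n b i)%N W <->
    stratum (excess n.+1 a2) (fun i => c + excess n b2 i)%N W.
  by split; apply: eq_stratum => i; rewrite ?ea2 ?eb2.
have /(presented_cl lam d_gt0 a2_gt0 Upt) := proj1 (sE _ _) N0s.
by apply: cl_trans => L' lam' U' /sE; apply: cl_refl.
Qed.

End Specialization.

(** * Monomial points *)

Section Windows.
Local Open Scope nat_scope.

(* Let V be spanned by the monomials x^v y^(j-v) with s v = true. Then R_{-i}V is spanned by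
   the monomials at the start of a window of i.+1 consecutive trues, and the monomials
   missing from R_iV correspond to the windows of i.+1 consecutive falses, once s is padded
   by i falses on both sides. *)
Definition windows (x : bool) i (s : seq bool) : nat :=
  \sum_(v < size s) ((v + i < size s) && all (fun a => nth false s (v + a) == x) (iota 0 i.+1)).

Lemma windows_cons x i y s : windows x i (y :: s) =
  ((i < (size s).+1) && all (fun a => nth false (y :: s) a == x) (iota 0 i.+1)) + windows x i s.
Proof. by rewrite /windows big_ord_recl. Qed.

Lemma windows_skip x i m s : windows x i (nseq m (~~ x) ++ s) = windows x i s.
Proof.
elim: m => // m IHm; rewrite /= windows_cons IHm /=.
by case: x {IHm} => /=; rewrite ?andbF.
Qed.

Lemma windows_run x i m s : windows x i (nseq m x ++ ~~ x :: s) = (m - i) + windows x i s.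
Proof.
elim: m => [|m IHm]; first by rewrite (windows_skip x i 1).
rewrite /= windows_cons IHm addnA; congr (_ + _).
have -> : (i < (size (nseq m x ++ ~~ x :: s)).+1) &&
   all (fun a => nth false (x :: nseq m x ++ ~~ x :: s) a == x) (iota 0 i.+1) = (i <= m).
  rewrite -[x :: _]/(nseq m.+1 x ++ ~~ x :: s).
  have [leim|ltmi] := leqP i m.
    rewrite size_cat size_nseq [size (_ :: _)]/= ltnS (leq_trans leim (leq_addr _ _)) andTb.
    apply/allP => a; rewrite mem_iota add0n ltnS => lea.
    by rewrite nth_cat size_nseq ltnS (leq_trans lea leim) nth_nseq ltnS (leq_trans lea leim).
  apply/negbTE/negP => /andP[_ /allP/(_ m.+1)]; rewrite mem_iota add0n ltnS => /(_ ltmi).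
  by rewrite nth_cat size_nseq ltnn subnn /=; case: (x).
by case: leqP; lia.
Qed.

Lemma windows_nseq x i m : windows x i (nseq m x) = m - i.
Proof.
elim: m => [|m IHm]; first by rewrite /windows big_ord0.
rewrite /= windows_cons IHm size_nseq ltnS.
(* Past the end the list reads as its default false, so for [x = false] the test also succeeds on
   windows that are too long; the size condition rejects them. *)
have -> : all (fun a => nth false (x :: nseq m x) a == x) (iota 0 i.+1) = (i <= m) || ~~ x.
  rewrite -[x :: _]/(nseq m.+1 x); have [leim|ltmi] := leqP i m.
    by apply/allP => a; rewrite mem_iota add0n ltnS => lea; rewrite nth_nseq ltnS (leq_trans lea leim).
  case: x {IHm}; rewrite [_ || _]/=; last by apply/allP => a _; rewrite nth_nseq; case: ifP.
  apply/negbTE/negP => /allP/(_ m.+1); rewrite mem_iota add0n ltnS => /(_ ltmi).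
  by rewrite nth_nseq ltnn.
by case: leqP => //=; lia.
Qed.

(** Alternating runs of lengths [a 0], [b 0], [a 1], and so on. The last [c] falses make all
    monomials divisible by y^c, a common factor that dehomogenizes to 1. *)
Fixpoint blocks n (a b : nat -> nat) c : seq bool :=
  if n is n'.+1 then
    nseq (a 0) true ++ nseq (b 0) false ++ blocks n' (fun l => a l.+1) (fun s => b s.+1) c
  else nseq (a 0) true ++ nseq c false.

Lemma size_blocks n a b c : size (blocks n a b c) = \sum_(l < n.+1) a l + \sum_(s < n) b s + c.
Proof.
elim: n a b => [|n IHn] a b; first by rewrite /= size_cat !size_nseq big_ord_recl !big_ord0 /= !addn0.
rewrite [blocks _ _ _ _]/= !size_cat !size_nseq IHn.
rewrite [\sum_(l < n.+2) a l]big_ord_recl [\sum_(s < n.+1) b s]big_ord_recl /=.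
by move: (\sum_(l < n.+1) a l.+1) (\sum_(s < n) b s.+1) => x y; lia.
Qed.

(** Positivity of the gaps keeps the runs of trues apart, so each run is counted separately. *)
Lemma windows_blocks_true n a b c i : (forall s, s < n -> 0 < b s) ->
  windows true i (blocks n a b c) = excess n.+1 a i.
Proof.
elim: n a b => [|n IHn] a b b_gt0; rewrite /excess big_ord_recl /=.
  rewrite big_ord0 addn0; case: c => [|c]; first by rewrite cats0 windows_nseq.
  rewrite (windows_run true i (a 0) (nseq c false)) -[nseq c false]cats0.
  by rewrite (windows_skip true) /windows big_ord0 addn0.
have := b_gt0 0 isT; case: (b 0) => // b0 _.
rewrite (windows_run true i (a 0)) (windows_skip true) IHn //.
by move=> s lts; apply: b_gt0.
Qed.

(** The padding lengthens the last run to [c + i], which contains [c] windows for every [i], whereas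
    an inner run is shortened by [i]. *)
Lemma windows_blocks_false n a b c i : (forall l, l < n.+1 -> 0 < a l) ->
  windows false i (blocks n a b c ++ nseq i false) = c + excess n b i.
Proof.
elim: n a b => [|n IHn] a b a_gt0.
  by rewrite /= -catA (windows_skip false) -nseqD windows_nseq addnK /excess big_ord0 addn0.
rewrite /= -!catA (windows_skip false) /excess big_ord_recl /=.
rewrite -[\sum_(_ < n) _]/(excess n (fun s => b s.+1) i) addnCA.
have := a_gt0 1 isT; rewrite -(IHn (fun l => a l.+1) (fun s => b s.+1)) => [a1|l ltl]; last exact: a_gt0.
have [s' ->] : exists s', blocks n (fun l => a l.+1) (fun s => b s.+1) c ++ nseq i false = true :: s'.
  by case: n {IHn a_gt0} => [|n] /=; case: (a 1) a1 => // a1 _; eexists; rewrite /= -?catA; reflexivity.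
by rewrite (windows_run false i (b 0)) (windows_skip false i 1).
Qed.

End Windows.

Section MonomialSpaces.
Variable K : fieldType.
Implicit Types (T : pred nat) (p : {poly K}).

Definition supported T p : Prop := forall v, p`_v != 0 -> T v.

Lemma subspace_supported T : @subspace K ({poly K})^o (supported T).
Proof.
split=> [v|c p q Tp Tq v]; first by rewrite coef0 eqxx.
rewrite scale_regular mul_polyC coefD coefZ => nz; have [p0|/Tp//] := eqVneq p`_v 0.
by apply: Tq; apply: contraNneq nz => ->; rewrite p0 mulr0 addr0.
Qed.

Lemma has_dim_supported T M : (forall v, T v -> (v < M)%N) ->
  @has_dim K ({poly K})^o (supported T) (\sum_(v < M) T v)%N.
Proof.
move=> ltM; apply: (@has_dim_xbasis K ({poly K})^o _ M (fun v => 'X^v) (fun v => T v : nat)).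
have E (q : nat -> {poly K}) : (forall v, (v < M)%N -> (size (q v) <= T v)%N) ->
    forall w : {poly K}, w = \sum_(l < M) (q l *: ('X^l : ({poly K})^o)) ->
    forall v, w`_v = if (v < M)%N then (q v)`_0 else 0.
  move=> sq w ew v; have -> : w = \sum_(l < M) q l * 'X^l by [].
  rewrite coef_sum.
  have F (l : 'I_M) : (q l * 'X^l)`_v = if l == v :> nat then (q v)`_0 else 0.
    rewrite (size1_polyC (leq_trans (sq l (ltn_ord l)) (leq_b1 _))) coefCM coefXn eq_sym.
    by case: eqP => [->|_]; rewrite ?mulr1 ?mulr0.
  rewrite (eq_bigr _ (fun l _ => F l)); case: ltnP => [ltv|lev].
    rewrite (bigD1 (Ordinal ltv)) //= eqxx big1 ?addr0 // => l.
    by rewrite -(inj_eq val_inj) /= => /negbTE ->.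
  by apply: big1 => l _; rewrite ltn_eqF // (leq_trans (ltn_ord l)).
split=> [p|q sq e0 v ltv].
  split=> [Tp|[q sq ->] v].
    exists (fun v => (p`_v)%:P) => [v _|].
      by rewrite size_polyC; case: eqVneq => [_|/Tp ->].
    apply/polyP => v; rewrite (E (fun v => (p`_v)%:P) _ _ erefl) => [|l _]; last first.
      by rewrite size_polyC; case: eqVneq => [_|/Tp ->].
    rewrite coefC eqxx; case: ltnP => // lev; apply/eqP.
    by rewrite -[_ == _]negbK; apply/negP => /Tp/ltM; rewrite ltnNge lev.
  rewrite (E _ sq _ erefl); case: ifP => [ltv|]; last by rewrite eqxx.
  apply: contraNT => nT; have := sq v ltv; rewrite (negbTE nT) leqn0 size_poly_eq0 => /eqP ->.
  by rewrite coef0.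
have := E _ sq 0 (esym e0) v; rewrite coef0 ltv => q0.
by rewrite (size1_polyC (leq_trans (sq v ltv) (leq_b1 _))) -q0.
Qed.

Variable s : seq bool.
Notation mono := (supported (nth false s)).

Lemma dn_mono i p : dn mono i p <->
  supported (fun v => (v + i < size s)%N && all (fun a => nth false s (v + a) == true) (iota 0 i.+1)) p.
Proof.
split=> [Sp v nz|Sp a lea v].
  have nth_s a : (a <= i)%N -> nth false s (v + a).
    move=> lea; apply: (Sp a lea); rewrite coefXnM addnK ifN //; lia.
  apply/andP; split; last by apply/allP => a; rewrite mem_iota add0n ltnS => /nth_s ->.
  by rewrite ltnNge; apply/negP => le; have := nth_s i (leqnn i); rewrite nth_default.
rewrite coefXnM; case: ltnP => [_|leav]; first by rewrite eqxx.
move=> /Sp/andP[_ /allP/(_ a)]; rewrite mem_iota add0n ltnS lea subnK // => /(_ isT).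
by case: nth.
Qed.

Lemma up_mono i p : up mono i p <->
  supported (fun v => has (fun a => (a <= v)%N && nth false s (v - a)) (iota 0 i.+1)) p.
Proof.
split=> [[w Sw ->] v|Tp].
  rewrite coef_sum => nz; apply/hasP.
  have [a aP] : exists a : 'I_i.+1, ('X^a * w a)`_v != 0.
    apply/existsP; apply: contraNT nz; rewrite negb_exists => /forallP a0.
    by rewrite big1 // => a _; apply/eqP; rewrite -[_ == _]negbK a0.
  exists (a : nat); first by rewrite mem_iota add0n ltn_ord.
  move: aP; rewrite coefXnM; case: ltnP => [_|leav]; first by rewrite eqxx.
  exact: Sw (leq_ord a) _.
have sup := subspace_up i (subspace_supported (nth false s)).
rewrite -[p]coefK poly_def; apply: (@subspace_sum K ({poly K})^o) => // v _.
have [->|/Tp/hasP[a]] := eqVneq p`_v 0; first by rewrite scale0r; exact: (proj1 sup).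
rewrite mem_iota add0n ltnS => lea /andP[leav sva].
rewrite -mul_polyC; apply: (@subspaceZ K ({poly K})^o _ _ ('X^v)) => //.
rewrite -[in 'X^v](subnKC leav) exprD; apply: up_mulXn => //; first exact: subspace_supported.
by move=> u; rewrite coefXn; have [->//|_] := eqVneq u (v - a)%N; rewrite eqxx.
Qed.

Lemma dim_dn_mono i : @has_dim K ({poly K})^o (dn mono i) (windows true i s).
Proof.
have := @has_dim_supported _ (size s) _ .
move=> /(_ (fun v => (v + i < size s)%N && all (fun a => nth false s (v + a) == true) (iota 0 i.+1))) H.
apply: (eq_has_dim _ (H _)) => [p|v /andP[lt _]]; first by rewrite dn_mono.
exact: leq_ltn_trans (leq_addr _ _) lt.
Qed.

Lemma dim_up_mono i : @has_dim K ({poly K})^o (up mono i)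
  (size s + i - windows false i (nseq i false ++ s ++ nseq i false)).
Proof.
pose T v := has (fun a => (a <= v)%N && nth false s (v - a)) (iota 0 i.+1).
have TM v : T v -> (v < size s + i)%N.
  case/hasP=> a; rewrite mem_iota add0n ltnS => lea /andP[leav]; apply: contraTT.
  by rewrite -leqNgt => le; rewrite nth_default //; lia.
have := has_dim_supported TM.
have -> : (\sum_(v < size s + i) T v = size s + i - windows false i (nseq i false ++ s ++ nseq i false))%N.
  set s' := nseq i false ++ s ++ nseq i false.
  have size_s' : size s' = (size s + i + i)%N by rewrite !size_cat !size_nseq; lia.
  have -> : windows false i s' = (\sum_(v < size s + i) ~~ T v)%N.
    rewrite /windows size_s' big_split_ord /= [X in (_ + X)%N]big1 ?addn0 => [|v _]; last first.
      by rewrite ltnNge leq_add2r leq_addr.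
    apply: eq_bigr => v _; rewrite ltn_add2r ltn_ord andTb; congr (nat_of_bool _).
    rewrite /T -all_predC -[LHS]/(all (fun a => nth false s' (v + a) == false) (iota 0 i.+1)).
    apply/allP/allP => H a; rewrite mem_iota add0n ltnS => lea.
      apply/negP => /andP[leav]; apply/negP.
      (* Offset [i - a] in the window of the padded list reads [s] at position [v - a]. *)
      have := H (i - a)%N; rewrite mem_iota add0n ltnS leq_subr => /(_ isT)/eqP.
      rewrite nth_cat size_nseq ltnNge (_ : (i <= v + (i - a))%N) /=; last by lia.
      have -> : (v + (i - a) - i = v - a)%N by lia.
      by rewrite nth_cat; case: ltnP => [_ -> //|le _]; rewrite nth_default.
    rewrite nth_cat size_nseq; case: ltnP => [lt|le]; first by rewrite nth_nseq lt.
    have := H (i - a)%N; rewrite mem_iota add0n ltnS leq_subr => /(_ isT) /=.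
    rewrite negb_and -ltnNge; case: ltnP => [lt|_ /=]; first by lia.
    have -> : (v - (i - a) = v + a - i)%N by lia.
    rewrite nth_cat; case: ltnP => [_ /negbTE -> //|_ _].
    by rewrite nth_nseq; case: ifP.
  have : (\sum_(v < size s + i) T v + \sum_(v < size s + i) ~~ T v = size s + i)%N.
    rewrite -big_split /= (eq_bigr (fun=> 1%N)) => [|v _]; last by case: (T v).
    by rewrite sum1_card card_ord.
  by move: (\sum_(_ < _) _)%N (\sum_(_ < _) _)%N => x y <-; rewrite addnK.
by apply: eq_has_dim => p; rewrite up_mono.
Qed.

End MonomialSpaces.

Lemma points_of_dim (K : fieldType) d j (S : {poly K} -> Prop) :
  @has_dim K ({poly K})^o S d -> (forall p, S p -> (size p <= j.+1)%N) ->
  exists2 N : 'M[K]_(d, j.+1), row_free N & forall p, rowspace N p <-> S p.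
Proof.
move=> [v [Sv vI]] sS; pose N : 'M[K]_(d, j.+1) := \matrix_u poly_rV (v u).
have sv u : (size (v u : {poly K}) <= j.+1)%N.
  by apply: sS; apply/Sv; exists (delta_mx 0 u); rewrite lincomb_delta.
have NE r : rVpoly (r *m N) = lincomb v r.
  rewrite -lincomb_rowspace; apply: eq_bigr => u _.
  by rewrite rowK poly_rV_K.
exists N; last by move=> p; rewrite Sv; split=> -[r ->]; exists r; rewrite NE.
by apply: inj_row_free => r rN; apply: vI; rewrite -NE rN linear0.
Qed.

Lemma exists_stratum_point (L : fieldType) d j n (a b : nat -> nat) c :
  (forall l, (l < n.+1)%N -> (0 < a l)%N) -> (forall s, (s < n)%N -> (0 < b s)%N) ->
  (\sum_(l < n.+1) a l = d)%N -> (\sum_(l < n.+1) a l + \sum_(s < n) b s + c = j.+1)%N ->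
  exists N0 : 'M[L]_(d, j.+1),
    stratum (excess n.+1 a) (fun i => c + excess n b i)%N N0.
Proof.
move=> a_gt0 b_gt0 suma sumab; pose s := blocks n a b c.
have size_s : size s = j.+1 by rewrite size_blocks.
have dnE i := dim_dn_mono L s i; have upE i := dim_up_mono L s i.
have [||N0 N0f N0E] := @points_of_dim L d j (supported (nth false s)).
- rewrite -suma; have := dnE 0%N; rewrite windows_blocks_true // /excess.
  under eq_bigr do rewrite subn0.
  by apply: eq_has_dim => p; apply: dn0.
- move=> p Sp; apply/leq_sizeP => v lev; apply/eqP; rewrite -[_ == _]negbK; apply/negP => /Sp.
  by rewrite nth_default // size_s.
exists N0; split=> // i; split.
  have := dnE i; rewrite windows_blocks_true //; apply: eq_has_dim => p.
  by apply: eq_dn => q; rewrite N0E.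
have := upE i; rewrite size_s addSn -(windows_blocks_false b c i a_gt0) -/s.
(* The list starts with a true, so the left padding is a run of length exactly [i] and contains no
   window of length [i.+1]. *)
have [s' es] : exists s', s = true :: s'.
  have := a_gt0 0%N isT; rewrite /s; case: (n) => [|n'] /=; case: (a 0%N) => // a0 _;
  eexists; reflexivity.
have -> : windows false i (nseq i false ++ s ++ nseq i false) = windows false i (s ++ nseq i false).
  by rewrite es (windows_run false i i) subnn add0n [RHS](windows_skip false i 1).
by apply: eq_has_dim => p; apply: eq_up => q; rewrite N0E.
Qed.

(** * The ancestor ideal *)

Section Dehomogenization.
Variable K : fieldType.

Definition bigrading_var (i : 'I_2) : {poly {poly K}} := if i == ord0 then 'X%:P * 'X else 'X.

(* The coefficient of 'X^n in theta f is the dehomogenization of the degree n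
   component of f: x goes to 'X%:P * 'X and y goes to 'X. *)
Definition theta : {mpoly K[2]} -> {poly {poly K}} :=
  mmap (@polyC {poly K} \o @polyC K) bigrading_var.

HB.instance Definition _ := GRing.RMorphism.copy theta
  (mmap (@polyC {poly K} \o @polyC K) bigrading_var).

Definition mnm2 (v u : nat) : 'X_{1..2} := (U_(ord0) *+ v + U_(ord_max) *+ u)%MM.

Lemma mnm2_0 v u : mnm2 v u ord0 = v.
Proof. by rewrite mnmDE !mulmnE !mnm1E eqxx /= mul1n mul0n addn0. Qed.

Lemma mnm2_1 v u : mnm2 v u ord_max = u.
Proof. by rewrite mnmDE !mulmnE !mnm1E eqxx /= mul1n mul0n. Qed.

Lemma mnm2_eta (m : 'X_{1..2}) : m = mnm2 (m ord0) (m ord_max).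
Proof.
apply/mnmP => i; have [->|->] : i = ord0 \/ i = ord_max.
- by case: i => -[|[|//]] lti; [left|right]; apply: val_inj.
- by rewrite mnm2_0.
by rewrite mnm2_1.
Qed.

Lemma mdeg2 (m : 'X_{1..2}) : mdeg m = (m ord0 + m ord_max)%N.
Proof.
rewrite mdegE big_ord_recl big_ord_recl big_ord0 addn0.
by congr (_ + m _)%N; apply: val_inj.
Qed.

Lemma coef_theta f n v :
  ((theta f)`_n)`_v = if (v <= n)%N then f@_(mnm2 v (n - v)) else 0.
Proof.
have thE (m : 'X_{1..2}) (x : K) : ((x%:P%:P * mmap1 bigrading_var m)`_n)`_v =
    if (n == mdeg m) && (v == m ord0) then x else 0.
  have -> : mmap1 bigrading_var m = ('X^(m ord0))%:P * 'X^(mdeg m).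
    rewrite /mmap1 big_ord_recl big_ord_recl big_ord0 mulr1 /bigrading_var /=.
    rewrite exprMn -rmorphXn -mulrA -exprD mdeg2; congr (_ * 'X^(_ + m _)).
    exact: val_inj.
  rewrite mulrA -polyCM coefCM coefXn; case: eqP => _; last by rewrite mulr0 coef0.
  by rewrite mulr1 coefCM coefXn; case: eqP => _; rewrite ?mulr1 ?mulr0.
rewrite /theta /mmap !coef_sum; under eq_bigr do rewrite thE.
rewrite -big_mkcond /=; case: leqP => [levn|ltnv]; last first.
  rewrite big_seq_cond big_pred0 // => m; apply/negbTE/negP => /and3P[_ /eqP en /eqP ev].
  by move: ltnv; rewrite en ev mdeg2 ltnNge leq_addr.
have eqm (m : 'X_{1..2}) : (n == mdeg m) && (v == m ord0) = (m == mnm2 v (n - v)).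
  apply/andP/eqP => [[/eqP -> /eqP ->]|->].
    by rewrite {1}[m]mnm2_eta mdeg2 addKn.
  by rewrite mdeg2 mnm2_0 mnm2_1 subnKC.
rewrite (eq_bigl _ _ eqm); have [im|nm] := boolP (mnm2 v (n - v) \in msupp f).
  rewrite big_mkcond (bigD1_seq _ im (msupp_uniq f)) /= eqxx big1 ?addr0 // => m.
  by move/negbTE ->.
rewrite (memN_msupp_eq0 nm) big_seq_cond big_pred0 // => m.
by apply/negbTE/negP => /andP[mf /eqP em]; rewrite -em mf in nm.
Qed.

Lemma size_theta f n : (size ((theta f)`_n)%R <= n.+1)%N.
Proof. by apply/leq_sizeP => v ltv; rewrite coef_theta leqNgt ltv. Qed.

Lemma theta_inj : injective theta.
Proof.
move=> f g efg; apply/mpolyP => m; rewrite [m]mnm2_eta.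
have := congr1 (fun p : {poly {poly K}} => (p`_(m ord0 + m ord_max)%N)`_(m ord0)) efg.
by rewrite !coef_theta leq_addr addKn.
Qed.

Lemma theta_homogP f n : reflect (theta f = ((theta f)`_n)%:P * 'X^n) (f \is n.-homog).
Proof.
apply: (iffP idP) => [hf|ef].
  apply/polyP => i; rewrite coefCM coefXn; have [->|ni] := eqVneq i n; first by rewrite mulr1.
  rewrite mulr0; apply/polyP => v; rewrite coef_theta coef0; case: leqP => // levi.
  by apply: (dhomog_nemf_coeff hf); rewrite /= mdeg2 mnm2_0 mnm2_1 subnKC.
apply/dhomogP => m; rewrite mcoeff_msupp => nz; apply/eqP; apply: contraNT nz => /= ndeg.
have := congr1 (fun p : {poly {poly K}} => (p`_(mdeg m))`_(m ord0)) ef.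
rewrite coefCM coefXn (negbTE ndeg) mulr0 coef0 coef_theta mdeg2 leq_addr addKn -mnm2_eta.
by move->.
Qed.

Definition homogenize n (p : {poly K}) : {mpoly K[2]} :=
  \sum_(v < n.+1) p`_v *: 'X_[mnm2 v (n - v)].

Lemma hom_homog n p : homogenize n p \is n.-homog.
Proof.
apply: rpred_sum => v _; apply: dhomogZ; rewrite dhomogX /= mdeg2 mnm2_0 mnm2_1.
by rewrite subnKC // leq_ord.
Qed.

Lemma theta_hom n (p : {poly K}) : (size p <= n.+1)%N -> theta (homogenize n p) = p%:P * 'X^n.
Proof.
move=> sp; rewrite (theta_homogP _ _ (hom_homog n p)); congr (_%:P * _).
apply/polyP => v; rewrite coef_theta; case: leqP => [lev|ltv]; last first.
  by rewrite nth_default // (leq_trans sp).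
rewrite /homogenize raddf_sum /= (bigD1 (Ordinal (lev : (v < n.+1)%N))) //=.
rewrite mcoeffZ mcoeffX eqxx mulr1 big1 ?addr0 // => u.
rewrite -(inj_eq val_inj) /= => nu; rewrite mcoeffZ mcoeffX.
case: eqP => [/(congr1 (fun m : 'X_{1..2} => m ord0))|_]; last by rewrite mulr0.
by rewrite !mnm2_0 => e; rewrite e eqxx in nu.
Qed.

Lemma dehomK f n : f \is n.-homog -> homogenize n ((theta f)`_n) = f.
Proof.
move=> hf; apply: theta_inj; rewrite theta_hom ?size_theta //.
exact/esym/theta_homogP.
Qed.

Lemma homK n (p : {poly K}) : (size p <= n.+1)%N -> (theta (homogenize n p))`_n = p.
Proof. by move=> sp; rewrite theta_hom // coefCM coefXn eqxx mulr1. Qed.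

Lemma homM m n (p q : {poly K}) : (size p <= m.+1)%N -> (size q <= n.+1)%N ->
  homogenize (m + n) (p * q) = homogenize m p * homogenize n q.
Proof.
move=> sp sq; apply: theta_inj; rewrite rmorphM /= !theta_hom //.
  by rewrite polyCM exprD mulrACA.
by rewrite (leq_trans (size_polyMleq _ _)) //; move: sp sq; move: (size p) (size q) => x y; lia.
Qed.

Lemma hom_sum (I : Type) (r : seq I) (P : pred I) n (F : I -> {poly K}) :
  homogenize n (\sum_(i <- r | P i) F i) = \sum_(i <- r | P i) homogenize n (F i).
Proof.
rewrite /homogenize exchange_big /=; apply: eq_bigr => v _.
by rewrite coef_sum scaler_suml.
Qed.

Lemma homZ n c p : homogenize n (c *: p) = c *: homogenize n p.
Proof. by rewrite /homogenize scaler_sumr; apply: eq_bigr => v _; rewrite coefZ scalerA. Qed.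

Lemma hom0 n : homogenize n 0 = 0.
Proof. by rewrite /homogenize big1 // => v _; rewrite coef0 scale0r. Qed.

Lemma hom_partition f N : (size (theta f) <= N)%N -> f = \sum_(n < N) homogenize n ((theta f)`_n).
Proof.
move=> sN; apply: theta_inj; rewrite rmorph_sum /=.
rewrite -[LHS]coefK poly_def (big_ord_widen N (fun n => (theta f)`_n *: 'X^n) sN) big_mkcond /=.
apply: eq_bigr => n _; rewrite theta_hom ?size_theta // -mul_polyC.
by case: ltnP => // le; rewrite nth_default // mul0r.
Qed.

Lemma coef_thetaM m f e n : m \is e.-homog ->
  (theta (f * m))`_n = if (n < e)%N then 0 else (theta f)`_(n - e) * (theta m)`_e.
Proof.
move=> /theta_homogP; move: ((theta m)`_e) => q em.
by rewrite rmorphM /= em mulrA coefMXn coefMC; case: ltnP.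
Qed.

End Dehomogenization.

(** * Spaces of forms as spaces of polynomials in one variable *)

Section VSpaces.
Variable K : fieldType.
Notation pdim := (@has_dim K ({poly K})^o).

Definition form i (p : {poly K}) : dhomog 2 K i := DHomog (hom_homog i p).

Lemma form_sum i (I : Type) (r : seq I) (P : pred I) (c : I -> K) (F : I -> {poly K}) :
  form i (\sum_(l <- r | P l) (c l)%:P * F l) = \sum_(l <- r | P l) c l *: form i (F l).
Proof.
apply: val_inj; rewrite /= hom_sum (raddf_sum (@mpoly_of_dhomog 2 K i)) /=.
by apply: eq_bigr => l _; rewrite mul_polyC homZ.
Qed.

Lemma form_inj i (p q : {poly K}) : (size p <= i.+1)%N -> (size q <= i.+1)%N -> form i p = form i q -> p = q.
Proof.
move=> sp sq e; have := congr1 (fun v => (theta (mpoly_of_dhomog v))`_i) e.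
by rewrite /= !homK.
Qed.

Lemma formK i (v : dhomog 2 K i) : form i ((theta v)`_i) = v.
Proof. by apply: val_inj; rewrite /= dehomK // dhomog_is_dhomog. Qed.

Definition dehom_space i (W : {vspace dhomog 2 K i}) (p : {poly K}) : Prop :=
  (size p <= i.+1)%N /\ in_space W (homogenize i p).

Lemma dehom_spaceP i (W : {vspace dhomog 2 K i}) (p : {poly K}) :
  dehom_space W p <-> (size p <= i.+1)%N /\ form i p \in W.
Proof.
split=> -[sp Wp]; split=> //; last by exists (form i p).
by case: Wp => v Wv ev; rewrite (_ : form i p = v) //; apply: val_inj.
Qed.

Lemma size_lincomb_le i m (v : 'I_m -> ({poly K})^o) r :
  (forall u, (size (v u : {poly K}) <= i)%N) -> (size (lincomb v r : {poly K}) <= i)%N.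
Proof.
move=> sv; apply: leq_trans (size_sum _ _ _) _; apply/bigmax_leqP => u _.
by rewrite scale_regular mul_polyC (leq_trans (size_scale_leq _ _)).
Qed.

Lemma form_lincomb i m (v : 'I_m -> ({poly K})^o) r :
  form i (lincomb v r) = \sum_u r 0 u *: form i (v u).
Proof. exact: form_sum. Qed.

Lemma dehom_space_basis i (W : {vspace dhomog 2 K i}) m (v : 'I_m -> ({poly K})^o)
    (X : m.-tuple (dhomog 2 K i)) :
  basis_of W X -> (forall u, v u = (theta (tnth X u))`_i) ->
  (forall p, dehom_space W p <-> exists r, p = lincomb v r) /\
  (forall r, lincomb v r = 0 -> r = 0).
Proof.
move=> XW vE; have sv u : (size (v u : {poly K}) <= i.+1)%N by rewrite vE size_theta.
have fv u : form i (v u) = tnth X u by rewrite vE formK.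
split=> [p|r].
  rewrite dehom_spaceP; split=> [[sp Wp]|[r ->]]; last first.
    split; first exact: size_lincomb_le.
    rewrite form_lincomb; apply: memv_suml => u _; apply: memvZ.
    by rewrite fv; apply: (basis_mem XW); apply: mem_tnth.
  exists (\row_u coord X u (form i p)); apply: (form_inj sp (size_lincomb_le _ sv)).
  rewrite form_lincomb [LHS](coord_basis XW Wp); apply: eq_bigr => u _.
  by rewrite mxE fv (tnth_nth 0).
move=> r0; apply/rowP => u; rewrite mxE.
have /freeP/(_ (fun u => r 0 u)) := basis_free XW; apply.
rewrite -[RHS](_ : form i (lincomb v r) = 0); last first.
  by apply: val_inj; rewrite r0 /= hom0.
by rewrite form_lincomb; apply: eq_bigr => w _; rewrite fv (tnth_nth 0).
Qed.

Lemma has_dim_dehom i (W : {vspace dhomog 2 K i}) : pdim (dehom_space W) (\dim W).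
Proof.
exists (fun u => (theta (tnth (vbasis W) u))`_i).
exact: (dehom_space_basis (vbasisP W)).
Qed.

Lemma dim_forms i : \dim {: dhomog 2 K i} = i.+1.
Proof.
apply: (@has_dim_uniq K ({poly K})^o _ _ _ (has_dim_dehom fullv)).
have := has_dim_rowspace (1%:M : 'M[K]_i.+1); rewrite mxrank1.
apply: eq_has_dim => p; rewrite dehom_spaceP memvf.
split=> [Np|[sp _]]; first by rewrite (rowspace_size Np).
by apply/rowspaceP; rewrite ?submx1.
Qed.

Lemma vspace_of_dim i (S : {poly K} -> Prop) m : pdim S m ->
  (forall p, S p -> (size p <= i.+1)%N) ->
  exists2 W : {vspace dhomog 2 K i}, \dim W = m & forall p, dehom_space W p <-> S p.
Proof.
move=> [v [Sv vI]] sS; have sv u : (size (v u : {poly K}) <= i.+1)%N.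
  by apply: sS; apply/Sv; exists (delta_mx 0 u); rewrite lincomb_delta.
pose X := [tuple form i (v u) | u < m].
have Xf : free X.
  apply/freeP => c cX u; suff /vI/rowP/(_ u) : lincomb v (\row_u c u) = 0 by rewrite !mxE.
  apply: (form_inj (size_lincomb_le _ sv)); first by rewrite size_poly0.
  rewrite form_lincomb; apply: val_inj; rewrite /= hom0 -[RHS](congr1 val cX).
  by congr val; apply: eq_bigr => w _; rewrite mxE -tnth_nth tnth_mktuple.
exists <<X>>%VS; first by move: Xf; rewrite /free size_tuple => /eqP.
have XW : basis_of <<X>>%VS X by rewrite /basis_of eqxx.
move=> p; rewrite Sv; apply: (proj1 (@dehom_space_basis _ _ _ v X XW _)) => u.
by rewrite tnth_mktuple /= homK.
Qed.

Lemma rowspace_coef_mx d j (V : {vspace dhomog 2 K j}) : \dim V = d ->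
  row_free (coef_mx d V) /\ forall p, rowspace (coef_mx d V) p <-> dehom_space V p.
Proof.
move=> <-; have [VE vI] := dehom_space_basis (vbasisP V) (fun u => erefl).
have cE r : rVpoly (r *m coef_mx (\dim V) V) =
    lincomb (fun u => (theta (tnth (vbasis V) u))`_j : ({poly K})^o) r.
  rewrite -lincomb_rowspace; apply: eq_bigr => u _; rewrite !scale_regular; congr (_ * _).
  apply/polyP => v; rewrite coef_rVpoly coef_theta; case: insubP => [v' ltv <-|].
    by rewrite !mxE (tnth_nth 0) leq_ord.
  by rewrite ltnS => /negbTE ->.
split; last by move=> p; rewrite VE; split=> -[r ->]; exists r; rewrite cE.
by apply: inj_row_free => r rc; apply: vI; rewrite -cE rc linear0.
Qed.

End VSpaces.

Section AncestorIdeal.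
Variables (K : fieldType) (j : nat) (V : {vspace dhomog 2 K j}).
Notation pdim := (@has_dim K ({poly K})^o).
Notation S := (dehom_space V).

(* The degree n piece of the ancestor ideal of S. *)
Definition anc (T : {poly K} -> Prop) n (p : {poly K}) : Prop :=
  if (n <= j)%N then dn T (j - n) p else up T (n - j) p.

Lemma subspace_S : @subspace K ({poly K})^o S.
Proof. exact: has_dim_subspace (has_dim_dehom V). Qed.

Lemma subspace_anc n : @subspace K ({poly K})^o (anc S n).
Proof.
by rewrite /anc; case: (n <= j)%N; [apply: subspace_dn | apply: subspace_up]; apply: subspace_S.
Qed.

Lemma anc0 n : anc S n 0.
Proof. by case: (subspace_anc n). Qed.

Lemma anc_up n p : (j <= n)%N -> anc S n p <-> up S (n - j) p.
Proof.
rewrite /anc => lejn; case: leqP => // lenj; have -> : n = j by lia.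
rewrite subnn; split=> [/(dn0 S) Sp|[v Sv ->]]; last apply/dn0.
  by rewrite -[p]mul1r -(expr0 'X); apply: up_mulXn => //; apply: subspace_S.
by rewrite big_ord1 expr0 mul1r; apply: Sv.
Qed.

Lemma anc_size n p : anc S n p -> (size p <= n.+1)%N.
Proof.
rewrite /anc; case: leqP => [lenj|ltjn] ap.
  have [] := ap _ (leqnn _); have [->|nz] := eqVneq p 0; first by rewrite size_poly0.
  by rewrite mulrC size_mulXn // => sp _; move: sp; move: (size p) => x; lia.
case: ap => v Sv ->; apply: leq_trans (size_sum _ _ _) _; apply/bigmax_leqP => a _.
rewrite (leq_trans (size_polyMleq _ _)) // size_polyXn.
have [sv _] := Sv a (leq_ord a); have := leq_ord a; move: sv.
by move: (size (v a)) => x; lia.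
Qed.

Lemma in_spaceE f : in_space V f -> exists2 p, S p & f = homogenize j p.
Proof.
case=> v Vv ->; exists ((theta v)`_j); last by rewrite dehomK // dhomog_is_dhomog.
by apply/dehom_spaceP; rewrite size_theta formK.
Qed.

Lemma in_space_sum (I : Type) (r : seq I) (P : pred I) (F : I -> {mpoly K[2]}) :
  (forall l, P l -> in_space V (F l)) -> in_space V (\sum_(l <- r | P l) F l).
Proof.
move=> VF; elim/big_rec: _ => [|l f Pl [v Vv ->]]; first by exists 0; rewrite ?mem0v.
by have [u Vu ->] := VF l Pl; exists (u + v); rewrite ?memvD.
Qed.

(** By linearity it is enough to multiply by monomials of degree [i], and these dehomogenize to the
    powers ['X^a] with a at most [i]. *)
Lemma down_hom i (p : {poly K}) : (i <= j)%N -> (size p <= (j - i).+1)%N -> down i V (homogenize (j - i) p) <-> dn S i p.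
Proof.
move=> lei sp; split=> [[_ dV] a lea|dp].
  have sXp : (size ('X^a * p)%R <= j.+1)%N.
    rewrite (leq_trans (size_polyMleq _ _)) // size_polyXn.
    by move: sp; move: (size p) => x; lia.
  split=> //; have := dV (homogenize i 'X^a) (hom_homog _ _); rewrite -homM ?size_polyXn ?ltnS //.
  by rewrite subnKC.
split; first exact: hom_homog.
move=> h hh; rewrite -(dehomK hh) -homM ?size_theta // subnKC //.
set q := (theta h)`_i; have sq : (size q <= i.+1)%N by apply: size_theta.
rewrite -[q](coefK) poly_def mulr_suml hom_sum; apply: in_space_sum => a _.
rewrite -scalerAl homZ; have lea : (a <= i)%N by have := ltn_ord a; lia.
by have [_ [v Vv ->]] := dp a lea; exists (q`_a *: v); rewrite ?memvZ.
Qed.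

Definition generated := ideal_gen (in_space V).

Lemma generatedD f g : generated f -> generated g -> generated (f + g).
Proof.
move=> [n [a [s [Vs ->]]]] [m [b [t [Vt ->]]]].
exists (n + m)%N, (fun i => match split i with inl u => a u | inr u => b u end),
  (fun i => match split i with inl u => s u | inr u => t u end); split.
  by move=> i; case: split.
rewrite big_split_ord /=; congr (_ + _); apply: eq_bigr => i _.
  by rewrite (unsplitK (inl _ i)).
by rewrite (unsplitK (inr _ i)).
Qed.

Lemma generatedM f v : in_space V v -> generated (f * v).
Proof.
by move=> Vv; exists 1%N, (fun=> f), (fun=> v); split=> //; rewrite big_ord1.
Qed.

Lemma generated0 : generated 0.
Proof. by exists 0%N, (fun=> 0), (fun=> 0); split=> [[]|] //; rewrite big_ord0. Qed.

Lemma generated_sum (I : Type) (r : seq I) (P : pred I) (F : I -> {mpoly K[2]}) :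
  (forall l, P l -> generated (F l)) -> generated (\sum_(l <- r | P l) F l).
Proof.
move=> gF; elim/big_rec: _ => [|l f Pl gf]; first exact: generated0.
by apply: generatedD => //; apply: gF.
Qed.

(** Membership is tested degree by degree: the part from degree [j] on comes from the ideal
    generated by V, and each lower degree from its own summand. *)
Lemma ancestorP f : ancestor V f <-> forall n, anc S n ((theta f)`_n).
Proof.
split=> [[g [t [[m [a [s [Vs ->]]]] tP ->]]] n|af].
  rewrite rmorphD /= coefD rmorph_sum rmorph_sum /= !coef_sum.
  apply: (@subspaceD K ({poly K})^o); first exact: subspace_anc.
    apply: (@subspace_sum K ({poly K})^o) => [|u _]; first exact: subspace_anc.
    have [p Sp es] := in_spaceE (Vs u).
    rewrite es (coef_thetaM _ _ (hom_homog j p)); case: ltnP => [_|lejn]; first exact: anc0.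
    rewrite homK ?(proj1 Sp) //; apply/anc_up => //.
    set q := (theta _)`_ _; have sq : (size q <= (n - j).+1)%N by apply: size_theta.
    rewrite -[q](coefK) poly_def mulr_suml.
    apply: (@subspace_sum K ({poly K})^o) => [|e _].
      exact: subspace_up subspace_S.
    rewrite -scalerAl -mul_polyC; apply: (@subspaceZ K ({poly K})^o _ _ ('X^e * p)).
      exact: subspace_up subspace_S.
    apply: up_mulXn; [exact: subspace_S | by have := ltn_ord e; lia | exact: Sp].
  rewrite big_seq; apply: (@subspace_sum K ({poly K})^o) => [|i]; first exact: subspace_anc.
  rewrite mem_index_iota ltnS => leij; have [ht dt] := tP i leij.
  have /theta_homogP -> := ht; rewrite coefCM coefXn.
  case: eqP => [->|_]; last by rewrite mulr0; apply: anc0.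
  case/andP: leij => i0 lei; rewrite mulr1 /anc leq_subr subKn //.
  by apply/down_hom; rewrite ?size_theta ?dehomK //; split.
(* Beyond all the degrees of [f], and beyond [j] so that the sum can be split there. *)
pose N := (size (theta f) + j.+1)%N.
exists (\sum_(j <= n < N) homogenize n ((theta f)`_n)), (fun i => homogenize (j - i) ((theta f)`_(j - i))).
split.
- rewrite big_seq; apply: generated_sum => n; rewrite mem_index_iota => /andP[lejn _].
  have /(anc_up _ lejn)[v Sv ->] := af n; rewrite hom_sum; apply: generated_sum => a _.
  have [sv Vv] := Sv a (leq_ord a); rewrite (_ : homogenize n _ = homogenize (n - j) 'X^a * homogenize j (v a)); first exact: generatedM.
  by rewrite -homM ?subnK // size_polyXn ltnS leq_ord.
- move=> i /andP[i0 lei]; apply/down_hom; rewrite ?size_theta //.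
  by have := af (j - i)%N; rewrite /anc leq_subr subKn.
rewrite [LHS](@hom_partition _ _ N) ?leq_addr // -(big_mkord xpredT (fun n => homogenize n ((theta f)`_n))).
rewrite (@big_cat_nat _ _ _ j) //=; last by rewrite /N; lia.
rewrite addrC; congr (_ + _); rewrite big_nat_rev /= big_add1 /=.
apply: eq_big_nat => i /andP[_ lti]; by rewrite add0n.
Qed.

Lemma ancestor_hom n (p : {poly K}) : (size p <= n.+1)%N -> ancestor V (homogenize n p) <-> anc S n p.
Proof.
move=> sp; rewrite ancestorP; split=> [/(_ n)|ap i]; first by rewrite homK.
rewrite theta_hom // coefCM coefXn; case: eqP => [->|_]; first by rewrite mulr1.
by rewrite mulr0; apply: anc0.
Qed.

Lemma hilbert_quotP H : hilbert_quot (ancestor V) H <->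
  forall n, (H n <= n.+1)%N /\ pdim (anc S n) (n.+1 - H n).
Proof.
split=> [HV n|HV n].
  have [W [WE dimW]] := HV n; rewrite dim_forms in dimW.
  have -> : (n.+1 - H n = \dim W)%N by rewrite -dimW addKn.
  split; first by rewrite -dimW leq_addr.
  apply: eq_has_dim (has_dim_dehom W) => p; rewrite dehom_spaceP; split=> [[sp]|ap].
    by move/WE; rewrite /= ancestor_hom.
  have sp := anc_size ap; split=> //; apply/WE => /=; exact/ancestor_hom.
have [leH dimH] := HV n; have [W dimW WE] := vspace_of_dim dimH (@anc_size n).
exists W; split; last by rewrite dimW dim_forms subnKC.
move=> f; rewrite -[X in ancestor V X](dehomK (dhomog_is_dhomog f)) ancestor_hom ?size_theta //.
rewrite -WE dehom_spaceP size_theta formK.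
by split=> [|[]].
Qed.

End AncestorIdeal.

(** * Minimal resolutions *)

Section WeightedCoefficients.
Variable K : fieldType.

(* The degree m component of an element x of (+)_l R(-G_l). *)
Definition wcoef t (G : 'I_t -> nat) (x : 'cV[{mpoly K[2]}]_t) (m : nat) :
  'rV[{poly K}]_t := \row_l (theta (x l 0) * 'X^(G l))`_m.

Definition wsize t (G : 'I_t -> nat) m (q : 'rV[{poly K}]_t) : Prop :=
  forall l, (size (q 0%R l) <= m.+1 - G l)%N.

Lemma wcoef_size t (G : 'I_t -> nat) x m : wsize G m (wcoef G x m).
Proof.
move=> l; rewrite mxE coefMXn; case: ltnP => [_|leG]; first by rewrite size_poly0.
by rewrite subSn // size_theta.
Qed.

Lemma wcoef_inj t (G : 'I_t -> nat) x y : (forall m, wcoef G x m = wcoef G y m) -> x = y.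
Proof.
move=> exy; apply/colP => l; apply: theta_inj; apply/polyP => n.
have /rowP/(_ l) := exy (n + G l)%N; rewrite !mxE !coefMXn ltnNge leq_addl /= addnK //.
Qed.

Lemma wcoef_0 t (G : 'I_t -> nat) m : wcoef G 0 m = 0.
Proof. by apply/rowP => l; rewrite !mxE rmorph0 mul0r coef0. Qed.

Lemma wcoef_bound t (G : 'I_t -> nat) x : exists N, forall m, (N <= m)%N -> wcoef G x m = 0.
Proof.
exists (\max_l size (theta (x l 0) * 'X^(G l))%R) => m leNm; apply/rowP => l; rewrite !mxE.
by apply: nth_default; apply: leq_trans leNm; apply: (leq_bigmax l).
Qed.

(** Finitely many graded components can be prescribed freely; truncation at [N] keeps the entries
    polynomial. *)
Lemma wcoef_ex t (G : 'I_t -> nat) N (q : nat -> 'rV_t) : (forall m, wsize G m (q m)) ->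
  exists x, forall m, wcoef G x m = if (m < N)%N then q m else 0.
Proof.
move=> sq; exists (\col_l \sum_(m < N) (if (G l <= m)%N then homogenize (m - G l) (q m 0 l) else 0)).
move=> m; apply/rowP => l; rewrite !mxE rmorph_sum mulr_suml.
rewrite (eq_bigr (fun i : 'I_N => q i 0 l *: 'X^i)) => [|i _].
  by rewrite -(poly_def N (fun i => q i 0 l)) coef_poly; case: ifP => _; rewrite ?mxE.
have := sq i l; case: (leqP (G l) i) => [leG|ltG] /=.
  rewrite subSn // => sqi; rewrite theta_hom // -mulrA -exprD subnK // mul_polyC //.
rewrite (_ : (i.+1 - G l = 0)%N); last by apply/eqP; rewrite subn_eq0.
by rewrite leqn0 size_poly_eq0 => /eqP ->; rewrite rmorph0 mul0r scale0r.
Qed.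

Lemma wcoef_single t (G : 'I_t -> nat) m (q : 'rV_t) : wsize G m q ->
  exists x, forall i, wcoef G x i = if i == m then q else 0.
Proof.
move=> sq; have [i|x xE] := @wcoef_ex t G m.+1 (fun i => if i == m then q else 0).
  by case: eqP => [->//|_] l; rewrite mxE size_poly0.
by exists x => i; rewrite xE ltnS; case: eqP => [->|_]; rewrite ?leqnn ?if_same.
Qed.

(* F is homogeneous of degree 0 from (+)_s R(-S_s) to (+)_i R(-G_i), and phi is the
   transpose of its dehomogenization. *)
Definition graded r t (G : 'I_r -> nat) (S : 'I_t -> nat) (F : 'M[{mpoly K[2]}]_(r, t))
    (phi : 'M[{poly K}]_(t, r)) : Prop :=
  forall i s, theta (F i s) * 'X^(G i) = (phi s i)%:P * 'X^(S s).

Lemma graded_wcoef r t (G : 'I_r -> nat) (S : 'I_t -> nat) F phi : graded G S F phi ->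
  forall x m, wcoef G (F *m x) m = wcoef S x m *m phi.
Proof.
move=> Fphi x m; apply/rowP => i; rewrite !mxE rmorph_sum mulr_suml coef_sum.
apply: eq_bigr => s _; rewrite rmorphM /= mxE mulrAC Fphi.
by rewrite -mulrA coefCM mulrC ['X^_ * _]mulrC.
Qed.

Lemma graded_of_homog r t (G : 'I_r -> nat) (S : 'I_t -> nat) (F : 'M[{mpoly K[2]}]_(r, t)) :
  (forall i s, if (G i <= S s)%N then F i s \is (S s - G i)%N.-homog else F i s == 0) ->
  exists phi, graded G S F phi.
Proof.
move=> hF; exists (\matrix_(s, i) (theta (F i s))`_(S s - G i)) => i s; rewrite mxE.
have := hF i s; case: ifP => [leGS /theta_homogP {1}->|_ /eqP ->].
  by rewrite -mulrA -exprD subnK.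
by rewrite rmorph0 coef0 !mul0r.
Qed.

(** Lifts are chosen in each degree and assembled, which is possible because [y] has finitely many
    nonzero components. *)
Lemma graded_image r t (G : 'I_r -> nat) (S : 'I_t -> nat) F phi (y : 'cV_r) : graded G S F phi -> (exists x, y = F *m x) <->
  forall m, exists2 q, wsize S m q & wcoef G y m = q *m phi.
Proof.
move=> Fphi; split=> [[x ->] m|yq]; first by exists (wcoef S x m); [apply: wcoef_size | apply: graded_wcoef].
have [N yN] := wcoef_bound G y.
have [q qP] : exists q : nat -> 'rV_t, forall m, wsize S m (q m) /\
    ((m < N)%N -> wcoef G y m = q m *m phi).
  have [|q qP] := @fin_all_exists 'I_N (fun _ => 'rV_t)
    (fun i q => wsize S i q /\ wcoef G y i = q *m phi).
    by move=> i; have [q] := yq i; exists q.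
  exists (fun m => if @insub nat (fun m => (m < N)%N) 'I_N m is Some i then q i else 0) => m.
  case: insubP => [i ltm <-|/negbTE ->]; first by have [] := qP i.
  by split=> // l; rewrite mxE size_poly0.
have [x xE] := @wcoef_ex t S N q (fun m => proj1 (qP m)).
exists x; apply: (@wcoef_inj _ G) => m; rewrite (graded_wcoef Fphi) xE.
by case: ltnP => [ltm|lem]; [apply: (proj2 (qP m)) | rewrite mul0mx yN].
Qed.

Section Exactness.
Variables (r t u : nat) (G : 'I_r -> nat) (S : 'I_t -> nat) (U : 'I_u -> nat).
Variables (F : 'M[{mpoly K[2]}]_(r, t)) (phi : 'M[{poly K}]_(t, r)).
Variables (M : 'M[{mpoly K[2]}]_(t, u)) (psi : 'M[{poly K}]_(u, t)).
Hypotheses (Fphi : graded G S F phi) (Mpsi : graded S U M psi).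

(** Turns exactness over K[x,y] into exactness in every degree, where bases and dimensions over [K]
    are available. *)
Lemma graded_exact : (forall x : 'cV_t, F *m x = 0 <-> exists b : 'cV_u, x = M *m b) <->
  (forall m (q : 'rV_t), wsize S m q -> (q *m phi = 0 <-> exists2 b, wsize U m b & q = b *m psi)).
Proof.
split=> [ex m q sq|ex x].
  have [x xE] := wcoef_single sq; split=> [q0|[b sb qb]].
    have [|b xb] := (ex x).1.
      apply: (@wcoef_inj _ G) => i; rewrite (graded_wcoef Fphi) xE wcoef_0.
      by case: eqP => // _; rewrite mul0mx.
    exists (wcoef U b m); first exact: wcoef_size.
    by rewrite -(graded_wcoef Mpsi) -xb xE eqxx.
  have [y yE] := wcoef_single sb.
  have Fx : F *m x = 0.
    apply/ex; exists y; apply: (@wcoef_inj _ S) => i; rewrite (graded_wcoef Mpsi) xE yE.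
    by case: eqP => // _; rewrite mul0mx.
  by have := graded_wcoef Fphi x m; rewrite Fx wcoef_0 xE eqxx.
split=> [Fx|[b ->]].
  apply/(graded_image _ Mpsi) => m; apply/ex; first exact: wcoef_size.
  by rewrite -(graded_wcoef Fphi) Fx wcoef_0.
apply: (@wcoef_inj _ G) => m; rewrite (graded_wcoef Fphi) wcoef_0.
apply/ex; first exact: wcoef_size.
by exists (wcoef U b m); [apply: wcoef_size | apply: graded_wcoef].
Qed.

Lemma graded_injective : (forall x : 'cV_t, F *m x = 0 -> x = 0) <->
  (forall m (q : 'rV_t), wsize S m q -> q *m phi = 0 -> q = 0).
Proof.
split=> [inj m q sq q0|inj x Fx]; last first.
  apply: (@wcoef_inj _ S) => m; rewrite wcoef_0; apply: (inj m); first exact: wcoef_size.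
  by rewrite -(graded_wcoef Fphi) Fx wcoef_0.
have [x xE] := wcoef_single sq; have Fx : F *m x = 0.
  apply: (@wcoef_inj _ G) => i; rewrite (graded_wcoef Fphi) xE wcoef_0.
  by case: eqP => // _; rewrite mul0mx.
by have := xE m; rewrite (inj x Fx) wcoef_0 eqxx.
Qed.

End Exactness.

Lemma has_dim_wsize t (G : 'I_t -> nat) m :
  has_dim (wsize G m : 'rV[{poly K}]_t -> Prop) (\sum_l (m.+1 - G l))%N.
Proof.
pose a l := if @insub nat (fun l => (l < t)%N) 'I_t l is Some l' then (m.+1 - G l')%N else 0%N.
have aE (l : 'I_t) : a l = (m.+1 - G l)%N by rewrite /a valK.
rewrite -(eq_bigr _ (fun l _ => aE l)).
apply: eq_has_dim (has_dim_xspan (@indep_unit_row K t a)) => q.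
by rewrite xspan_unit_row; split=> sq l; have := sq l; rewrite ?aE.
Qed.

End WeightedCoefficients.

Section RowForm.
Variables (K : fieldType) (E : lmodType {poly K}).

Lemma row_extension t (q : 'rV[{poly K}]_t) :
  exists2 p : nat -> {poly K}, (forall l : 'I_t, p l = q 0 l) & forall l, (t <= l)%N -> p l = 0.
Proof.
exists (fun l => if @insub nat (fun l => (l < t)%N) 'I_t l is Some l' then q 0 l' else 0) => l.
  by rewrite valK.
by move=> tl; rewrite insubF // ltnNge tl.
Qed.

Lemma xspan_row t (v : nat -> E) (m : nat -> nat) w : xspan t v m w <->
  exists2 q : 'rV[{poly K}]_t, (forall l : 'I_t, (size (q 0%R l) <= m l)%N) &
    w = \sum_(l < t) q 0 l *: v l.
Proof.
split=> [[p sp ->]|[q sq ->]].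
  exists (\row_l p l) => [l|]; first by rewrite mxE sp.
  by apply: eq_bigr => l _; rewrite mxE.
have [p pq _] := row_extension q; exists p => [l ltl|].
  by rewrite (pq (Ordinal ltl)); apply: sq.
by apply: eq_bigr => l _; rewrite pq.
Qed.

Lemma indep_row t (v : nat -> E) (m : nat -> nat) (q : 'rV[{poly K}]_t) :
  indep t v m -> (forall l : 'I_t, (size (q 0%R l) <= m l)%N) ->
  \sum_(l < t) q 0 l *: v l = 0 -> q = 0.
Proof.
move=> vI sq q0; have [p pq _] := row_extension q; apply/rowP => l; rewrite mxE -pq.
apply: (vI p) => // [i lti|]; first by rewrite (pq (Ordinal lti)); apply: sq.
by rewrite -[RHS]q0; apply: eq_bigr => i _; rewrite pq.
Qed.

Lemma eq_xspan_size t (v : nat -> E) (m m' : nat -> nat) w :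
  (forall l, (l < t)%N -> m l = m' l) -> xspan t v m w <-> xspan t v m' w.
Proof.
by move=> em; split=> -[p sp ->]; exists p => // l ltl; rewrite ?em ?sp // -em ?sp.
Qed.

End RowForm.

Lemma homog_coef0 (K : fieldType) e (f : {mpoly K[2]}) : f \is e.-homog -> (0 < e)%N ->
  f@_0%MM = 0.
Proof. by move=> hf e0; apply: (dhomog_nemf_coeff hf); rewrite /= mdeg0 eq_sym -lt0n. Qed.

Section Resolution.
Variables (K : fieldType) (j : nat) (V : {vspace dhomog 2 K j}).
Notation pdim := (@has_dim K ({poly K})^o).
Notation S := (dehom_space V).

(* minimal_resolution for shifts listed by functions, which leaves the ranks
   of the free modules as variables. *)
Definition min_res (I : {mpoly K[2]} -> Prop) t u (G T : nat -> nat) : Prop :=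
  exists (g : 'rV[{mpoly K[2]}]_t) (M : 'M[{mpoly K[2]}]_(t, u)),
  [/\ (forall i : 'I_t, g 0 i \is (G i).-homog) /\
      (forall (i : 'I_t) (s : 'I_u),
                   if (G i <= T s)%N then M i s \is (T s - G i)%N.-homog else M i s == 0),
      forall f, I f <-> exists a : 'cV_t, f = (g *m a) 0 0,
      forall a : 'cV_t, g *m a = 0 <-> exists b : 'cV_u, a = M *m b,
      forall b : 'cV_u, M *m b = 0 -> b = 0
    & (forall i, (g 0 i)@_0%MM = 0) /\ (forall i s, (M i s)@_0%MM = 0)].

Lemma image_ancestor t (G : 'I_t -> nat) (g : 'rV[{mpoly K[2]}]_t) (phi : 'M[{poly K}]_(t, 1)) :
  graded (fun=> 0%N) G g phi ->
  (forall f, ancestor V f <-> exists a : 'cV_t, f = (g *m a) 0 0) <->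
  (forall m p, anc j S m p <-> exists2 q, wsize G m q & p = \sum_l q 0 l * phi l 0).
Proof.
move=> gphi; pose y (f : {mpoly K[2]}) : 'cV_1 := const_mx f.
have yE f m q : wcoef (fun=> 0%N) (y f) m = q *m phi <-> (theta f)`_m = \sum_l q 0 l * phi l 0.
  split=> [/rowP/(_ 0)|e]; first by rewrite !mxE expr0 mulr1.
  by apply/rowP => i; rewrite !mxE expr0 mulr1 e; apply: eq_bigr => l _; rewrite (ord1 i).
have imE f : (exists a : 'cV_t, f = (g *m a) 0 0) <-> forall m, exists2 q, wsize G m q &
    (theta f)`_m = \sum_l q 0 l * phi l 0.
  have -> : (exists a : 'cV_t, f = (g *m a) 0 0) <-> (exists a : 'cV_t, y f = g *m a).
    split=> -[a ea]; exists a; last by rewrite -ea mxE.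
    by apply/colP => i; rewrite mxE (ord1 i).
  rewrite (graded_image _ gphi); split=> yq m; have [q sq qE] := yq m; exists q => //; exact/yE.
split=> [VE m p|VE f]; last first.
  rewrite imE ancestorP; split=> H m; first exact/VE.
  by apply/VE; apply: H.
split=> [ap|[q sq ->]].
  have sp := anc_size ap; have /VE/imE/(_ m) : ancestor V (homogenize m p) by apply/ancestor_hom.
  by rewrite homK.
have [x xE] := wcoef_single sq; pose f := (g *m x) 0 0.
have yf : y f = g *m x by apply/colP => i; rewrite mxE (ord1 i).
have /yE <- : wcoef (fun=> 0%N) (y f) m = q *m phi by rewrite yf (graded_wcoef gphi) xE eqxx.
by apply: (proj1 (ancestorP V f)); apply/VE; exists x.
Qed.

Section Exists.
Variables (n c : nat) (a b : nat -> nat).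
Hypothesis a_gt0 : forall l, (l < n.+1)%N -> (0 < a l)%N.
Hypothesis le_a : forall l, (l < n.+1)%N -> (a l <= j)%N.
Hypothesis sum_ab : (\sum_(l < n.+1) a l + \sum_(s < n) b s + c = j.+1)%N.
Hypothesis dnE : forall i, pdim (dn S i) (excess n.+1 a i).
Hypothesis upE : forall i, pdim (up S i) ((j + i).+1 - (c + excess n b i)).

(** The bases of generators and syzygies, homogenized. Minimality is a matter of degrees: the
    generators have degree [j.+1 - a l > 0], and the matrix entries degree [a l + b s > 0]. *)
Lemma min_res_exists :
  min_res (ancestor V) n.+1 n (fun l => j.+1 - a l)%N (fun s => j.+1 + b s)%N.
Proof.
have [f [C [Pf Uf Cf]]] := free_resolution a_gt0 sum_ab dnE upE.
pose G l := (j.+1 - a l)%N; pose T s := (j.+1 + b s)%N.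
(* The generator belongs to R_{-i}V for [i = (a l).-1], whose degree is [j.+1 - a l]. *)
have sf l : (l < n.+1)%N -> (size (f l) <= (G l).+1)%N.
  move=> ltl; have a0 := a_gt0 ltl; have aj := le_a ltl.
  have [] := Pf (a l).-1; first by lia.
  move=> /(_ (f l))[_ dnf] _; have /dnf df : xspan n.+1 (f : nat -> ({poly K})^o) (fun l' => a l' - (a l).-1)%N (f l).
    have := @xspan_X K ({poly K})^o n.+1 f (fun l' => a l' - (a l).-1)%N l 0%N ltl.
    by rewrite scale_regular expr0 mul1r; apply; lia.
  have /anc_size : anc j S (G l) (f l).
    by rewrite /anc /G ifT; [rewrite (_ : (j - (j.+1 - a l) = (a l).-1)%N) //; lia | lia].
  by [].
have sC s (l : 'I_n.+1) : (s < n)%N -> (size (C s 0%R l) <= (a l + b s).+1)%N.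
  move=> lts; have [/(_ (C s))[_ Cs] _] := Cf (b s).+1.
  have [|sCs _] := Cs; last by have := sCs l; rewrite addnS.
  by rewrite -[C s]scale1r -(expr0 'X); apply: xspan_X; rewrite ?subSnn.
pose g : 'rV[{mpoly K[2]}]_n.+1 := \row_l homogenize (G l) (f l).
pose M : 'M[{mpoly K[2]}]_(n.+1, n) := \matrix_(l, s) homogenize (T s - G l) (C s 0 l).
pose phi : 'M[{poly K}]_(n.+1, 1) := \col_l f l.
pose psi : 'M[{poly K}]_(n, n.+1) := \matrix_(s, l) C s 0 l.
have GT (l : 'I_n.+1) (s : 'I_n) : (T s - G l = a l + b s)%N.
  by have := le_a (ltn_ord l); rewrite /T /G; lia.
have gphi : graded (fun=> 0%N) (fun l : 'I_n.+1 => G l) g phi.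
  by move=> i l; rewrite !mxE expr0 mulr1 theta_hom ?sf.
have Mpsi : graded (fun l : 'I_n.+1 => G l) (fun s : 'I_n => T s) M psi.
  move=> l s; rewrite !mxE theta_hom ?GT ?sC // -mulrA -exprD; congr (_ * 'X^_).
  by have := le_a (ltn_ord l); rewrite /T /G; lia.
have phiE (q : 'rV_n.+1) i : (q *m phi) 0 i = \sum_l q 0 l * f l.
  by rewrite mxE; apply: eq_bigr => l _; rewrite mxE.
have psiE (q : 'rV_n) : q *m psi = \sum_s q 0 s *: C s.
  by apply/rowP => l; rewrite mxE summxE; apply: eq_bigr => s _; rewrite !mxE.
have ancE m p : anc j S m p <-> exists2 q : 'rV_n.+1, wsize (fun l : 'I_n.+1 => G l) m q &
    p = \sum_l q 0 l * phi l 0.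
  have -> : (exists2 q : 'rV_n.+1, wsize (fun l : 'I_n.+1 => G l) m q & p = \sum_l q 0 l * phi l 0)
      <-> xspan n.+1 (f : nat -> ({poly K})^o) (fun l => m.+1 - G l)%N p.
    rewrite xspan_row; split=> -[q sq ->]; exists q => //; apply: eq_bigr => l _;
    by rewrite mxE.
  rewrite /anc; case: leqP => [lemj|ltjm].
    have [|dE _] := Pf (j - m)%N; first by lia.
    by rewrite dE; apply: eq_xspan_size => l ltl; have := le_a ltl; rewrite /G; lia.
  by rewrite Uf; apply: eq_xspan_size => l ltl; have := le_a ltl; rewrite /G; lia.
exists g, M; split.
- split=> [i|i s]; first by rewrite mxE hom_homog.
  by rewrite leq_subLR mxE hom_homog ifT //; lia.
- exact/(image_ancestor gphi).
- apply/(graded_exact gphi Mpsi) => m q sq.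
  (* All relations have degree at least [j.+1], so below [j] exactness is the independence of the
     generators. *)
  have small (b0 : 'rV[{poly K}]_n) : (m < j)%N -> wsize (fun s : 'I_n => T s) m b0 -> b0 = 0.
    move=> ltm sb; apply/rowP => s; have := sb s; rewrite mxE /T.
    by rewrite (_ : (m.+1 - (j.+1 + b s) = 0)%N) ?leqn0 ?size_poly_eq0 => [/eqP|]; last lia.
  have q0E : q *m phi = 0 <-> \sum_l q 0 l * f l = 0.
    by split=> [/rowP/(_ 0)|e]; [rewrite phiE mxE | apply/rowP => i; rewrite phiE e mxE].
  rewrite q0E; case: (ltnP m j) => [ltm|lem].
    split=> [e|[b0 sb ->]]; last first.
      rewrite (small b0) // mul0mx; apply: big1 => l _; by rewrite mxE mul0r.
    exists 0; first by move=> s; rewrite mxE size_poly0.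
    rewrite mul0mx; have [|_ fI] := Pf (j - m)%N; first by lia.
    apply: (indep_row fI) => // l; apply: leq_trans (sq l) _.
    by have := le_a (ltn_ord l); rewrite /G; lia.
  have [/(_ q) CE _] := Cf (m - j)%N.
  have -> : (\sum_l q 0 l * f l = 0) <-> syzygy f a (m - j) q.
    split=> [e|[]] //; split=> // l; apply: leq_trans (sq l) _.
    by have := le_a (ltn_ord l); rewrite /G; lia.
  rewrite CE xspan_row; split=> -[b0 sb bE]; exists b0; rewrite ?bE ?psiE // => s.
    by apply: leq_trans (sb s) _; rewrite /T; lia.
  by apply: leq_trans (sb s) _; rewrite /T; lia.
- apply/(graded_injective Mpsi) => m q sq; rewrite psiE => q0.
  have [_ CI] := Cf (m - j)%N; apply: (indep_row CI) => // s; apply: leq_trans (sq s) _.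
  by rewrite /T; lia.
split=> [i|i s]; rewrite mxE; first apply: (homog_coef0 (hom_homog _ _)).
  by have := le_a (ltn_ord i); rewrite /G; lia.
by apply: (homog_coef0 (hom_homog _ _)); rewrite GT; have := a_gt0 (ltn_ord i); lia.
Qed.
End Exists.

Lemma has_dim_zero (E : lmodType {poly K}) (P : E -> Prop) : (forall w, P w <-> w = 0) -> has_dim P 0.
Proof.
move=> P0; exists (fun=> 0); split=> [w|r _]; last by apply/rowP => -[].
by rewrite P0 /lincomb; split=> [->|[r ->]]; [exists 0|]; rewrite big_ord0.
Qed.

(** Exactness in each degree makes the dimension an alternating sum of the ranks, so the shifts
    determine the Hilbert function. *)
Lemma min_res_dims t u G T : min_res (ancestor V) t u G T -> forall m,
  (\sum_(s < u) (m.+1 - T s) <= \sum_(l < t) (m.+1 - G l))%N /\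
  pdim (anc j S m) (\sum_(l < t) (m.+1 - G l) - \sum_(s < u) (m.+1 - T s)).
Proof.
move=> [g [M [[hg hM] VE ex inj _]]] m.
have [phi gphi] : exists phi, graded (fun=> 0%N) (fun l : 'I_t => G l) g phi.
  by apply: graded_of_homog => i l; rewrite leq0n subn0 (ord1 i).
have [psi Mpsi] := graded_of_homog hM.
move/(image_ancestor gphi): VE => ancE.
have /(_ m) kerE := proj1 (graded_exact gphi Mpsi) ex.
have /(_ m) injE := proj1 (graded_injective Mpsi) inj.
have psiL : klinear (fun q : 'rV[{poly K}]_u => q *m psi).
  by move=> a q r; rewrite mulmxDl scalemxAl.
have phiL : klinear (fun q : 'rV[{poly K}]_t => (\sum_l q 0 l * phi l 0 : ({poly K})^o)).
  move=> a q r; rewrite scaler_sumr -big_split /=; apply: eq_bigr => l _.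
  by rewrite !mxE mulrDl [X in _ = X + _]mulrA.
have [|_ dimI] := rank_nullity psiL (has_dim_wsize K (fun s : 'I_u => T s) m) (m := 0).
  apply: has_dim_zero => q; split=> [[sq q0]|->]; first exact: injE.
  by split=> [s|]; rewrite ?mul0mx // mxE size_poly0.
rewrite subn0 in dimI.
have phiE (q : 'rV[{poly K}]_t) : q *m phi = 0 <-> \sum_l q 0 l * phi l 0 = 0.
  split=> [/rowP/(_ 0)|e]; first by rewrite !mxE.
  by apply/rowP => i; rewrite (ord1 i) !mxE.
have [|leI dimA] := rank_nullity phiL (has_dim_wsize K (fun l : 'I_t => G l) m) (m := (\sum_(s < u) (m.+1 - T s))%N).
  apply: eq_has_dim dimI => q; split=> [[b sb qb]|[sq /phiE q0]]; last exact/kerE.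
  have sq : wsize (fun l : 'I_t => G l) m q.
    by rewrite qb; have [y yE] := wcoef_single sb; move: (graded_wcoef Mpsi y m);
    rewrite yE eqxx => <-; apply: wcoef_size.
  by split=> //; apply/phiE/kerE => //; exists b.
split=> //; apply: eq_has_dim dimA => p; rewrite ancE.
by split=> -[q sq ->]; exists q.
Qed.

(* A generator of degree 0 would vanish by minimality, and the corresponding
   basis vector would be a relation with an entry outside (x,y). *)
Lemma min_res_pos t u G T : min_res (ancestor V) t u G T -> forall l, (l < t)%N -> (0 < G l)%N.
Proof.
move=> [g [M [[hg _] _ ex _ [g0 M0]]]] l ltl; rewrite lt0n; apply/eqP => Gl0.
pose l' := Ordinal ltl; have gl0 : g 0 l' = 0.
  have := hg l'; rewrite /= Gl0 => h0; apply/mpolyP => m; rewrite mcoeff0.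
  have [->|nz] := eqVneq m 0%MM; first exact: g0.
  by apply: (dhomog_nemf_coeff h0); rewrite /= mdeg_eq0.
have [b eb] : exists b : 'cV_u, delta_mx l' 0 = M *m b.
  apply/ex; apply/colP => i; rewrite (ord1 i) !mxE big1 // => s _; rewrite mxE.
  by case: eqP => [->|_]; rewrite ?gl0 ?mul0r ?mulr0.
have := congr1 (fun x : 'cV_t => (x l' 0)@_0%MM) eb; rewrite !mxE !eqxx mcoeff1 eqxx.
rewrite raddf_sum big1 /= => [/eqP|s _]; first by rewrite oner_eq0.
by rewrite rmorphM /= M0 mul0r.
Qed.

End Resolution.

(** * Partitions and acceptable sequences *)

Import Num.Theory.
Local Close Scope ring_scope.

Lemma nth_partition_gt0 D i : is_partition D -> (0 < nth 0 D i) = (i < size D).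
Proof.
case/andP=> _ D0; case: (ltnP i (size D)) => [lti|?]; last by rewrite nth_default.
by rewrite lt0n; apply: contraNneq D0 => <-; rewrite mem_nth.
Qed.

Lemma nth_partition_le D i : is_partition D -> nth 0 D i.+1 <= nth 0 D i.
Proof.
case/andP=> sD _; case: (ltnP i.+1 (size D)) => [lti|?]; last by rewrite nth_default.
by move/(sortedP 0): sD => /(_ i lti).
Qed.

Lemma nth_partition_anti D i m : is_partition D -> i <= m -> nth 0 D m <= nth 0 D i.
Proof.
move=> pD /subnK <-; elim: (m - i) => // k IH.
by apply: leq_trans IH; rewrite addSn nth_partition_le.
Qed.

Lemma is_partitionP D : (forall i, nth 0 D i.+1 <= nth 0 D i) ->
  (forall i, i < size D -> 0 < nth 0 D i) -> is_partition D.
Proof.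
move=> Dle D0; apply/andP; split; first by apply/(sortedP 0) => i _; apply: Dle.
by apply/negP => /(nthP 0)[i lti] Di; have := D0 i lti; rewrite Di.
Qed.

Lemma eq_partition D D' : is_partition D -> is_partition D' ->
  (forall i, nth 0 D i = nth 0 D' i) -> D = D'.
Proof.
move=> pD pD' eD; apply: (@eq_from_nth _ 0) => [|i _]; last exact: eD.
have lt_size i : (i < size D) = (i < size D') by rewrite -!nth_partition_gt0 ?eD.
apply/eqP; rewrite eqn_leq leqNgt lt_size ltnn /= leqNgt.
by rewrite -lt_size ltnn.
Qed.

Lemma sumn_drop D i : sumn (drop i D) = nth 0 D i + sumn (drop i.+1 D).
Proof.
case: (ltnP i (size D)) => [lti|lei]; first by rewrite (drop_nth 0).
by rewrite nth_default // !drop_oversize // ltnW.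
Qed.

Lemma sumn_take_drop D i : sumn (take i D) + sumn (drop i D) = sumn D.
Proof. by rewrite -sumn_cat cat_take_drop. Qed.

Lemma sumn_take_le D i m : i <= m -> sumn (take i D) <= sumn (take m D).
Proof. by move=> leim; rewrite -(subnKC leim) takeD sumn_cat leq_addr. Qed.

(** Beyond the length of the shorter partition the inequality follows from the comparison of the
    totals, or from monotonicity of the partial sums of [D'] once [D] is exhausted. *)
Lemma maj_leP D D' : maj_le D D' <-> forall i, sumn (take i D) <= sumn (take i D').
Proof.
split=> [[leS leT] i|leT].
  have [/leT //|] := boolP (1 <= i <= minn (size D) (size D')).
  case: i => [|i]; first by rewrite !take0.
  rewrite leq_min /= negb_and -!ltnNge => /orP[lti|lti]; last first.
    rewrite [in leqRHS]take_oversize; last by rewrite ltnW.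
    by apply: leq_trans leS; rewrite -(sumn_take_drop D i.+1) leq_addr.
  case: (leqP (size D) (size D')) => [leD|/ltnW geD]; last first.
    rewrite [in leqRHS]take_oversize; last by rewrite ltnW // (leq_ltn_trans geD).
    by apply: leq_trans leS; rewrite -(sumn_take_drop D i.+1) leq_addr.
  rewrite take_oversize; last by rewrite ltnW.
  have [/size0nil ->//|D0] := posnP (size D).
  apply: (@leq_trans (sumn (take (size D) D'))); last by apply: sumn_take_le; rewrite ltnW.
  by rewrite -{1}(take_size D); apply: leT; rewrite D0 leq_min leqnn.
split=> [|i _]; last exact: leT.
have := leT (maxn (size D) (size D')).
by rewrite !take_oversize ?leq_maxl ?leq_maxr.
Qed.

Lemma nth_conj_partition D i : is_partition D ->
  nth 0 (conj_partition D) i = count (fun x => i < x) D.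
Proof.
move=> pD; rewrite /conj_partition; case: (ltnP i (head 0 D)) => [lti|lei].
  by rewrite (nth_map 0) ?size_iota // nth_iota.
rewrite nth_default ?size_map ?size_iota //; apply/esym/eqP; rewrite -leqn0 leqNgt -has_count.
apply/hasPn => x /(nthP 0)[m ltm <-]; rewrite -leqNgt.
by apply: leq_trans (nth_partition_anti pD (leq0n m)) _; rewrite nth0.
Qed.

Lemma size_conj_partition D : size (conj_partition D) = head 0 D.
Proof. by rewrite size_map size_iota. Qed.

Lemma ltn_count_partition D i m : is_partition D ->
  (i < count (fun x => m < x) D) = (m < nth 0 D i).
Proof.
elim: D i => [|x D IH] i; first by rewrite nth_nil.
move=> pxD; have pD : is_partition D.
  case/andP: pxD => sD D0; rewrite /is_partition (path_sorted sD).
  by move: D0; rewrite inE negb_or => /andP[_ ->].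
case: i => [|i] /=; last first.
  case: (ltnP m x) => [ltmx|lexm]; first by rewrite add1n ltnS IH.
  rewrite add0n; have c0 y : y < count (fun x => m < x) D = false.
    rewrite IH //; apply/negbTE; rewrite -leqNgt; apply: leq_trans lexm.
    exact: (nth_partition_anti pxD (leq0n y.+1)).
  by rewrite c0 -IH // c0.
case: (ltnP m x) => // lexm; rewrite add0n IH //; apply/negbTE; rewrite -leqNgt.
by apply: leq_trans lexm; apply: (nth_partition_anti pxD (leq0n 1)).
Qed.

Lemma conj_is_partition D : is_partition D -> is_partition (conj_partition D).
Proof.
move=> pD; apply: is_partitionP => i.
  by rewrite !nth_conj_partition //; apply: sub_count => x /= /ltnW.
rewrite size_conj_partition nth_conj_partition // => lti.
by rewrite ltn_count_partition // nth0.
Qed.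

(** Conjugation is an involution, in the form needed for the recursion on [excess]. *)
Lemma count_gt_conj D i : is_partition D ->
  count_gt (size (conj_partition D)) (nth 0 (conj_partition D)) i = nth 0 D i.
Proof.
move=> pD; rewrite size_conj_partition /count_gt.
under eq_bigr => l _ do rewrite nth_conj_partition // ltn_count_partition //.
rewrite -(big_mkord xpredT (fun l => (l < nth 0 D i) : nat)).
rewrite (@big_cat_nat _ _ _ (nth 0 D i)) //=; last first.
  by rewrite -nth0 nth_partition_anti.
rewrite (@eq_big_nat _ _ _ 0 (nth 0 D i) _ (fun=> 1)) => [|l /andP[_ ->]] //.
rewrite (@eq_big_nat _ _ _ (nth 0 D i) _ _ (fun=> 0)) => [|l /andP[lel _]]; last by rewrite ltnNge lel.
by rewrite !sum_nat_const_nat muln1 muln0 subn0 addn0.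
Qed.

(** Both sides satisfy the same recursion and vanish for large arguments. *)
Lemma excess_sumn_drop n a D : (forall i, count_gt n a i = nth 0 D i) ->
  forall i, excess n a i = sumn (drop i D).
Proof.
move=> aD; have [N aN] := excess_eventually0 n a; move=> i.
have [k] : exists k, N + size D <= i + k by exists (N + size D); rewrite leq_addl.
elim: k i => [|k IH] i.
  rewrite addn0 => lei; rewrite aN ?drop_oversize //; apply: leq_trans lei.
    by rewrite leq_addl.
  by rewrite leq_addr.
by rewrite addnS -addSn => /IH eS; rewrite excess_rec eS aD addnC -sumn_drop.
Qed.

Lemma excess_conj D i : is_partition D ->
  excess (size (conj_partition D)) (nth 0 (conj_partition D)) i = sumn (drop i D).
Proof. by move=> pD; apply: excess_sumn_drop => m; apply: count_gt_conj. Qed.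

Lemma conj_of_count_gt D E : is_partition D -> is_partition E ->
  (forall i, count_gt (size E) (nth 0 E) i = nth 0 D i) -> D = conj_partition E.
Proof.
move=> pD pE DE; apply: eq_partition => // [|i]; first exact: conj_is_partition.
rewrite -DE nth_conj_partition // /count_gt -(big_mkord xpredT (fun l => (i < nth 0 E l) : nat)).
rewrite -sum1_count [RHS]big_mkcond [RHS](big_nth 0); apply: eq_bigr => l _; by case: ltnP.
Qed.

(* H is recovered from P = P(H) and Q = Q(H) by summing the differences e_i on either side
   of j. *)
Definition profile (d j : nat) (P Q : seq nat) (H : nat -> nat) : Prop :=
  [/\ PA d j (P, Q), forall i, i <= j -> H i + sumn (drop (j - i) P) = i.+1
    & forall m, H (j + m) + sumn Q = j.+1 - d + sumn (drop m Q)].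

(** A telescoping sum; the convention e_0 = -1 makes its first term zero, in accordance with H_0 =
    1. *)
Lemma sum_ediff (H : nat -> nat) mu n : proper_Oseq H mu ->
  (\sum_(0 <= i < n.+1) (ediff H i + 1) = n.+1%:Z - (H n)%:Z)%R.
Proof.
case=> mu0 Hlt _ _; elim: n => [|n IH]; first by rewrite big_nat1 (Hlt 0) //; lia.
by rewrite big_nat_recr //= IH; lia.
Qed.

Lemma sum_ediff_tail (H : nat -> nat) (j n : nat) : (\sum_(j.+1 <= i < (j.+1 + n)%N) ediff H i = (H j)%:Z - (H (j + n)%N)%:Z)%R.
Proof.
elim: n => [|n IH]; first by rewrite !addn0 big_geq // subrr.
by rewrite addnS big_nat_recr ?leq_addr //= IH addSn addnS; lia.
Qed.

(** * From acceptable sequences to partitions *)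

Section Acceptable.
Variables (d j : nat) (H : nat -> nat).
Hypotheses (d_gt0 : 0 < d) (le_dj : d <= j).

Hypothesis accH : acceptable d j H.

Lemma acceptable_order : exists2 mu, mu <= j & proper_Oseq H mu /\ order_upto j H = mu.
Proof.
have [mu [c [pH evH eH [sumH _] _]]] := accH.
have [mu0 Hlt Hmu Hle] := pH.
have Hj := sum_ediff j pH; rewrite sumH in Hj.
(* If [j < mu] then [H j = j.+1], and the sum equal to [d] would be 0. *)
have lemu : mu <= j by rewrite leqNgt; apply/negP => ltj; have := Hlt j ltj; lia.
exists mu => //; split=> //; rewrite /order_upto.
rewrite (_ : j.+1 = mu + (j.+1 - mu)); last by lia.
rewrite iotaD find_cat; case: ifP => [/hasP[i]|_].
  by rewrite mem_iota => /andP[_ lti]; rewrite Hlt // ltnn.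
rewrite size_iota subSn //= add0n Hmu addn0 //.
Qed.

Lemma acceptable_Hj : H j = j.+1 - d.
Proof.
have [mu [c [pH _ _ [sumH _] _]]] := accH.
by have := sum_ediff j pH; rewrite sumH; lia.
Qed.

(** The default 0 past the end of [Ppart] is the right value, because e_i = -1 for i below the
    order. *)
Lemma nth_Ppart m : m <= j -> Posz (nth 0 (Ppart j H) m) = (ediff H (j - m) + 1)%R.
Proof.
move=> lemj; have [mu lemu [[mu0 Hlt Hmu Hle] ordmu]] := acceptable_order.
have [_ [_ [_ _ [eH _] _ _]]] := accH.
rewrite /Ppart ordmu; set n := j.+1 - mu.
have sz : size (rev (iota mu n)) = n by rewrite size_rev size_iota.
case: (ltnP m n) => [ltm|lem].
  rewrite (nth_map 0) ?sz // nth_rev ?size_iota // nth_iota; last by lia.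
  rewrite (_ : mu + (n - m.+1) = j - m); last by rewrite /n; lia.
  suff : (-1 <= ediff H (j - m))%R by lia.
  have : j - m <= j by lia.
  elim: (j - m) => [|i IH] lei //; apply: le_trans (IH _) (eH i _); lia.
rewrite nth_default ?size_map ?sz //; have: j - m < mu by rewrite /n in lem; lia.
case: (j - m) => [|i] lti //=; rewrite !Hlt //; lia.
Qed.

Lemma nth_Ppart_out m : j < m -> nth 0 (Ppart j H) m = 0.
Proof.
move=> ltm; rewrite nth_default // size_map size_rev size_iota; lia.
Qed.

(** The nonzero values of a nonincreasing function form an initial segment, so filtering does not
    shift positions; beyond it the default 0 agrees with the function. *)
Lemma nonzero_prefix (f : nat -> nat) s N m : (forall i, f i.+1 <= f i) -> f (s + N) = 0 ->
  nth 0 [seq f i | i <- iota s N & f i != 0] m = f (s + m).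
Proof.
move=> fle; have fanti i k : f (i + k) <= f i.
  by elim: k => [|k IH]; rewrite ?addn0 // addnS (leq_trans (fle _)).
elim: N s m => [|N IH] s m fN.
  rewrite nth_nil; apply/esym/eqP; rewrite -leqn0 -fN addn0; exact: fanti.
rewrite addnS -addSn in fN; have {IH}IH := IH s.+1 _ fN.
rewrite /=; case: eqP => [f0|_] /=.
  by rewrite IH addSn; apply/eqP; have := fanti s m; have := fanti s m.+1; rewrite f0 addnS; lia.
by case: m => [|m]; rewrite /= ?addn0 // IH addSn addnS.
Qed.

Lemma nth_Qpart m : Posz (nth 0 (Qpart j H) m) = ediff H (j.+1 + m).
Proof.
have [mu lemu [[mu0 Hlt Hmu Hle] ordmu]] := acceptable_order.
have [_ [_ [_ _ [_ eH] _ _]]] := accH.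
(* The truncated subtraction makes [f] constant up to [j.+1], hence nonincreasing on all natural
   numbers. *)
pose f i := H (j + (i - j.+1)) - H (j + (i - j.+1)).+1.
have fE i : Posz (f i) = ediff H (j.+1 + (i - j.+1)).
  by rewrite addSn /= /f; have := Hle (j + (i - j.+1)); lia.
have -> : Qpart j H = [seq f i | i <- iota j.+1 (H j) & f i != 0].
  have fi i : i \in iota j.+1 (H j) -> ediff H i = Posz (f i).
    by rewrite mem_iota => /andP[lei _]; rewrite fE subnKC.
  rewrite /Qpart (@eq_in_filter _ _ (fun i => f i != 0)) => [|i /fi ->] //.
  by apply/eq_in_map => i; rewrite mem_filter => /andP[_ /fi ->].
have fle i : f i.+1 <= f i.
  rewrite -lez_nat !fE; case: (ltnP i j.+1) => [lti|lei].
    have -> : i.+1 - j.+1 = 0 by lia.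
    have -> : i - j.+1 = 0 by lia.
    exact: lexx.
  have -> : j.+1 + (i.+1 - j.+1) = i.+1 by lia.
  have -> : j.+1 + (i - j.+1) = i by lia.
  by apply: eH; lia.
rewrite nonzero_prefix // ?fE; first by congr (ediff H _); lia.
(* The sequence cannot drop by at least one in each of [(H j).+1] consecutive steps starting from
   [H j]; so [f] vanishes after [H j] terms. *)
have bound n : n <= (H j).+1 -> H (j + n) + n * f (j.+1 + H j) <= H j.
  elim: n => [|n IH] len; first by rewrite addn0 mul0n addn0.
  have fn : f (j.+1 + H j) <= f (j.+1 + n).
    rewrite -(subnKC (_ : n <= H j)) //; elim: (H j - n) => [|k IHk]; first by rewrite addn0.
    by rewrite !addnA; apply: leq_trans IHk; rewrite !addnS addnA; apply: fle.
  have := IH (ltnW len); move: fn; rewrite {2}/f addKn mulSn addnS.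
  by have := Hle (j + n); move: (f _) (n * _) => x y; lia.
have := bound (H j).+1 (leqnn _); case: (f _) => // x; rewrite mulnS; lia.
Qed.

Lemma acceptable_shape : profile d j (Ppart j H) (Qpart j H) H.
Proof.
have [mu lemu [[mu0 Hlt Hmu Hle] ordmu]] := acceptable_order.
have [mu' [c [_ [N HN] [eH eH'] _ [ej ejS _]]]] := accH.
have Hj := acceptable_Hj.
have Plow i : i <= j -> H i + sumn (drop (j - i) (Ppart j H)) = i.+1.
  elim: i => [|i IH] lei.
    rewrite subn0 sumn_drop; have := nth_Ppart (leqnn j); rewrite subnn /=.
    rewrite drop_oversize; last by rewrite size_map size_rev size_iota; lia.
    by rewrite (Hlt 0) //=; lia.
  rewrite sumn_drop (_ : (j - i.+1).+1 = j - i); last by lia.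
  have := @nth_Ppart (j - i.+1) (leq_subr _ _); rewrite subKn //=.
  by have := IH (ltnW lei); lia.
have Qhigh m : H (j + m) + sumn (Qpart j H) = j.+1 - d + sumn (drop m (Qpart j H)).
  elim: m => [|m IH]; first by rewrite addn0 drop0 Hj.
  have := nth_Qpart m; rewrite addSn addnS /=; move: IH; rewrite sumn_drop; lia.
split=> //; split=> /=.
- apply: is_partitionP => i.
    case: (ltnP i j) => [lti|lei]; last by rewrite nth_Ppart_out.
    rewrite -lez_nat !nth_Ppart //; last exact: ltnW.
    by have -> : j - i = (j - i.+1).+1; [lia | rewrite lerD2r; apply: eH; lia].
  rewrite size_map size_rev size_iota ordmu => lti.
  rewrite -ltz_nat nth_Ppart; last by lia.
  (* At the order, H drops from [mu] to at most [mu], so e is nonnegative there; it stays so up to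
     [j] by monotonicity, and the parts e + 1 are positive. *)
  have : mu <= j - i <= j by lia.
  case/andP=> lemi leij; suff : (0 <= ediff H (j - i))%R by lia.
  rewrite -(subnKC lemi) in leij *; elim: (j - i - mu) leij => [|k IH] lek.
    rewrite addn0; case: mu mu0 Hlt Hmu {lemu ordmu Hle lemi lti lek} => // mu _ Hlt Hmu.
    by rewrite /= Hlt //; lia.
  rewrite addnS in lek *; apply: le_trans (IH (ltnW lek)) (eH _ (ltnW lek)).
- have := Plow j (leqnn j); rewrite subnn drop0 Hj; lia.
- apply: is_partitionP => i.
    by rewrite -lez_nat !nth_Qpart addnS; apply: eH'; lia.
  move=> /(mem_nth 0); set x := nth _ _ _; case/mapP => i'; rewrite mem_filter => /andP[ne _] ->.
  by rewrite absz_gt0.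
- have := Qhigh (size (Qpart j H)); rewrite drop_size addn0 => <-; exact: leq_addl.
rewrite -!nth0; have := nth_Qpart 0; have := nth_Ppart (leq0n j); rewrite subn0 addn0 -ejS.
by move: (ediff H j) => e; lia.
Qed.

End Acceptable.

Lemma size_le_sumn D : 0 \notin D -> size D <= sumn D.
Proof.
elim: D => //= x D IH; rewrite inE negb_or => /andP[x0 /IH].
by case: x x0 => // x _; rewrite addSn ltnS => leD; rewrite (leq_trans leD) ?leq_addl.
Qed.

Lemma size_partition_le D : is_partition D -> size D <= sumn D.
Proof. by case/andP=> _; apply: size_le_sumn. Qed.

Lemma sumn_drop_partition D m : is_partition D -> sumn (drop m D) <= sumn D - m.
Proof.
move=> /andP[_ D0]; case: (leqP (size D) m) => [lem|ltm]; first by rewrite drop_oversize.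
have /size_le_sumn : 0 \notin take m D by apply: contra D0; apply: mem_take.
by rewrite size_takel ?(ltnW ltm) // -(sumn_take_drop D m); lia.
Qed.

(** * From partitions to acceptable sequences *)

Section Shape.
Variables (d j : nat).
Hypotheses (d_gt0 : 0 < d) (le_dj : d <= j).

Section Converse.
Variables (P Q : seq nat) (H : nat -> nat).
Hypothesis shH : profile d j P Q H.

Lemma shape_size : size P <= j.
Proof. by have [[pP sP _ _ _] _ _] := shH; have := size_partition_le pP; simpl in *; lia. Qed.

Lemma shape_ediff_low i : i <= j -> ediff H i = (Posz (nth 0%N P (j - i)) - 1)%R.
Proof.
have [[/= pP sP pQ sQ hPQ] Plow Qhigh] := shH.
case: i => [|i] lei; first by rewrite subn0 nth_default ?shape_size.
have := Plow i.+1 lei; have := Plow i (ltnW lei); rewrite (sumn_drop _ (j - i.+1)).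
by rewrite subnSK //= => e1 e2; lia.
Qed.

Lemma shape_ediff_high m : ediff H (j.+1 + m) = Posz (nth 0 Q m).
Proof.
have [[/= pP sP pQ sQ hPQ] Plow Qhigh] := shH.
have := Qhigh m.+1; have := Qhigh m; rewrite (sumn_drop _ m) addSn addnS /=; lia.
Qed.

Lemma shape_acceptable : acceptable d j H.
Proof.
have [[/= pP sP pQ sQ hPQ] Plow Qhigh] := shH; have sizeP := shape_size.
have P0 : 0 < size P by rewrite lt0n; apply/eqP => /size0nil P0; rewrite P0 /= in sP; lia.
(* [H i = i.+1] as long as the tail [drop (j - i) P] is empty, which fixes the order. *)
have pmu : proper_Oseq H (j.+1 - size P).
  split=> [|i lti||i lei]; first by lia.
  - by have := Plow i; rewrite drop_oversize /=; lia.
  - have := Plow (j.+1 - size P); rewrite sumn_drop; have := nth_partition_gt0 (j - (j.+1 - size P)) pP.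
    by rewrite (_ : _ - _ < size P); [move: (nth _ _ _) => x; lia | lia].
  case: (ltnP i j) => [ltij|leji].
    have := shape_ediff_low ltij; have := nth_partition_gt0 (j - i.+1) pP.
    by rewrite (_ : _ - _ < size P) /=; [move: (nth _ _ _) => x; lia | lia].
  by have := shape_ediff_high (i - j); rewrite addSn subnKC //=; lia.
exists (j.+1 - size P), (j.+1 - d - sumn Q).
have Hj : H j = j.+1 - d by have := Plow j (leqnn j); rewrite subnn drop0; lia.
have limH m : size Q <= m -> H (j + m) = j.+1 - d - sumn Q.
  by move=> lem; have := Qhigh m; rewrite (drop_oversize lem) /=; lia.
split=> //.
- exists (j + size Q) => n len; rewrite -(subnKC (_ : j <= n)); last by lia.
  by apply: limH; lia.
- split=> i leij; last first.
    have -> : i.+1 = j.+1 + (i - j) by lia.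
    (* At [i = j] both monotonicity conditions hold with equality: the relation between the largest
       parts says e_j = e_{j+1}. *)
    case: (ltnP j i) => [ltji|leij']; last first.
      have -> : i = j by lia.
      rewrite subnn shape_ediff_high shape_ediff_low // subnn nth0 nth0 hPQ; lia.
    have {2}-> : i = j.+1 + (i - j).-1 by lia.
    rewrite !shape_ediff_high lez_nat; have -> : i - j = (i - j).-1.+1 by lia.
    exact: nth_partition_le.
  case: (ltnP i j) => [ltij|leji]; last first.
    have -> : i = j by lia.
    rewrite -[j.+1]addn0 shape_ediff_high shape_ediff_low // subnn nth0 nth0 hPQ; lia.
  rewrite !shape_ediff_low // lerD2r lez_nat (_ : j - i = (j - i.+1).+1); last by lia.
  exact: nth_partition_le.
- split; first by rewrite (sum_ediff j pmu) Hj; lia.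
  exists (j.+1 + size Q) => n len; rewrite -(subnKC (_ : j.+1 <= n)); last by lia.
  rewrite sum_ediff_tail limH; last by lia.
  by rewrite Hj; lia.
have ej : ediff H j = Posz (head 0 Q) by rewrite shape_ediff_low // subnn nth0 hPQ; lia.
have leP : head 0 P <= d.
  by rewrite -sP -[sumn P](congr1 sumn (drop0 P)) sumn_drop nth0 leq_addr.
have leQ : head 0 Q <= sumn Q by rewrite -[sumn Q](congr1 sumn (drop0 Q)) sumn_drop nth0 leq_addr.
rewrite ej -[j.+1]addn0 shape_ediff_high nth0; split=> //.
by rewrite le_min; apply/andP; split; lia.
Qed.

Lemma shape_uniq P' Q' : profile d j P' Q' H -> P' = P /\ Q' = Q.
Proof.
move=> sh'; have [[/= pP sP pQ sQ hPQ] Plow Qhigh] := shH.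
have [[/= pP' sP' pQ' sQ' hPQ'] Plow' Qhigh'] := sh'.
have dP i : sumn (drop i P') = sumn (drop i P).
  case: (leqP i j) => [lei|lti].
    by have := Plow (j - i) (leq_subr _ _); have := Plow' (j - i) (leq_subr _ _); rewrite subKn //; lia.
  have := size_partition_le pP; have := size_partition_le pP' => s1 s2.
  rewrite !drop_oversize //; lia.
have nth_eq D D' : (forall i, sumn (drop i D') = sumn (drop i D)) -> forall i, nth 0 D' i = nth 0 D i.
  by move=> dD i; have := dD i; rewrite 2!(sumn_drop _ i) dD; lia.
split; apply: eq_partition => //; apply: nth_eq => // i.
have e1 m : sumn Q + sumn (drop m Q') = sumn Q' + sumn (drop m Q).
  by have := Qhigh m; have := Qhigh' m; lia.
(* [H] gives only differences of tails of [Q]; an index beyond both lengths recovers the total. *)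
have e2 : sumn Q = sumn Q'.
  by have := e1 (size Q + size Q'); rewrite !drop_oversize ?leq_addl ?leq_addr //= !addn0.
by have := e1 i; lia.
Qed.

End Converse.

Lemma shape_ex P Q : PA d j (P, Q) -> exists H, profile d j P Q H.
Proof.
move=> PAPQ; have [/= pP sP pQ sQ hPQ] := PAPQ.
exists (fun i => if i <= j then i.+1 - sumn (drop (j - i) P)
  else (j.+1 - d - sumn Q) + sumn (drop (i - j) Q)).
have sizeP := size_partition_le pP.
split=> // [i lei|m].
  rewrite lei subnK //.
  by have := sumn_drop_partition (j - i) pP; lia.
case: m => [|m]; first by rewrite addn0 leqnn subnn !drop0 sP; lia.
by rewrite (_ : (j + m.+1 <= j) = false) ?addKn; [lia | apply/negbTE; rewrite -ltnNge; lia].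
Qed.

(** The common total [d] turns tails of [P] into initial sums. On the other side [H (j + m)] is
    [j.+1 - d] minus an initial sum of [Q], so different totals of [Q] and [Q'] cause no
    difficulty. *)
Lemma P_ge_shape P Q H P' Q' H' : profile d j P Q H -> profile d j P' Q' H' ->
  P_ge j H' H <-> PA_le (P', Q') (P, Q).
Proof.
move=> [[/= pP sP pQ sQ hPQ] Plow Qhigh] [[/= pP' sP' pQ' sQ' hPQ'] Plow' Qhigh'].
rewrite /PA_le /= !maj_leP; split=> [[leH geH]|[leP leQ]]; split=> i.
- have sizeP := size_partition_le pP; have sizeP' := size_partition_le pP'.
  have := sumn_take_drop P i; have := sumn_take_drop P' i.
  case: (leqP i j) => [lei|lti]; last by rewrite !drop_oversize //=; lia.
  have := Plow (j - i) (leq_subr _ _); have := Plow' (j - i) (leq_subr _ _).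
  have := leH (j - i) (leq_subr _ _); rewrite subKn //; lia.
- have := sumn_take_drop Q i; have := sumn_take_drop Q' i.
  have := Qhigh i; have := Qhigh' i; have := geH (j + i) (leq_addr _ _); lia.
- move=> lei; have := Plow i lei; have := Plow' i lei; have := leP (j - i).
  have := sumn_take_drop P (j - i); have := sumn_take_drop P' (j - i); lia.
move=> lei; rewrite -(subnKC lei); move: (i - j) => m.
have := Qhigh m; have := Qhigh' m; have := leQ m.
have := sumn_take_drop Q m; have := sumn_take_drop Q' m; lia.
Qed.

End Shape.

(** * The strata *)

Section Strata.
Variables (d j : nat).
Hypotheses (d_gt0 : 0 < d) (le_dj : d <= j).

Definition gens (P : seq nat) : nat -> nat := nth 0 (conj_partition P).
Definition tail_dim (Q : seq nat) : nat := j.+1 - d - sumn Q.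
Definition dn_dims (P : seq nat) : nat -> nat :=
  excess (size (conj_partition P)) (gens P).
Definition up_dims (Q : seq nat) (i : nat) : nat :=
  tail_dim Q + excess (size (conj_partition Q)) (gens Q) i.

Section OneShape.
Variables (P Q : seq nat) (H : nat -> nat).
Hypothesis shH : profile d j P Q H.

Lemma shape_size_conj : size (conj_partition P) = (size (conj_partition Q)).+1.
Proof. by have [[_ _ _ _ hPQ] _ _] := shH; rewrite !size_conj_partition. Qed.

Lemma shape_gens_gt0 l : l < size (conj_partition P) -> 0 < gens P l.
Proof.
by have [[pP _ _ _ _] _ _] := shH; rewrite nth_partition_gt0 //; apply: conj_is_partition.
Qed.

Lemma shape_relations_gt0 l : l < size (conj_partition Q) -> 0 < gens Q l.
Proof.
by have [[_ _ pQ _ _] _ _] := shH; rewrite nth_partition_gt0 //; apply: conj_is_partition.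
Qed.

Lemma shape_dn_dims i : dn_dims P i = sumn (drop i P).
Proof. by have [[pP _ _ _ _] _ _] := shH; apply: excess_conj. Qed.

Lemma shape_up_dims i : up_dims Q i = H (j + i).
Proof.
have [[/= _ _ pQ sQ _] _ Qhigh] := shH; rewrite /up_dims excess_conj // /tail_dim.
by have := Qhigh i; lia.
Qed.

Lemma sum_excess0 n (a : nat -> nat) : \sum_(l < n) a l = excess n a 0.
Proof. by apply: eq_bigr => l _; rewrite subn0. Qed.

Lemma shape_sum_gens : \sum_(l < size (conj_partition P)) gens P l = d.
Proof.
by have [[/= pP sP _ _ _] _ _] := shH; rewrite sum_excess0 excess_conj // drop0.
Qed.

Lemma shape_sum : \sum_(l < size (conj_partition P)) gens P l +
  \sum_(s < size (conj_partition Q)) gens Q s + tail_dim Q = j.+1.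
Proof.
have [[/= _ _ pQ sQ _] _ _] := shH; rewrite shape_sum_gens sum_excess0 excess_conj // drop0.
by rewrite /tail_dim; lia.
Qed.

Lemma shape_gens_le l : l < size (conj_partition P) -> gens P l <= j.
Proof.
move=> ltl; apply: leq_trans le_dj; rewrite -shape_sum_gens (bigD1 (Ordinal ltl)) //=.
exact: leq_addr.
Qed.

Variable K : fieldType.
Implicit Type V : {vspace dhomog 2 K j}.
Notation pdim := (@has_dim K ({poly K})^o).

Definition space_stratum V : Prop := forall i,
  pdim (dn (dehom_space V) i) (dn_dims P i) /\
  pdim (up (dehom_space V) i) ((j + i).+1 - up_dims Q i).

Lemma has_dim_dn_big V i : j < i -> pdim (dn (dehom_space V) i) 0.
Proof.
move=> ltji; apply: has_dim_zero => p; split=> [dp|-> a _]; last first.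
  by rewrite mulr0; case: (subspace_S V).
have [] := dp i (leqnn i); have [//|nz] := eqVneq p 0%R.
by rewrite mulrC size_mulXn // => sp _; move: nz; rewrite -size_poly_gt0; move: sp; move: (size p) => x; lia.
Qed.

Lemma GrassP V : Grass d H V <-> \dim V = d /\ space_stratum V.
Proof.
have [[/= pP sP pQ sQ hPQ] Plow Qhigh] := shH.
have leH n : H n <= n.+1.
  case: (leqP n j) => [/Plow|ltj]; first by lia.
  by have := Qhigh (n - j); rewrite subnKC ?(ltnW ltj) //; have := sumn_take_drop Q (n - j); lia.
have upE i : pdim (up (dehom_space V) i) ((j + i).+1 - up_dims Q i) <->
    pdim (anc j (dehom_space V) (j + i)) ((j + i).+1 - H (j + i)).
  rewrite shape_up_dims; split; apply: eq_has_dim => p;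
    by rewrite anc_up ?leq_addr // addKn.
have dnE i : i <= j -> pdim (dn (dehom_space V) i) (dn_dims P i) <->
    pdim (anc j (dehom_space V) (j - i)) ((j - i).+1 - H (j - i)).
  move=> lei; rewrite shape_dn_dims (_ : (j - i).+1 - _ = sumn (drop i P)); last first.
    by have := Plow (j - i) (leq_subr _ _); rewrite subKn //; lia.
  by split; apply: eq_has_dim => p; rewrite /anc leq_subr subKn.
split=> -[dimV HV]; split=> //.
  move/hilbert_quotP: HV => HV i; split; last by apply/upE; have [] := HV (j + i).
  case: (leqP i j) => [lei|lti]; first by apply/dnE => //; have [] := HV (j - i).
  rewrite shape_dn_dims drop_oversize; first exact: has_dim_dn_big.
  by have := shape_size d_gt0 le_dj shH; lia.
apply/hilbert_quotP => n; split=> //; case: (leqP n j) => [len|/ltnW lejn].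
  by have [/dnE] := HV (j - n); rewrite subKn // leq_subr => /(_ isT).
by have [_ /upE] := HV (n - j); rewrite subnKC.
Qed.

Lemma stratum_coef_mx V : \dim V = d ->
  stratum (dn_dims P) (up_dims Q) (coef_mx d V) <-> space_stratum V.
Proof.
move=> dimV; have [Vf VE] := rowspace_coef_mx dimV.
split=> [[_ VS] i|VS]; last split=> // i.
  have [dV uV] := VS i; split.
    by apply: eq_has_dim dV => p; apply: eq_dn.
  by apply: eq_has_dim uV => p; apply: eq_up.
have [dV uV] := VS i; split.
  by apply: eq_has_dim dV => p; apply: eq_dn => q; rewrite VE.
by apply: eq_has_dim uV => p; apply: eq_up => q; rewrite VE.
Qed.

Lemma vspace_of_stratum (N : 'M[K]_(d, j.+1)) : stratum (dn_dims P) (up_dims Q) N ->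
  exists2 V : {vspace dhomog 2 K j}, Grass d H V & forall p, rowspace N p <-> rowspace (coef_mx d V) p.
Proof.
move=> [Nf NS]; have dimN := has_dim_rowspace N; rewrite (eqP Nf) in dimN.
have [V dimV VE] := vspace_of_dim dimN (fun p Np => rowspace_size Np).
have [_ cE] := rowspace_coef_mx dimV.
exists V => [|p]; last by rewrite cE VE.
apply/GrassP; split=> // i; have [dN uN] := NS i; split.
  by apply: eq_has_dim dN => p; apply: eq_dn => q; rewrite VE.
by apply: eq_has_dim uN => p; apply: eq_up => q; rewrite VE.
Qed.

Lemma shape_stratum_point : exists N : 'M[K]_(d, j.+1), stratum (dn_dims P) (up_dims Q) N.
Proof.
rewrite /dn_dims /up_dims shape_size_conj; apply: exists_stratum_point.
- by rewrite -shape_size_conj; apply: shape_gens_gt0.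
- exact: shape_relations_gt0.
- by rewrite -shape_size_conj shape_sum_gens.
by rewrite -shape_size_conj shape_sum.
Qed.

Lemma Grass_nonempty : exists V : {vspace dhomog 2 K j}, Grass d H V.
Proof. by have [N /vspace_of_stratum[V]] := shape_stratum_point; exists V. Qed.

End OneShape.

(** The matrix of a stored basis may differ from a given matrix with the same row space, so the two
    notions of closure are compared through [eq_rowspace_cl]. *)
Lemma in_closureP P Q H (k K : fieldType) (emb : {rmorphism k -> K})
    (V : {vspace dhomog 2 K j}) : profile d j P Q H ->
  in_closure d H emb V <->
  \dim V = d /\ cl (stratum (dn_dims P) (up_dims Q)) emb (coef_mx d V).
Proof.
move=> shH; split=> -[dimV clV]; split=> // D F hF F0.
  apply: (clV D F hF) => L lam U /(GrassP shH)[dimU SU].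
  by apply: F0; apply/stratum_coef_mx.
pose X : point_class d j := fun L N => exists2 U : {vspace dhomog 2 L j}, Grass d H U & N = coef_mx d U.
apply: (@cl_trans d j k (stratum (dn_dims P) (up_dims Q)) X K emb _ _ clV D F hF) => [L lam N SN|L lam N [U GU ->]]; last exact: F0.
have [U GU UE] := vspace_of_stratum shH SN; have [Nf _] := SN.
by apply: (eq_rowspace_cl Nf UE); apply: cl_refl; exists U.
Qed.

End Strata.

Lemma eq_min_res (K : fieldType) (I : {mpoly K[2]} -> Prop) t u G T G' T' :
  (forall l, l < t -> G l = G' l) -> (forall s, s < u -> T s = T' s) ->
  min_res I t u G T -> min_res I t u G' T'.
Proof.
move=> eG eT [g [M [[hg hM] ? ? ? ?]]]; exists g, M; split=> //; split=> [i|i s].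
  by rewrite -eG.
by rewrite -eG // -eT //; apply: hM.
Qed.

Section Resolutions.
Variables (k : fieldType) (d j : nat) (P Q : seq nat) (H : nat -> nat).
Hypotheses (d_gt0 : 0 < d) (le_dj : d <= j) (shH : profile d j P Q H).

Lemma shape_ediff_j : ediff H j = Posz (head 0 Q).
Proof.
have [[/= _ _ _ _ hPQ] _ _] := shH.
by rewrite (shape_ediff_low d_gt0 le_dj shH) // subnn nth0 hPQ; lia.
Qed.

Lemma AB_conj : AB_partitions k d j H (conj_partition P) (conj_partition Q).
Proof.
have [[/= pP sP pQ sQ hPQ] Plow Qhigh] := shH.
split; try exact: conj_is_partition.
- by rewrite size_conj_partition shape_ediff_j hPQ; lia.
- by rewrite size_conj_partition shape_ediff_j.
move=> V /(GrassP d_gt0 le_dj shH)[dimV HV].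
have sc := shape_size_conj shH.
have res : min_res (ancestor V) (size (conj_partition Q)).+1 (size (conj_partition Q))
    (fun l => j.+1 - gens P l) (fun s => j.+1 + gens Q s).
  apply: (@min_res_exists _ _ _ _ (tail_dim d j Q)) => [l|l||i|i].
  - by rewrite -sc; apply: (shape_gens_gt0 shH).
  - by rewrite -sc; apply: (shape_gens_le le_dj shH).
  - by rewrite -sc; apply: (shape_sum d_gt0 le_dj shH).
  - by rewrite -sc; have [] := HV i.
  by have [] := HV i.
rewrite -sc in res; change (min_res (ancestor V) (size [seq j.+1 - a | a <- conj_partition P])
  (size [seq j.+1 + b | b <- conj_partition Q]) (nth 0 [seq j.+1 - a | a <- conj_partition P])
  (nth 0 [seq j.+1 + b | b <- conj_partition Q])).
rewrite (size_map (fun a => j.+1 - a)) (size_map (addn j.+1)).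
by apply: (eq_min_res _ _ res) => l ltl; rewrite (nth_map 0).
Qed.

(** A point of the stratum over [k] exists, so its resolution computes [H] from the shifts: degrees
    up to [j] involve only the generators and determine A, and the higher degrees then determine
    B. *)
Lemma AB_uniq A B : AB_partitions k d j H A B -> P = conj_partition A /\ Q = conj_partition B.
Proof.
have [[/= pP sP pQ sQ hPQ] Plow Qhigh] := shH.
case=> pA pB sA sB AB; have [V GV] := @Grass_nonempty _ _ d_gt0 le_dj _ _ _ shH k.
have := AB V GV; set G := map _ A; set T := map _ B => res0.
have {res0} res : min_res (ancestor V) (size A) (size B) (nth 0 G) (nth 0 T).
  by rewrite -(size_map (fun a => j.+1 - a) A) -(size_map (addn j.+1) B).
have GE l : l < size A -> nth 0 G l = j.+1 - nth 0 A l by move=> ltl; rewrite (nth_map 0).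
have TE s : s < size B -> nth 0 T s = j.+1 + nth 0 B s by move=> lts; rewrite (nth_map 0).
(* Generators have positive degree, so the subtraction [j.+1 - a] did not truncate. *)
have leA l : l < size A -> nth 0 A l <= j.
  by move=> ltl; have := min_res_pos res ltl; rewrite GE //; lia.
have sAB : size A = (size B).+1 by lia.
have [_ /hilbert_quotP HV] := GV.
have dimE m : m.+1 - H m = \sum_(l < size A) (m.+1 - nth 0 G l) - \sum_(s < size B) (m.+1 - nth 0 T s).
  have [_ dimV] := min_res_dims res m; have [_ dimV'] := HV m.
  exact: has_dim_uniq dimV' dimV.
have exA i : excess (size A) (nth 0 A) i = sumn (drop i P).
  case: (leqP i j) => [lei|lti]; last first.
    rewrite drop_oversize /=; last by have := shape_size d_gt0 le_dj shH; lia.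
    by apply: big1 => l _; have := leA l (ltn_ord l); lia.
  have := dimE (j - i); have := Plow (j - i) (leq_subr _ _); rewrite subKn // => e1.
  rewrite [X in _ = _ - X]big1 ?subn0 => [e2|s _]; last by rewrite TE //; lia.
  transitivity ((j - i).+1 - H (j - i)); last by lia.
  rewrite e2; apply: eq_bigr => l _; rewrite GE //.
  by have := leA l (ltn_ord l); lia.
have sumA : \sum_(l < size A) nth 0 A l = d.
  by rewrite (sum_excess0 (size A)) exA drop0.
have exB i : \sum_(s < size B) nth 0 B s + sumn (drop i Q) = sumn Q + excess (size B) (nth 0 B) i.
  have [leTG _] := min_res_dims res (j + i).
  have := dimE (j + i); have [leH _] := HV (j + i).
  have sumG : \sum_(l < size A) ((j + i).+1 - nth 0 G l) = d + size A * i.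
    rewrite -sumA (_ : size A * i = \sum_(l < size A) i) -?big_split /=; last by rewrite sum_nat_const card_ord.
    by apply: eq_bigr => l _; rewrite GE //; have := leA l (ltn_ord l); lia.
  have sumT : \sum_(s < size B) ((j + i).+1 - nth 0 T s) + \sum_(s < size B) nth 0 B s =
      size B * i + excess (size B) (nth 0 B) i.
    rewrite (_ : size B * i = \sum_(s < size B) i) -?big_split /=; last by rewrite sum_nat_const card_ord.
    by apply: eq_bigr => s _; rewrite TE //; lia.
  move: leTG sumT; rewrite sumG sAB mulSn.
  by have := Qhigh i; lia.
have sumB : \sum_(s < size B) nth 0 B s = sumn Q.
  have [N0 N0P] := excess_eventually0 (size B) (nth 0 B).
  have := exB (N0 + size Q); rewrite N0P ?leq_addr // drop_oversize ?leq_addl //=; lia.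
split; apply: conj_of_count_gt => // i.
  by have := excess_rec (size A) (nth 0 A) i; rewrite !exA sumn_drop; lia.
have := excess_rec (size B) (nth 0 B) i; have := exB i; have := exB i.+1.
by rewrite sumB (sumn_drop Q i); lia.
Qed.

End Resolutions.

Section Specialization.
Variables (d j : nat) (P Q P' Q' : seq nat) (H H' : nat -> nat).
Hypotheses (d_gt0 : 0 < d) (le_dj : d <= j).
Hypotheses (shH : profile d j P Q H) (shH' : profile d j P' Q' H').

Lemma P_ge_dims : P_ge j H' H <->
  (forall i, dn_dims P i <= dn_dims P' i) /\ (forall i, up_dims d j Q i <= up_dims d j Q' i).
Proof.
have [[/= pP sP pQ sQ hPQ] Plow Qhigh] := shH.
have [[/= pP' sP' pQ' sQ' hPQ'] Plow' Qhigh'] := shH'.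
have sz := shape_size d_gt0 le_dj shH; have sz' := shape_size d_gt0 le_dj shH'.
have dE := shape_dn_dims shH; have dE' := shape_dn_dims shH'.
have uE := shape_up_dims d_gt0 le_dj shH; have uE' := shape_up_dims d_gt0 le_dj shH'.
split=> [[leH geH]|[leP leQ]]; split=> i.
- rewrite dE dE'; case: (leqP i j) => [lei|lti]; last by rewrite !drop_oversize //; lia.
  have := Plow (j - i) (leq_subr _ _); have := Plow' (j - i) (leq_subr _ _).
  by have := leH (j - i) (leq_subr _ _); rewrite subKn //; lia.
- by rewrite uE uE'; apply: geH; apply: leq_addr.
- by move=> lei; have := Plow i lei; have := Plow' i lei; have := leP (j - i); rewrite dE dE'; lia.
by move=> lei; have := leQ (i - j); rewrite uE uE' subnKC.
Qed.

Lemma P_ge_closure (k : fieldType) : P_ge j H' H -> stratum_in_closure k d j H' H.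
Proof.
move=> geH K emb V /(GrassP d_gt0 le_dj shH')[dimV SV].
apply/(in_closureP d_gt0 le_dj emb V shH); split=> //.
have /P_ge_dims[leP leQ] := geH.
have sc := shape_size_conj shH; have sc' := shape_size_conj shH'.
have SV' : stratum (dn_dims P') (up_dims d j Q') (coef_mx d V) by apply/stratum_coef_mx.
have [[/= pP sP pQ sQ hPQ] Plow Qhigh] := shH.
have [[/= pP' sP' pQ' sQ' hPQ'] Plow' Qhigh'] := shH'.
(* The special point has at most as many relations as a point of the larger stratum, so padding goes
   in the right direction. *)
have leQ' : head 0 Q' <= head 0 Q.
  have /(P_ge_shape d_gt0 le_dj shH shH')[_ /maj_leP/(_ 1)] := geH.
  by case: (Q) => [|x s]; case: (Q') => [|y s'] //=; rewrite !take0 /= !addn0.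
move: SV' leP leQ; rewrite /dn_dims /up_dims sc sc' => SV' leP leQ.
apply: (@stratum_cl _ _ _ _ _ _ (size (conj_partition Q)) (size (conj_partition Q'))
  (gens P) (gens Q) (gens P') (gens Q') (tail_dim d j Q) (tail_dim d j Q')) => //.
- by rewrite !size_conj_partition.
- by rewrite -sc; apply: (shape_gens_gt0 shH).
- by rewrite -sc'; apply: (shape_gens_gt0 shH').
- by rewrite -sc'; apply: (shape_sum d_gt0 le_dj shH').
- rewrite -sc -sc'; have := shape_dn_dims shH 0; have := shape_dn_dims shH' 0.
  by rewrite /dn_dims !drop0 sP sP' => -> ->.
- have := shape_up_dims d_gt0 le_dj shH 0; have := shape_up_dims d_gt0 le_dj shH' 0; rewrite /up_dims => -> ->.
  by have := Qhigh 0; have := Qhigh' 0; rewrite !drop0; lia.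
by move=> L; have := shape_stratum_point d_gt0 le_dj shH L; rewrite /dn_dims /up_dims sc.
Qed.

Lemma closure_meets (k : fieldType) : stratum_in_closure k d j H' H -> stratum_meets_closure k d j H' H.
Proof.
move=> inH; have [V GV] := @Grass_nonempty _ _ d_gt0 le_dj _ _ _ shH' k.
by exists k, idfun, V; split=> //; apply: inH.
Qed.

(** One common point is enough: semicontinuity compares its dimensions, those of its own stratum,
    with those of the stratum in whose closure it lies. *)
Lemma meets_P_ge (k : fieldType) : stratum_meets_closure k d j H' H -> P_ge j H' H.
Proof.
case=> K [emb [V [/(GrassP d_gt0 le_dj shH')[dimV SV] /(in_closureP d_gt0 le_dj emb V shH)[_ clV]]]].
have [Vf VS] : stratum (dn_dims P') (up_dims d j Q') (coef_mx d V) by apply/stratum_coef_mx.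
apply/P_ge_dims; split=> i; have [dV uV] := VS i.
  apply: (dn_dim_cl Vf clV dV) => [L lam U [_ /(_ i)[dU _]]|]; first by exists (dn_dims P i).
  have [[/= pP sP _ _ _] _ _] := shH; rewrite (shape_dn_dims shH).
  by have := sumn_take_drop P i; lia.
have := up_dim_cl Vf clV uV; move=> /(_ ((j + i).+1 - up_dims d j Q i)) le_up.
have : (j + i).+1 - up_dims d j Q' i <= (j + i).+1 - up_dims d j Q i.
  by apply: le_up => L lam U [_ /(_ i)[_ uU]]; exists ((j + i).+1 - up_dims d j Q i).
have [[/= _ _ _ sQ _] _ Qhigh] := shH; rewrite (shape_up_dims d_gt0 le_dj shH).
have := Qhigh i; have := sumn_take_drop Q i; lia.
Qed.

End Specialization.

Theorem theoremE (k : fieldType) (d j : nat) :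
  infinite_field k -> (0 < d)%N -> (d <= j)%N ->
  (* beta is a bijection from the acceptable sequences onto PA(d,j) *)
  [/\ forall H : nat -> nat, acceptable d j H -> PA d j (beta j H),
      forall H H' : nat -> nat, acceptable d j H -> acceptable d j H' ->
        beta j H = beta j H' -> forall i, H i = H' i
    & forall PQ : seq nat * seq nat, PA d j PQ ->
        exists H : nat -> nat, acceptable d j H /\ beta j H = PQ]
  (* the two orders correspond; the order in which H' >= H means that H' is
     the more special sequence is carried to the opposite of majorization *)
  /\ (forall H H' : nat -> nat, acceptable d j H -> acceptable d j H' ->
        (P_ge j H' H <-> PA_le (beta j H') (beta j H)))
  (* P(H) and Q(H) are the conjugates of A(H) and B(H) *)
  /\ (forall H : nat -> nat, acceptable d j H ->
        (exists A B : seq nat, AB_partitions k d j H A B) /\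
        (forall A B : seq nat, AB_partitions k d j H A B ->
           Ppart j H = conj_partition A /\ Qpart j H = conj_partition B))
  (* the order is the one induced by specialization of the strata *)
  /\ (forall H H' : nat -> nat, acceptable d j H -> acceptable d j H' ->
        (P_ge j H' H <-> stratum_in_closure k d j H' H) /\
        (P_ge j H' H <-> stratum_meets_closure k d j H' H)).
Proof.
move=> _ d_gt0 le_dj; have sh H := @acceptable_shape d j H d_gt0 le_dj.
split; first split=> [H /sh[] //|H H' /sh[_ Hlow Hhigh] /sh[_ Hlow' Hhigh'] [eP eQ] i|[P Q]].
- case: (leqP i j) => [lei|/ltnW lei].
    by have := Hlow i lei; have := Hlow' i lei; rewrite eP; lia.
  have := Hhigh (i - j); have := Hhigh' (i - j); rewrite subnKC // eQ; lia.
- case/(shape_ex d_gt0 le_dj) => H shH; exists H.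
  have accH := shape_acceptable d_gt0 le_dj shH; split=> //.
  by have [eP eQ] := shape_uniq d_gt0 le_dj shH (sh H accH); rewrite /beta eP eQ.
split; first by move=> H H' /sh shH /sh shH'; exact: (P_ge_shape d_gt0 le_dj shH shH').
split=> [H /sh shH|H H' /sh shH /sh shH'].
  split; last by move=> A B; apply: (AB_uniq d_gt0 le_dj shH).
  by do 2 eexists; apply: (AB_conj k d_gt0 le_dj shH).
(* The three conditions are closed into a cycle; nonemptiness of the special stratum gives the
   passage from containment in the closure to meeting it. *)
have cl_of_ge := @P_ge_closure _ _ _ _ _ _ _ _ d_gt0 le_dj shH shH' k.
have meets_of_cl := @closure_meets _ _ _ _ H _ d_gt0 le_dj shH' k.
have ge_of_meets := @meets_P_ge _ _ _ _ _ _ _ _ d_gt0 le_dj shH shH' k.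
by split; split=> [/cl_of_ge cl|] //; [move/meets_of_cl/ge_of_meets | apply: meets_of_cl].
Qed.
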